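(* Let $\varepsilon>0$, $P=m$, and $h=\sigma^2$. Let $u\in W^{P+1,2}(\Omega)$ and let the particle approximation $u_h\in W^{-(P+1),2}(\Omega)$ satisfy $$\|u_h-u\|_{W^{-(P+1),2}(\Omega)}\leq Ch^{P+1}\|u\|_{W^{P+1,2}(\Omega)}.$$ Then for $\sigma>0$ small enough the solution $u_\sigma\in V_\sigma^P(\Omega_\sigma)$ of $$A(u_\sigma,v_\sigma)=\langle u_h,v_\sigma\rangle\qquad\forall v_\sigma\in V_\sigma^P(\Omega_\sigma),$$ where $A(w,v)=\int_\Omega wv\,\mathrm{d}x+\varepsilon j(w,v)$, fulfills $$\|u_\sigma-u\|_{W^{-(P+1),2}(\Omega)}\leq C(\varepsilon)h^{P+1}\|u\|_{W^{P+1,2}(\Omega)},$$ with a constant $C(\varepsilon)$ independent of $\sigma$ (equivalently $h$) and $u$.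
   Context: Grid. Let $d\in\mathbb{N}$, $P\in\mathbb{N}_0$, $\sigma>0$. For $i\in\mathbb{Z}^d$ let $x_i:=(i_1\sigma,\ldots,i_d\sigma)$ be the Cartesian grid points (nodes), $\Omega_i:=\prod_{l=1}^d((i_l-1)\sigma,(i_l+1)\sigma)$ the patches, $\omega_i:=\prod_{l=1}^d((i_l-\tfrac12)\sigma,(i_l+\tfrac12)\sigma)$ the patch-cores, and $Q_i:=\prod_{l=1}^d(i_l\sigma,(i_l+1)\sigma)$ the elements. Partition of unity. Let $\zeta:\mathbb{R}\to\mathbb{R}$, $\zeta(x)=K^{-1}\exp(-1/(1-4x^2))$ for $|x|<\tfrac12$ and $\zeta(x)=0$ otherwise, with $K>0$ such that $\|\zeta\|_{L^1(\mathbb{R})}=1$; on $\mathbb{R}^d$ put $\zeta(x)=\prod_{l=1}^d\zeta(x_l)$ and $\zeta_\sigma(x)=\sigma^{-d}\zeta(x/\sigma)$. Set $\varphi_i:=\chi_{\omega_i}\star\zeta_\sigma$ (convolution with the characteristic function of $\omega_i$). The $\varphi_i$ are $C^\infty$, have support $\operatorname{clos}\Omega_i$, and sum to $1$. Domains. $\Omega\subset\mathbb{R}^d$ is a bounded domain for which Stein's extension theorem holds (there is a bounded linear extension operator $W^{k,2}(\Omega)\to W^{k,2}(\mathbb{R}^d)$ for every $k\in\mathbb{N}$). The fictitious domain is $\Omega_\sigma:=\operatorname{int}\bigcup\lbrace\operatorname{clos}Q_i\mid\operatorname{meas}_d(Q_i\cap\Omega)>0\rbrace$; the cut part is $\Omega_\sigma^\Gamma:=\operatorname{int}\bigcup\lbrace\operatorname{clos}Q_i\mid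 Q_i\subset\Omega_\sigma,\ Q_i\not\subset\Omega\rbrace$; the uncut part is $\Omega_\sigma^\circ:=\operatorname{int}\bigcup\lbrace\operatorname{clos}Q_i\mid Q_i\subset\Omega_\sigma,\ Q_i\subset\Omega\rbrace$. One writes $Q_i\in\Omega_\sigma^\Gamma$ for $Q_i\subset\Omega_\sigma^\Gamma$, and similarly for the other domains. Two elements are neighbors if they share at least one grid node. Standing assumption: for every $Q_i\in\Omega_\sigma^\Gamma$ there is a finite sequence $(Q_i=Q_{i,1},\ldots,Q_{i,K})$ of elements in $\Omega_\sigma^\Gamma$ with $K$ bounded independently of $\sigma$, any two subsequent elements being neighbors, and $Q_{i,K}$ having a neighbor in $\Omega_\sigma^\circ$ (if necessary, this is enforced by moving additional elements from $\Omega_\sigma^\circ$ to $\Omega_\sigma^\Gamma$). Space and forms. $V_\sigma^P(\Omega_\sigma)$ is the span of the functions $\varphi_i x^\alpha$, $|\alpha|\leq P$, $i\in\mathbb{Z}^d$, restricted to $\Omega_\sigma$. The stabilization form is $$j(u,v):=\sigma^{2(P+1)}\sum_{Q_i\in\Omega_\sigma^\Gamma}\sum_{|\alpha|=P+1}\int_{Q_i}(\partial^\alpha u)(\partial^\alpha v)\,\mathrm{d}x.$$ Local approximation (Bramble--Hilbert) assumption. For all $i$ with $\Omega_i\cap\Omega_\sigma\neq\emptyset$ and all $w\in W^{P+1,2}(\Omega_\sigma\cap\Omega_i)$ there is a polynomial $v_i$ of total degree at most $P$ with $|w-v_i|_{W^{k,2}(\Omega_\sigma\cap\Omega_i)}\leq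 C\sigma^{P+1-k}|w|_{W^{P+1,2}(\Omega_\sigma\cap\Omega_i)}$ for all $k\in\mathbb{N}_0$, $k\leq P+1$, with $C$ independent of $\sigma$ and $w$ (and of how $\partial\Omega$ intersects the grid). Here $|w|_{W^{k,2}}^2=\sum_{|\alpha|=k}\|\partial^\alpha w\|_{L^2}^2$. Dual spaces. $W^{-k,2}(\Omega):=W^{k,2}(\Omega)'$ is the dual of the full space $W^{k,2}(\Omega)$ (not of $W^{k,2}_0(\Omega)$), $\langle\cdot,\cdot\rangle$ is the duality pairing, and functions in $L^2(\Omega)$ act on $W^{k,2}(\Omega)$ by integration over $\Omega$; $\langle u_h,v_\sigma\rangle$ means $u_h$ applied to the restriction $v_\sigma|_\Omega$. It is assumed that $m+1>d/2$, i.e. $P+1>d/2$. The constant $C$ in the error bound for $u_h$ is independent of $u$ and $h$. *)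

(* Defs.v *)
From HB Require Import structures.
From mathcomp Require Import all_boot all_order all_algebra.
From mathcomp Require Import all_classical all_reals all_analysis.

Set Implicit Arguments.
Unset Strict Implicit.
Unset Printing Implicit Defensive.

Import Order.TTheory GRing.Theory Num.Theory.
Import numFieldNormedType.Exports.

Local Open Scope classical_set_scope.
Local Open Scope ring_scope.

Definition rV_display : measure_display.
Proof. exact: default_measure_display. Qed.

(* [R^n] is ['rV[R]_n] with the product sigma-algebra, generated by the
   coordinates; it coincides with the Borel sigma-algebra. *)
Section rV_measurable.
Context {R : realType}.
Variable n : nat.

Let coord : 'I_n -> 'rV[R]_n -> measurableTypeR R := fun i x => x ord0 i.

Let rV_set0 : g_sigma_preimage coord set0.
Proof. exact: sigma_algebra0. Qed.

Let rV_setC A : g_sigma_preimage coord A -> g_sigma_preimage coord (~` A).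
Proof. exact: sigma_algebraC. Qed.

Let rV_bigcup (F : (set 'rV[R]_n)^nat) :
  (forall i, g_sigma_preimage coord (F i)) ->
  g_sigma_preimage coord (\bigcup_i (F i)).
Proof. exact: sigma_algebra_bigcup. Qed.

HB.instance Definition _ :=
  @isMeasurable.Build rV_display
  'rV[R]_n (g_sigma_preimage coord) rV_set0 rV_setC rV_bigcup.

Lemma measurable_coord (i : 'I_n) :
  measurable_fun [set: 'rV[R]_n] (fun x => x ord0 i : measurableTypeR R).
Proof.
move=> _ Y mY; rewrite setTI; apply: sub_sigma_algebra => /=.
rewrite -bigcup_seq/=; exists i => /=; first by rewrite mem_index_enum.
by exists Y => //; rewrite setTI.
Qed.

Lemma measurable_fun_coordP d (T : measurableType d) (f : T -> 'rV[R]_n) :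
  (forall i, measurable_fun [set: T]
     (fun t => f t ord0 i : measurableTypeR R)) ->
  measurable_fun [set: T] f.
Proof.
move=> mf _ A mA; rewrite setTI.
suff : g_sigma_preimage coord `<=` [set B | measurable (f @^-1` B)] by exact.
apply: smallest_sub.
  split => /=; first by rewrite preimage_set0.
    by move=> B mB; rewrite setTD -preimage_setC; exact: measurableC.
  by move=> F mF; rewrite preimage_bigcup; exact: bigcup_measurable.
rewrite -bigcup_seq => B [i _ [C mC <-]] /=.
by rewrite setTI -[X in measurable X]setTI; exact: mf.
Qed.

End rV_measurable.

Section lebesgue_rV.
Context {R : realType}.

Definition rV_cons n (p : measurableTypeR R * 'rV[R]_n) : 'rV[R]_n.+1 :=
  \row_i if unlift ord0 i is Some j then p.2 ord0 j else p.1.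

Lemma measurable_rV_cons n : measurable_fun setT (@rV_cons n).
Proof.
apply: measurable_fun_coordP => i.
under eq_fun do rewrite mxE.
case: (unlift ord0 i) => [j|]; last exact: measurable_fst.
exact: (measurableT_comp (measurable_coord j) measurable_snd).
Qed.

Section leb_cons.
Variables (n : nat) (mu : {measure set 'rV[R]_n -> \bar R}).

Definition leb_cons : set 'rV[R]_n.+1 -> \bar R :=
  pushforward (@lebesgue_measure R \x^ mu)%E (@rV_cons n).

Let leb_cons0 : leb_cons set0 = 0%E.
Proof. by rewrite /leb_cons /pushforward preimage_set0 measure0. Qed.

Let leb_cons_ge0 A : (0 <= leb_cons A)%E.
Proof. by rewrite /leb_cons /pushforward measure_ge0. Qed.

Let leb_cons_sigma_additive : semi_sigma_additive leb_cons.
Proof.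
have mc := @measurable_rV_cons n.
exact: measure_semi_sigma_additive.
Qed.

HB.instance Definition _ := isMeasure.Build _ _ _ leb_cons
  leb_cons0 leb_cons_ge0 leb_cons_sigma_additive.

End leb_cons.

(* Lebesgue measure on [R^n], as an iterated product measure. *)
Fixpoint leb n : {measure set 'rV[R]_n -> \bar R} :=
  if n is n'.+1 then leb_cons (leb n') else \d_(0 : 'rV[R]_0).

End lebesgue_rV.

Section sobolev.
Context {R : realType} {d : nat}.
Notation Rd := 'rV[R]_d.
Implicit Types (U : set Rd) (f g psi u v w : Rd -> R).

(* The multi-indices with entries at most [k]: every multi-index of order at
   most [k] is one of these. *)
Definition multi (k : nat) := {ffun 'I_d -> 'I_k.+1}.

Definition morder k (a : multi k) : nat := (\sum_l a l)%N.

Definition monomial k (a : multi k) (x : Rd) : R := \prod_l x ord0 l ^+ a l.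

Definition iter_partial (s : seq 'I_d) f : Rd -> R :=
  foldr (fun l g => 'D_(delta_mx ord0 l : Rd) g) f s.

Definition smooth f := forall s : seq 'I_d,
  continuous (iter_partial s f) /\
  forall (l : 'I_d) (x : Rd),
    derivable (iter_partial s f) x (delta_mx ord0 l).

Definition partial k (a : multi k) f : Rd -> R :=
  iter_partial (flatten [seq nseq (a l) l | l <- enum 'I_d]) f.

Definition test_function U psi :=
  smooth psi /\
  exists K : set Rd,
    [/\ compact K, K `<=` U & forall x, ~ K x -> psi x = 0].

Definition L2 U f :=
  measurable_fun U f /\ (leb d).-integrable U (fun x => (f x ^+ 2)%:E).

Definition weak_partial U k (a : multi k) f g :=
  forall psi, test_function U psi ->
    \int[leb d]_(x in U) (f x * partial a psi x) =
    (-1) ^+ morder a * \int[leb d]_(x in U) (g x * psi x).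

(* A choice of the weak derivative, which is unique up to equality almost
   everywhere on [U]. *)
Definition wpartial U k (a : multi k) f : Rd -> R :=
  xget (fun=> 0) [set g | L2 U g /\ weak_partial U a f g].

(* The elements of [W^{k,2}(U)] are represented by functions on the whole of
   [R^d], of which only the values on [U] matter. *)
Definition sobolev k U : set (Rd -> R) :=
  [set f | L2 U f /\ forall a : multi k, (morder a <= k)%N ->
             exists g, L2 U g /\ weak_partial U a f g].

Definition seminorm k U f : R :=
  Num.sqrt (\sum_(a : multi k | morder a == k)
              \int[leb d]_(x in U) (wpartial U a f x ^+ 2)).

Definition sobolev_norm k U f : R :=
  Num.sqrt (\sum_(a : multi k | (morder a <= k)%N)
              \int[leb d]_(x in U) (wpartial U a f x ^+ 2)).

(* [W^{-k,2}(U)], the dual of the full space [W^{k,2}(U)].  Boundedness makes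
   its elements respect equality almost everywhere on [U]. *)
Definition sobolev_dual k U : set ((Rd -> R) -> R) :=
  [set F | (forall (c : R) f g, sobolev k U f -> sobolev k U g ->
              F (fun x => c * f x + g x) = c * F f + F g) /\
           exists C : R, forall f, sobolev k U f ->
              `|F f| <= C * sobolev_norm k U f].

Definition dual_norm k U (F : (Rd -> R) -> R) : \bar R :=
  ereal_sup [set `|F f|%:E |
             f in [set f | sobolev k U f /\ sobolev_norm k U f <= 1]].

Definition L2_functional U u : (Rd -> R) -> R :=
  fun f => \int[leb d]_(x in U) (u x * f x).

Definition has_extension k U :=
  exists (E : (Rd -> R) -> Rd -> R) (C : R),
    (forall (c : R) f g, sobolev k U f -> sobolev k U g ->
       {ae leb d, forall x, E (fun y => c * f y + g y) x = c * E f x + E g x})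
    /\ forall f, sobolev k U f ->
       [/\ sobolev k setT (E f),
           {ae leb d, forall x, U x -> E f x = f x} &
           sobolev_norm k setT (E f) <= C * sobolev_norm k U f].

End sobolev.

Section grid.
Context {R : realType} {d : nat}.
Variable sigma : R.
Notation Rd := 'rV[R]_d.
Notation index := {ffun 'I_d -> int}.
Implicit Types (i j k : index) (Omega : set Rd).

Definition node i : Rd := \row_l ((i l)%:~R * sigma).

Definition patch_dom i : set Rd :=
  [set x | forall l, ((i l)%:~R - 1) * sigma < x ord0 l
                     < ((i l)%:~R + 1) * sigma].

Definition core i : set Rd :=
  [set x | forall l, ((i l)%:~R - 2^-1) * sigma < x ord0 l
                     < ((i l)%:~R + 2^-1) * sigma].

Definition elem i : set Rd :=
  [set x | forall l, (i l)%:~R * sigma < x ord0 l < ((i l)%:~R + 1) * sigma].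

(* [zeta1] below is [bump] divided by its L^1 norm. *)
Definition bump (t : R) : R :=
  if `|t| < 2^-1 then expR (- (1 - 4 * t ^+ 2)^-1) else 0.

Definition zeta1 (t : R) : R :=
  (\int[@lebesgue_measure R]_s bump s)^-1 * bump t.

Definition zeta (x : Rd) : R := \prod_l zeta1 (x ord0 l).

Definition zeta_sigma (x : Rd) : R := sigma ^- d * zeta (sigma^-1 *: x).

Definition phi i (x : Rd) : R :=
  \int[leb d]_y (\1_(core i) y * zeta_sigma (x - y)).

Definition neighbor i j :=
  exists k, closure (elem i) (node k) /\ closure (elem j) (node k).

(* The interior of the union of the closed elements with index in [I]. *)
Definition elems_dom (I : set index) : set Rd :=
  interior (\bigcup_(i in I) closure (elem i)).

Definition fict_dom Omega : set Rd :=
  elems_dom [set i | (0 < leb d (elem i `&` Omega))%E].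

(* [M] is the set of the additional elements moved from the uncut to the cut
   part in order to enforce [chain_condition]; [M = set0] if none is moved. *)
Definition cut_dom Omega (M : set index) : set Rd :=
  elems_dom [set i | elem i `<=` fict_dom Omega /\
                     (~ (elem i `<=` Omega) \/ M i)].

Definition uncut_dom Omega (M : set index) : set Rd :=
  elems_dom [set i | [/\ elem i `<=` fict_dom Omega,
                         elem i `<=` Omega & ~ M i]].

Definition chain_condition Omega (M : set index) (K : nat) :=
  forall i, elem i `<=` cut_dom Omega M ->
  exists (n : nat) (q : nat -> index),
    [/\ (n < K)%N, q 0%N = i,
        forall r, (r <= n)%N -> elem (q r) `<=` cut_dom Omega M,
        forall r, (r < n)%N -> neighbor (q r) (q r.+1) &
        exists j, elem j `<=` uncut_dom Omega M /\ neighbor (q n) j].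

Definition local_approximation Omega (P : nat) (C : R) :=
  forall i, fict_dom Omega `&` patch_dom i !=set0 ->
  forall w : Rd -> R, sobolev P.+1 (fict_dom Omega `&` patch_dom i) w ->
  exists c : multi P -> R,
    let v x := \sum_(a : multi P | (morder a <= P)%N) c a * monomial a x in
    forall k : nat, (k <= P.+1)%N ->
      seminorm k (fict_dom Omega `&` patch_dom i) (fun x => w x - v x) <=
      C * sigma ^+ (P.+1 - k) *
        seminorm P.+1 (fict_dom Omega `&` patch_dom i) w.

(* Functions on [fict_dom Omega] are extended by zero. *)
Definition V_space Omega (P : nat) : set (Rd -> R) :=
  [set v | exists (s : seq index) (c : index -> multi P -> R),
     v = (fun x => \sum_(i <- s) \sum_(a : multi P | (morder a <= P)%N)
                     c i a * (phi i x * monomial a x)) \_ (fict_dom Omega)].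

Definition stab_form Omega (M : set index) (P : nat) (u v : Rd -> R) : R :=
  sigma ^+ (2 * P.+1) *
  \sum_(i \in [set i | elem i `<=` cut_dom Omega M])
    \sum_(a : multi P.+1 | morder a == P.+1)
      \int[leb d]_(x in elem i)
        (wpartial (fict_dom Omega) a u x * wpartial (fict_dom Omega) a v x).

Definition A_form Omega (M : set index) (P : nat) (eps : R)
    (w v : Rd -> R) : R :=
  \int[leb d]_(x in Omega) (w x * v x) + eps * stab_form Omega M P w v.

Definition is_solution Omega (M : set index) (P : nat) (eps : R)
    (F : (Rd -> R) -> R) (us : Rd -> R) :=
  V_space Omega P us /\
  forall vs, V_space Omega P vs ->
    A_form Omega M P eps us vs = F (vs \_ Omega).

End grid.

(* Main.v *)
(* On an element rescaled to the unit cube, the functions of V_sigma^P form one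
   fixed finite-dimensional space, on which a quadratic form dominates every
   quadratic form that vanishes on its kernel.  This gives inverse estimates,
   and for neighbors Q, Q' the bound
     |v|_Q^2 <= C (|v|_Q'^2 + sigma^(2(P+1)) |D^(P+1) v|_Q^2):
   if v vanishes on Q' and its derivatives of order P + 1 vanish on Q, then v is
   on Q a polynomial of degree P whose derivatives all vanish at a common node,
   hence v = 0 on Q.  Following the chains of cut elements one obtains
     |v|_(Omega_sigma)^2 <= C (|v|_Omega^2 + j(v, v)).
   Gluing the local polynomial approximations v_i of an extension w of a
   function on Omega yields g = sum_i phi_i v_i with |w - g|_Omega and
   j(g, g)^(1/2) of order sigma^(P+1) |w|, and |g|_(W^(P+1,2)) <= C |w|.

   With k = P + 1, let g_u interpolate u and put e = u_sigma - g_u.  Then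
     A(e, e) = <u_h - u, e> + (u - g_u, e) - eps j(g_u, e),
   and h^k = sigma^(2k) compensates for the inverse estimate in the first term,
   so that A(e, e) <= C sigma^(2k) |u|^2.  For a test function f with interpolant
   g_f,
     (u_sigma - u, f) = (u_sigma - u, f - g_f) + <u_h - u, g_f>
                        - eps j(u_sigma, g_f),
   where every term is of order sigma^(2k) = h^k. *)

Require Import Defs.
From HB Require Import structures.
From mathcomp Require Import all_boot all_order all_algebra.
From mathcomp Require Import all_classical all_reals all_analysis measurable_realfun.
From mathcomp Require Import zify ring lra.
Import Order.TTheory GRing.Theory Num.Theory.
Import numFieldNormedType.Exports.

Set Implicit Arguments.
Unset Strict Implicit.
Unset Printing Implicit Defensive.
Local Open Scope classical_set_scope.
Local Open Scope ring_scope.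

(** * Smooth functions of one variable *)

(** The constants may depend neither on [sigma] nor on how the boundary of [Omega] cuts the grid.
    Pulled back to the unit grid around an element, the functions phi_j x^alpha stay in the span of
    translates of [phi1] times powers of bounded degree, and up to translation only finitely many
    pairs of neighboring elements occur; a matrix argument yields one constant for each of them.

    The functions phi_i x^alpha may be linearly dependent on an element or on the fictitious domain,
    so every form is only semidefinite on coefficient vectors. Hence domination is expressed through
    kernels, the discrete problem is solved through a compatibility condition, and uniqueness
    concerns the function u_sigma rather than its coefficients.

    A weak derivative is merely chosen, not computed. Every function that is differentiated
    explicitly is a finite sum of tensor products of smooth functions of one variable; integration
    by parts and the fundamental lemma of the calculus of variations identify the chosen weak
    derivatives with the classical ones almost everywhere. *)

Section smooth1.
Context {R : realType}.
Implicit Types (f g : R -> R) (n : nat).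

(** The index is shifted by one: [Cn n f] asks for derivatives up to order [n.+1], so that even
    [Cn 0] gives differentiability. Only the conjunction over all [n] matters. *)
Fixpoint Cn n f : Prop :=
  (forall x, derivable f x 1) /\ if n is n'.+1 then Cn n' (derive1 f) else True.

Definition smooth1 f := forall n, Cn n f.

Lemma Cn_derivable n f x : Cn n f -> derivable f x 1.
Proof. by case: n => [|n] []. Qed.

Lemma smooth1_derivable f x : smooth1 f -> derivable f x 1.
Proof. by move=> /(_ 0%N); exact: Cn_derivable. Qed.

Lemma CnW n f : Cn n.+1 f -> Cn n f.
Proof.
by elim: n f => [|n IHn] f [df Cf]; split; [exact: df|by []|exact: df|exact: IHn].
Qed.

Lemma smooth1_derive f : smooth1 f -> smooth1 (derive1 f).
Proof. by move=> sf n; case: (sf n.+1). Qed.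

Lemma smooth1_deriven f n : smooth1 f -> smooth1 (derive1n n f).
Proof.
by elim: n => [//|n IHn] sf; rewrite derive1nS; apply/smooth1_derive/IHn.
Qed.

Lemma derivable_continuous f : (forall x, derivable f x 1) -> continuous f.
Proof. by move=> df x; apply/differentiable_continuous/derivable1_diffP. Qed.

Lemma smooth1_continuous f : smooth1 f -> continuous f.
Proof.
by move=> sf; apply: derivable_continuous => x; exact: smooth1_derivable.
Qed.

Lemma Cn_cst n (c : R) : Cn n (cst c).
Proof.
elim: n c => [|n IHn] c /=; first by split.
split=> //; rewrite (_ : derive1 (cst c) = cst 0) //.
by apply/funext => x; rewrite derive1_cst.
Qed.

Lemma CnD n f g : Cn n f -> Cn n g -> Cn n (fun x => f x + g x).
Proof.
elim: n f g => [|n IHn] f g [df Cf] [dg Cg].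
  by split; [move=> x; exact: derivableD|by []].
split; first by move=> x; exact: derivableD.
rewrite (_ : derive1 _ = fun x => (derive1 f) x + (derive1 g) x); first exact: IHn.
by apply/funext => x; rewrite !derive1E deriveD.
Qed.

Lemma CnM n f g : Cn n f -> Cn n g -> Cn n (fun x => f x * g x).
Proof.
elim: n f g => [|n IHn] f g [df Cf] [dg Cg].
  by split; [move=> x; exact: derivableM|by []].
split; first by move=> x; exact: derivableM.
have Cf1 : Cn n f by apply: CnW.
have Cg1 : Cn n g by apply: CnW.
rewrite (_ : derive1 _ = fun x => f x * (derive1 g) x + g x * (derive1 f) x).
  by apply: CnD; exact: IHn.
by apply/funext => x; rewrite !derive1E deriveM.
Qed.

Lemma Cn_comp n f g : Cn n f -> Cn n g -> Cn n (f \o g).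
Proof.
elim: n f g => [|n IHn] f g [df Cf] [dg Cg].
  split; last by [].
  move=> x; apply/derivable1_diffP.
  by apply: differentiable_comp; apply/derivable1_diffP.
split.
  move=> x; apply/derivable1_diffP.
  by apply: differentiable_comp; apply/derivable1_diffP.
rewrite (_ : derive1 _ = fun x => ((derive1 f) \o g) x * (derive1 g) x).
  by apply: CnM => //; apply: IHn => //; exact: CnW.
by apply/funext => x; rewrite derive1_comp.
Qed.

Lemma Cn_id n : Cn n (@id R).
Proof.
case: n => [|n]; first by split=> //= x; exact: derivable_id.
split=> [x|]; first exact: derivable_id.
rewrite (_ : derive1 id = (cst 1 : R -> R)); first exact: Cn_cst.
by apply/funext => x; rewrite derive1_id.
Qed.

Lemma smooth1_cst c : smooth1 (cst c).
Proof. by move=> n; exact: Cn_cst. Qed.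

Lemma smooth1D f g : smooth1 f -> smooth1 g -> smooth1 (fun x => f x + g x).
Proof. by move=> sf sg n; exact: CnD. Qed.

Lemma smooth1M f g : smooth1 f -> smooth1 g -> smooth1 (fun x => f x * g x).
Proof. by move=> sf sg n; exact: CnM. Qed.

Lemma smooth1Z c f : smooth1 f -> smooth1 (fun x => c * f x).
Proof. by move=> sf; apply: smooth1M => //; exact: smooth1_cst. Qed.

Lemma smooth1B f g : smooth1 f -> smooth1 g -> smooth1 (fun x => f x - g x).
Proof.
move=> sf sg; apply: smooth1D => //.
rewrite (_ : (fun x => - g x) = fun x => - 1 * g x); first exact: smooth1Z.
by apply/funext => x; rewrite mulN1r.
Qed.

Lemma smooth1_aff f a b : smooth1 f -> smooth1 (fun x => f (a * x + b)).
Proof.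
move=> sf n; apply: (@Cn_comp _ f (fun x => a * x + b)) => //.
apply: CnD; last exact: Cn_cst.
by apply: CnM; [exact: Cn_cst|exact: Cn_id].
Qed.

Lemma smooth1X n : smooth1 (fun x : R => x ^+ n).
Proof.
elim: n => [|n IHn]; first exact: smooth1_cst.
rewrite (_ : (fun x => x ^+ n.+1) = fun x => x * x ^+ n).
  by apply: smooth1M => // k; exact: Cn_id.
by apply/funext => x; rewrite exprS.
Qed.

End smooth1.

(** * The bump function: smoothness and normalization *)

Section bump.
Context {R : realType}.
Implicit Types (p : {poly R}) (t x : R).

(* The derivative of [pexp p] is again of this form, with [p] replaced by
   ['X^2 * (p - p^`())]. *)
Definition pexp p t : R := if 0 < t then p.[t^-1] * expR (- t^-1) else 0.

(** A single term of the exponential series is at most the whole series. *)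
Lemma expR_pow_bound n x : 0 <= x -> x ^+ n * expR (- x) <= n`!%:R.
Proof.
move=> x0; rewrite expRN ler_pdivrMr ?expR_gt0//.
case: n => [|n].
  by rewrite expr0 fact0 mul1r -expR0 ler_expR.
have := expR_ge1Dxn n x0; set F := _%:R => h.
have F0 : 0 < F by rewrite ltr0n fact_gt0.
have : x ^+ n.+1 / F <= expR x by lra.
by rewrite ler_pdivrMr// mulrC.
Qed.

(** With [x = t^-1] this says that [pexp p t] is of order [t ^ 2] near the origin, one power more
    than a vanishing derivative at 0 requires of a difference. *)
Lemma poly_expR_bound p : exists C, forall x, 1 <= x ->
  `|p.[x] * expR (- x)| <= C / x ^+ 2.
Proof.
exists (\sum_(i < size p) `|p`_i| * (i + 2)`!%:R) => x x1.
have x0 : 0 < x by apply: lt_le_trans x1.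
rewrite horner_coef mulr_suml mulr_suml.
apply: le_trans (ler_norm_sum _ _ _) _; apply: ler_sum => i _.
rewrite !normrM -!mulrA ler_wpM2l//.
rewrite ger0_norm ?exprn_ge0 ?(ltW x0)// ger0_norm ?expR_ge0//.
rewrite ler_pdivlMr ?exprn_gt0//.
by rewrite mulrAC -exprD expR_pow_bound// ltW.
Qed.

Lemma is_derive_inv x : x != 0 ->
  is_derive x 1 (fun t : R => t^-1) (- x ^- 2).
Proof.
move=> x0; have := @is_deriveV R id x 1 1 x0 (is_derive_id _ _).
by rewrite [_ *: _]mulr1.
Qed.

Lemma pexp_derive p x :
  is_derive x 1 (pexp p) (pexp ('X^2 * (p - deriv p)) x).
Proof.
have [x0|x0|->] := ltgtP x 0.
- rewrite [X in is_derive _ _ _ X]/pexp ltNge (ltW x0)/=.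
  apply: (@near_eq_is_derive _ _ _ (cst (0:R))).
  near=> y; rewrite /pexp ltNge (_ : y <= 0)//.
  by apply: ltW; near: y; exact: lt_nbhsl.
- have xn0 : x != 0 by rewrite gt_eqF.
  apply: (@near_eq_is_derive _ _ _
    (fun t => p.[t^-1] * expR (- t^-1))).
    near=> y; rewrite /pexp (_ : 0 < y)//.
    by near: y; exact: lt_nbhsr.
  have dV := is_derive_inv xn0.
  have dN : is_derive x 1 (fun t : R => - t^-1) (x ^- 2).
    by apply: is_derive_eq; rewrite opprK.
  have dE : is_derive x 1 (expR \o (fun t : R => - t^-1))
      (expR (- x^-1) * x ^- 2).
    exact: is_derive1_comp.
  have dP : is_derive x 1 (horner p \o (fun t : R => t^-1))
      ((deriv p).[x^-1] * - x ^- 2).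
    exact: is_derive1_comp.
  have := is_deriveM dP dE.
  set D1 := (X in is_derive _ _ _ X -> _) => h.
  rewrite [X in is_derive _ _ _ X](_ : _ = D1); first exact: h.
  rewrite /pexp x0 /D1 /= !hornerE /= /GRing.scale/=.
  by field.
(* At the origin the difference quotient is 0 on the left and, by [poly_expR_bound], at most [C * h]
   on the right. *)
- rewrite [X in is_derive _ _ _ X]/pexp ltxx.
  have [C hC] := poly_expR_bound p.
  suff h : (fun h : R => h^-1 *: (pexp p (h *: 1 + 0) - pexp p 0)) @ 0^' --> (0 : R).
    split; first by apply/cvg_ex; exists 0; exact: h.
    by apply/cvg_lim; [exact: Rhausdorff|exact: h].
  have C0 : 0 <= C.
    have := hC 1 (lexx _); rewrite expr1n divr1; apply: le_trans; exact: normr_ge0.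
  apply/cvgr0Pnorm_le => e e0.
  near=> h.
  have h0 : h != 0 by near: h; exact: nbhs_dnbhs_neq.
  rewrite /pexp ltxx subr0 addr0 [h *: 1]mulr1.
  case: ifPn => [hp|_]; last by rewrite scaler0 normr0 ltW.
  have h1 : h <= 1.
    by rewrite -(gtr0_norm hp); near: h; exact: dnbhs0_le.
  have := hC h^-1; rewrite invf_cp1 ?hp// => /(_ h1) {}hC.
  rewrite normrZ normfV gtr0_norm// ler_pdivrMl//.
  apply: (le_trans hC); rewrite exprVn invrK expr2 mulrA mulrC ler_pM2l//.
  have hC' : h <= e / (C + 1).
    by rewrite -(gtr0_norm hp); near: h; apply: dnbhs0_le; rewrite divr_gt0// ltr_wpDl.
  have : (C + 1) * h <= e by rewrite mulrC -ler_pdivlMr// ltr_wpDl.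
  by apply: le_trans; rewrite ler_wpM2r// ?(ltW hp)//; lra.
Unshelve. all: by end_near. Qed.

Lemma smooth1_pexp p : smooth1 (pexp p).
Proof.
move=> n; elim: n p => [|n IHn] p.
  split=> [x|]; [by have [] := pexp_derive p x|by []].
split=> [x|]; first by have [] := pexp_derive p x.
rewrite (_ : derive1 (pexp p) = pexp ('X^2 * (p - deriv p))); first exact: IHn.
by apply/funext => x; rewrite derive1E; have [_ ->] := pexp_derive p x.
Qed.

(** Partial fractions of 1 / (1 - 4 t^2) separate the two singularities, so that the bump becomes a
    product of two one-sided exponentials. *)
Lemma bumpE t : Defs.bump t = pexp 1 (2 * (1 - 2 * t)) * pexp 1 (2 * (1 + 2 * t)).
Proof.
rewrite /Defs.bump /pexp !hornerE ltr_norml.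
case: (ltP t 2^-1) => h1; last first.
  by rewrite andbF [X in if X then _ else _](_ : _ = false) ?mul0r//; lra.
case: (ltP (- 2^-1) t) => h2 /=; last first.
  rewrite [X in _ * (if X then _ else _)](_ : _ = false) ?mulr0//.
  by apply/negbTE; rewrite -leNgt; lra.
rewrite !ifT; [|lra|lra].
have a1 : 0 < 1 - 2 * t by lra.
have a2 : 0 < 1 + 2 * t by lra.
have a3 : 0 < 1 - 4 * t * t by nra.
by rewrite -expRD; congr expR; field; rewrite !gt_eqF.
Qed.

Lemma smooth1_bump : smooth1 (@Defs.bump R).
Proof.
rewrite (_ : @Defs.bump R = fun t => pexp 1 (- 4 * t + 2) * pexp 1 (4 * t + 2)).
  by apply: smooth1M; apply: smooth1_aff; exact: smooth1_pexp.
by apply/funext => t; rewrite bumpE; congr (pexp _ _ * pexp _ _); ring.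
Qed.

Lemma bump_ge0 t : 0 <= Defs.bump t :> R.
Proof. by rewrite /Defs.bump; case: ifP => // _; exact: expR_ge0. Qed.

Lemma bump_eq0 t : 2^-1 <= `|t| -> Defs.bump t = 0 :> R.
Proof. by move=> h; rewrite /Defs.bump ltNge h. Qed.

Local Notation mu := (@lebesgue_measure R).

Lemma continuous_integrable_itv (f : R -> R) (a b : R) : continuous f ->
  mu.-integrable `[a, b] (EFin \o f).
Proof.
move=> cf; apply: continuous_compact_integrable; first exact: segment_compact.
exact: continuous_subspaceT.
Qed.

Lemma bump_int : \int[mu]_s Defs.bump s = \int[mu]_(s in `[- 2^-1, 2^-1]) Defs.bump s.
Proof.
rewrite [RHS]Rintegral_mkcond; apply: eq_Rintegral => x _.
rewrite patchE; case: ifPn => //; rewrite notin_setE/= in_itv/= => h.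
by apply: bump_eq0; rewrite ler_normr; apply/negPn/negP; lra.
Qed.

Lemma bump_int_gt0 : 0 < \int[mu]_s (Defs.bump s : R).
Proof.
have cb : continuous (@Defs.bump R) := smooth1_continuous smooth1_bump.
have ib := continuous_integrable_itv (- 2^-1) 2^-1 cb.
have c0 : 0 < Defs.bump (4^-1 : R).
  by rewrite /Defs.bump ifT ?expR_gt0// ltr_norml; lra.
rewrite bump_int.
(* The value at 1/4 is a positive lower bound on [0, 1/4], which already makes the integral
   positive. *)
have mono : (forall t : R, 0 <= t <= 4^-1 -> Defs.bump (4^-1 : R) <= Defs.bump t).
  move=> t t4; rewrite /Defs.bump !ifT ?ltr_norml; [|lra|lra].
  rewrite ler_expR lerN2 lef_pV2 ?posrE; [|nra|nra].
  by nra.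
apply: (@lt_le_trans _ _ (\int[mu]_(s in `[0, 4^-1]) (Defs.bump (4^-1 : R)))).
  rewrite Rintegral_cst//. rewrite [X in fine X](_ : _ = (4^-1)%:E); last first.
    apply: (etrans (lebesgue_measure_itv `[0, 4^-1])).
    by rewrite /= lte_fin ifT ?oppr0 ?adde0//; lra.
  by rewrite /= mulr_gt0//; lra.
apply: (@le_trans _ _ (\int[mu]_(s in `[0, 4^-1]) Defs.bump s)).
  apply: le_Rintegral => //.
  - by apply: continuous_integrable_itv => x; exact: cvg_cst.
  - exact: continuous_integrable_itv.
rewrite /Rintegral fine_le ?integrable_fin_num//; first exact: continuous_integrable_itv.
apply: ge0_subset_integral => //.
- by case/integrableP : ib.
- by move=> x _; rewrite lee_fin bump_ge0.
- by apply: subset_itv; rewrite bnd_simp; lra.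
Qed.

End bump.

Section zeta1.
Context {R : realType}.
Local Notation mu := (@lebesgue_measure R).
Implicit Types t x : R.

Lemma smooth1_zeta1 : smooth1 (@zeta1 R).
Proof. by apply: smooth1Z; exact: smooth1_bump. Qed.

Lemma zeta1_ge0 t : 0 <= zeta1 t :> R.
Proof. by rewrite mulr_ge0// ?invr_ge0 ?bump_ge0// ltW// bump_int_gt0. Qed.

Lemma zeta1_eq0 t : 2^-1 <= `|t| -> zeta1 t = 0 :> R.
Proof. by move=> /bump_eq0 t0; rewrite /zeta1 t0 mulr0. Qed.

(* [zeta1] vanishes on the left of [-1/2], so this is its primitive from [-oo]. *)
Definition zstep x : R := \int[mu]_(t in `[-1, x]) zeta1 t.

Lemma zeta1_integrable (a b : R) : mu.-integrable `[a, b] (EFin \o zeta1).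
Proof. exact/continuous_integrable_itv/smooth1_continuous/smooth1_zeta1. Qed.

Lemma zstep_le x : x <= - 2^-1 -> zstep x = 0.
Proof.
move=> h; rewrite /zstep (@eq_Rintegral _ _ _ mu _ (cst 0)) ?Rintegral_cst ?mul0r// => y.
rewrite inE/= in_itv/= => /andP[_ h1]; apply: zeta1_eq0.
by rewrite ler_normr; apply/orP; right; lra.
Qed.

Lemma zstep_ge x : 2^-1 <= x -> zstep x = 1.
Proof.
move=> h; rewrite /zstep.
transitivity (\int[mu]_(t in `[- 2^-1, 2^-1]) (zeta1 t : R)).
  rewrite [LHS]Rintegral_mkcond [RHS]Rintegral_mkcond; apply: eq_Rintegral => y _.
  rewrite !patchE.
  case: ifPn; rewrite ?notin_setE ?inE/= in_itv/= => h1;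
    case: ifPn; rewrite ?notin_setE ?inE/= in_itv/= => h2 //.
    by apply: zeta1_eq0; rewrite ler_normr; apply/negPn/negP; lra.
  by exfalso; lra.
rewrite /zeta1 RintegralZl//; last first.
  exact/continuous_integrable_itv/smooth1_continuous/smooth1_bump.
by rewrite -bump_int mulVf// gt_eqF// bump_int_gt0.
Qed.

Lemma zstep_derive x : is_derive x 1 zstep (zeta1 x).
Proof.
(* The fundamental theorem of calculus needs [x] to the right of the base point -1; for [x < -1/2]
   the function is locally zero instead. *)
have [x1|x1] := ltP x (- 2^-1).
  rewrite zeta1_eq0; last by rewrite ler_normr; apply/orP; right; lra.
  apply: (@near_eq_is_derive _ _ _ (cst 0)).
  by near=> y; rewrite /= zstep_le// ltW//; near: y; exact: lt_nbhsl.
have xx1 : x < x + 1 by rewrite ltrDl.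
have x1' : -1 < x by lra.
have cz : {for x, continuous (@zeta1 R)}.
  exact/smooth1_continuous/smooth1_zeta1.
have [d e] := continuous_FTC1_closed xx1 (zeta1_integrable _ _) x1' cz.
by split; [exact: d|rewrite -derive1E].
Unshelve. all: by end_near. Qed.

Lemma derive1_zstep : derive1 zstep = zeta1.
Proof.
by apply/funext => x; rewrite derive1E; have [_ ->] := zstep_derive x.
Qed.

Lemma smooth1_zstep : smooth1 zstep.
Proof.
have d x : derivable zstep x 1 by have [] := zstep_derive x.
case=> [|n]; split; [exact: d|by []|exact: d|].
by rewrite derive1_zstep; exact: smooth1_zeta1.
Qed.

Lemma zstep_homo x y : x <= y -> zstep x <= zstep y.
Proof.
move=> xy; rewrite /zstep /Rintegral fine_le ?integrable_fin_num//;
  [exact: zeta1_integrable|exact: zeta1_integrable|].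
apply: ge0_subset_integral => //.
- by case/integrableP : (zeta1_integrable (-1) y).
- by move=> t _; rewrite lee_fin zeta1_ge0.
- by apply: subset_itv; rewrite bnd_simp.
Qed.

Lemma zstep_ge0 x : 0 <= zstep x.
Proof. by apply: Rintegral_ge0 => t _; exact: zeta1_ge0. Qed.

Lemma zstep_le1 x : zstep x <= 1.
Proof.
have [h|h] := leP x 2^-1; last by rewrite zstep_ge// ltW.
by rewrite -(@zstep_ge 2^-1)//; exact: zstep_homo.
Qed.

(* By Fubini [phi sigma i] is the tensor product of the functions
   [fun t => phi1 (t / sigma - i l)]; this is [phiE]. *)
Definition phi1 t : R := zstep (t + 2^-1) - zstep (t - 2^-1).

Lemma smooth1_shift (f : R -> R) b : smooth1 f -> smooth1 (fun t => f (t + b)).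
Proof.
move=> sf; rewrite (_ : (fun t => _) = fun t => f (1 * t + b)).
  exact: smooth1_aff.
by apply/funext => t; rewrite mul1r.
Qed.

Lemma smooth1_phi1 : smooth1 phi1.
Proof. by apply: smooth1B; apply: smooth1_shift; exact: smooth1_zstep. Qed.

Lemma phi1_ge0 t : 0 <= phi1 t.
Proof. by rewrite subr_ge0; apply: zstep_homo; lra. Qed.

Lemma phi1_le1 t : phi1 t <= 1.
Proof. by have := zstep_ge0 (t - 2^-1); have := zstep_le1 (t + 2^-1); rewrite /phi1; lra. Qed.

Lemma phi1_eq0 t : 1 <= `|t| -> phi1 t = 0.
Proof.
rewrite /phi1 ler_normr => /orP[h|h].
  by rewrite !zstep_ge ?subrr; lra.
by rewrite !zstep_le ?subrr; lra.
Qed.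

(** The sum telescopes to [zstep (t + 1/2) - zstep (t - 3/2)], and on [0, 1] these two values are 1
    and 0. *)
Lemma phi1_partition t : 0 <= t <= 1 -> phi1 t + phi1 (t - 1) = 1.
Proof.
move=> h; rewrite /phi1 (_ : t - 1 + 2^-1 = t - 2^-1); last by lra.
rewrite (@zstep_ge (t + 2^-1)); last by lra.
by rewrite (@zstep_le (t - 1 - 2^-1)); lra.
Qed.

End zeta1.

(** * Lebesgue measure on R^d *)

Section rV_topology.
Context {R : realType} {n : nat}.
Notation Rn := 'rV[R]_n.
Implicit Types (x y : Rn) (A U : set Rn).

Lemma nbhs_rVP x A :
  nbhs x A <-> exists2 e : R, 0 < e &
    forall y, (forall l, `|y ord0 l - x ord0 l| < e) -> A y.
Proof.
split=> [/nbhs_ballP[e /= e0 eA]|[e e0 eA]].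
  exists e => // y xy; apply: eA; split=> // i j; rewrite (ord1 i).
  by rewrite /ball/= distrC.
apply/nbhs_ballP; exists e => //= y [_ xy]; apply: eA => l.
by rewrite distrC; exact: xy.
Qed.

Lemma measurable_box (I : 'I_n -> set R) : (forall l, measurable (I l)) ->
  measurable [set x : Rn | forall l, I l (x ord0 l)].
Proof.
move=> mI; rewrite (_ : [set _ | _] =
    \bigcap_(l in [set: 'I_n]) [set x : Rn | I l (x ord0 l)]).
  apply: fin_bigcap_measurable => [|l _]; first exact: finite_finset.
  rewrite -[X in measurable X]setTI.
  exact: (measurable_coord l measurableT (mI l)).
by apply/seteqP; split=> [x Ix l _|x Ix l]; exact: Ix.
Qed.

(** The sigma-algebra is generated by the coordinates, so an open set has to be written as a
    countable union of boxes; centers are rational and half-widths are of the form 1 / (k + 1). *)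
Lemma open_measurable_rV U : open U -> measurable U.
Proof.
move=> oU.
pose box (q : 'rV[rat]_n) (k : nat) : set Rn :=
  [set x | forall l, `|x ord0 l - ratr (q ord0 l)| < k.+1%:R^-1].
pose F (p : 'rV[rat]_n * nat) :=
  if `[< box p.1 p.2 `<=` U >] then box p.1 p.2 else set0.
rewrite (_ : U = \bigcup_p F p); last first.
  apply/seteqP; split=> [x Ux|x [p _]]; last first.
    by rewrite /F; case: ifPn => // /asboolP; exact.
  have /nbhs_rVP[e e0 eU] := open_nbhs_nbhs (conj oU Ux).
  have [k ke] : exists k : nat, k.+1%:R^-1 < e / 2.
    exists (Num.truncn (e / 2)^-1); rewrite invf_plt ?posrE ?divr_gt0//.
    by exact: (truncnS_gt).
  have q l : exists r : rat, `|x ord0 l - ratr r| < k.+1%:R^-1.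
    have [|r] := @rat_in_itvoo R (x ord0 l - k.+1%:R^-1) (x ord0 l + k.+1%:R^-1).
      by rewrite ltrD2l gt0_cp// invr_gt0.
    by rewrite in_itv/= => xr; exists r; rewrite distrC ltr_distl.
  pose r := \row_l projT1 (cid (q l)).
  have xr : box r k x.
    by move=> l; rewrite mxE; case: cid => s /=.
  exists (r, k) => //; rewrite /F ifT//; apply/asboolP => y yr.
  apply: eU => l; have := yr l; have := xr l; move: (ratr _) => t.
  rewrite !ltr_norml => h1 h2; move: k.+1%:R^-1 ke h1 h2 => u; lra.
apply: countable_bigcupT_measurable => [|p]; first exact: countableP.
rewrite /F; case: ifP => // _.
apply: (measurable_box (I := fun l =>
  [set t | `|t - ratr (p.1 ord0 l)| < p.2.+1%:R^-1])) => l.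
rewrite (_ : [set _ | _] = ball (ratr (p.1 ord0 l) : R) p.2.+1%:R^-1).
  by apply: open_measurable; exact: ball_open.
by apply/seteqP; split=> t; rewrite /ball/= distrC.
Qed.

Lemma continuous_measurable_rV (f : Rn -> R) : continuous f ->
  measurable_fun setT f.
Proof.
move=> cf; apply: (measurability _ (RGenOpens.measurableE R)).
move=> _ [_ [a [b ->] <-]]; rewrite setTI; apply: open_measurable_rV.
by have /continuousP := cf; apply; exact: interval_open.
Qed.

Lemma closed_measurable_rV U : closed U -> measurable U.
Proof.
move=> cU; rewrite -(setCK U); apply: measurableC; apply: open_measurable_rV.
exact: closed_openC.
Qed.

End rV_topology.

Section leb_theory.
Context {R : realType}.
Local Notation lambda := (@lebesgue_measure R).
Local Open Scope ereal_scope.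

Lemma leb_box n (I : 'I_n -> set R) (c : 'I_n -> R) :
  (forall l, measurable (I l)) -> (forall l, lambda (I l) = (c l)%:E) ->
  leb n [set x | forall l, I l (x ord0 l)] = (\prod_l c l)%:E.
Proof.
elim: n I c => [|n IHn] I c mI Ic.
  rewrite big_ord0 /= diracE mem_set//= => -[].
  by case.
pose B := [set x : 'rV[R]_n | forall l, I (lift ord0 l) (x ord0 l)].
have mB : measurable B.
  by apply: (measurable_box (I := I \o lift ord0)) => l; exact: mI.
transitivity ((lambda \x^ leb n) (I ord0 `*` B)).
  congr ((lambda \x^ leb n) _); apply/seteqP; split=> [p /= h|p /= [h1 h2] l].
    split; first by have := h ord0; rewrite mxE unlift_none.
    by move=> l; have := h (lift ord0 l); rewrite mxE liftK.
  by rewrite mxE; case: unliftP => [j ->|->] //; exact: h2.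
rewrite product_measure2E//; last exact: mI.
rewrite big_ord_recl EFinM; congr (_ * _); first exact: Ic.
apply: (IHn (fun l => I (lift ord0 l)) (fun l => c (lift ord0 l))) => l.
  exact: mI.
exact: Ic.
Qed.

Lemma leb_sigma_finite n : sigma_finite setT (leb n : set 'rV[R]_n -> \bar R).
Proof.
pose I (k : nat) := `[(- k%:R)%R, k%:R]%classic : set R.
exists (fun k => [set x : 'rV[R]_n | forall l, I k (x ord0 l)]).
  apply/seteqP; split=> // x _.
  exists (Num.truncn (\sum_l `|x ord0 l|)%R).+1 => // l.
  rewrite /I/= in_itv/= -ler_norml (le_trans _ (ltW (truncnS_gt _)))//.
  by rewrite (bigD1 l)//= lerDl sumr_ge0.
move=> k; split; first by apply: (measurable_box (I := fun=> I k)) => l; exact: measurable_itv.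
rewrite (@leb_box _ (fun=> I k) (fun=> k%:R + k%:R)%R) ?ltry// => l.
  exact: measurable_itv.
rewrite /I; apply: (etrans (lebesgue_measure_itv `[(- k%:R)%R, k%:R])) => /=.
case: ifPn => [_|]; first by rewrite -EFinD opprK.
rewrite lte_fin -leNgt => h; congr EFin.
by have : (0 <= k%:R :> R)%R by []; lra.
Qed.

(** An unbundled name for [leb n], to which the sigma-finiteness required by Fubini and Tonelli can
    be attached as a structure. *)
Definition lebn n : set 'rV[R]_n -> \bar R := leb n.
HB.instance Definition _ n := Measure.on (@lebn n).
End leb_theory.

Section leb_fubini.
Context {R : realType}.
Local Notation lambda := (@lebesgue_measure R).
Local Open Scope ereal_scope.

HB.instance Definition _ n :=
  @Measure_isSigmaFinite.Build _ _ _ (@lebn R n) (@leb_sigma_finite R n).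

Section leb_succ.
Variable n : nat.
Local Notation rV_cons := (@rV_cons R n).

(** [leb] is built from the product [\x^], whereas Fubini and Tonelli are applied to [\x]. Both give
    the same value to rectangles, and uniqueness of the product measure does the rest. *)
Lemma lebS_prod (f : measurableTypeR R * 'rV[R]_n -> \bar R) :
  \int[lambda \x^ leb n]_p f p = \int[lambda \x (@lebn R n)]_p f p.
Proof.
apply: eq_measure_integral => A mA _; apply/esym.
apply: (@product_measure_unique _ _ _ _ R lambda (@lebn R n)) => //.
by move=> B C mB mC; exact: (@product_measure2E _ _ _ _ R lambda (leb n)).
Qed.

Lemma ge0_integral_lebS (f : 'rV[R]_n.+1 -> \bar R) :
  measurable_fun setT f -> (forall x, 0 <= f x) ->
  \int[leb n.+1]_x f x = \int[lambda \x (@lebn R n)]_p f (rV_cons p).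
Proof.
move=> mf f0; rewrite -lebS_prod.
by apply: (ge0_integral_pushforward (@measurable_rV_cons R n)).
Qed.

Lemma ge0_integral_leb_yx (f : 'rV[R]_n.+1 -> \bar R) :
  measurable_fun setT f -> (forall x, 0 <= f x) ->
  \int[leb n.+1]_x f x =
  \int[leb n]_y \int[lambda]_t f (rV_cons (t, y)).
Proof.
move=> mf f0; rewrite ge0_integral_lebS// fubini_tonelli2//.
by apply: measurableT_comp => //; exact: measurable_rV_cons.
Qed.

Lemma integrable_lebS (f : 'rV[R]_n.+1 -> \bar R) :
  (leb n.+1).-integrable setT f ->
  (lambda \x (@lebn R n)).-integrable setT (f \o rV_cons).
Proof.
case/integrableP => mf foo; apply/integrableP; split.
  by apply: measurableT_comp => //; exact: measurable_rV_cons.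
rewrite -(ge0_integral_lebS (f := fun x => `|f x|))//.
exact: measurableT_comp.
Qed.

Lemma integral_lebS (f : 'rV[R]_n.+1 -> \bar R) :
  (leb n.+1).-integrable setT f ->
  \int[leb n.+1]_x f x = \int[lambda \x (@lebn R n)]_p f (rV_cons p).
Proof.
move=> /[dup] fi /integrableP[mf foo].
rewrite -[RHS]/(\int[_]_p (f \o rV_cons) p) integralE [RHS]integralE.
rewrite [X in _ = X - _](_ : _ = \int[lambda \x (@lebn R n)]_p f^\+ (rV_cons p)); last first.
  by apply: eq_integral => p _; rewrite (funepos_comp f rV_cons).
rewrite [X in _ = _ - X](_ : _ = \int[lambda \x (@lebn R n)]_p f^\- (rV_cons p)); last first.
  by apply: eq_integral => p _; rewrite (funeneg_comp f rV_cons).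
have ep := ge0_integral_lebS (measurable_funepos mf) (fun x => funepos_ge0 f x).
have en := ge0_integral_lebS (measurable_funeneg mf) (fun x => funeneg_ge0 f x).
by congr (_ - _); [exact: ep|exact: en].
Qed.

Lemma integral_leb_yx (f : 'rV[R]_n.+1 -> \bar R) :
  (leb n.+1).-integrable setT f ->
  \int[leb n.+1]_x f x = \int[leb n]_y \int[lambda]_t f (rV_cons (t, y)).
Proof.
move=> fi; rewrite integral_lebS// -integral21_prod_meas1//.
exact: integrable_lebS.
Qed.

Lemma integral_leb_xy (f : 'rV[R]_n.+1 -> \bar R) :
  (leb n.+1).-integrable setT f ->
  \int[leb n.+1]_x f x = \int[lambda]_t \int[leb n]_y f (rV_cons (t, y)).
Proof.
move=> fi; rewrite integral_lebS// -integral12_prod_meas1//.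
exact: integrable_lebS.
Qed.

Lemma leb_section (A : set 'rV[R]_n.+1) : measurable A ->
  leb n.+1 A = \int[leb n]_y lambda [set t | A (rV_cons (t, y))].
Proof.
move=> mA; apply: eq_integral => y _ /=; congr (lambda _).
by apply/seteqP; split=> t; rewrite /ysection/= ?inE.
Qed.

Lemma measurable_section (A : set 'rV[R]_n.+1) : measurable A ->
  measurable_fun setT (fun y => lambda [set t | A (rV_cons (t, y))]).
Proof.
move=> mA; have := measurable_fun_ysection lambda (A := rV_cons @^-1` A).
rewrite (_ : _ \o _ = fun y => lambda [set t | A (rV_cons (t, y))]).
  apply; rewrite -[X in measurable X]setTI; exact: measurable_rV_cons.
apply/funext => y /=; congr (lambda _).
by apply/seteqP; split=> t; rewrite /ysection/= ?inE.
Qed.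

End leb_succ.

Lemma measurable_rV_cons_r n (y : 'rV[R]_n) :
  measurable_fun setT (fun t : measurableTypeR R => rV_cons (t, y)).
Proof.
apply: (measurableT_comp (@measurable_rV_cons R n)).
by apply: measurable_fun_pair; [exact: measurable_id|exact: measurable_cst].
Qed.

(** Sections along the first coordinate are single points if [l] is that coordinate; otherwise they
    are empty off a hyperplane in one dimension less. *)
Lemma leb_hyperplane n (l : 'I_n) (c : R) :
  leb n [set x : 'rV[R]_n | x ord0 l = c] = 0.
Proof.
elim: n l => [[]//|n IHn] l.
have mH k (j : 'I_k) : measurable [set x : 'rV[R]_k | x ord0 j = c].
  rewrite -[X in measurable X]setTI.
  exact: (measurable_coord j measurableT (measurable_set1 c)).
have ms := measurable_section (mH _ l).
rewrite leb_section//; case: (unliftP ord0 l) ms => [j ->|->] ms; last first.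
  rewrite (eq_integral (cst 0)) ?integral0// => y _.
  rewrite (_ : [set _ | _] = [set c]) ?lebesgue_measure_set1//.
  by apply/seteqP; split=> t /=; rewrite mxE unlift_none.
rewrite (ge0_negligible_integral (mH _ j))// (eq_integral (cst 0)) ?integral0// => y.
rewrite inE/= => -[_ yj]; rewrite (_ : [set _ | _] = set0) ?measure0//.
by apply/seteqP; split=> t //=; rewrite mxE liftK.
Qed.

Section affine1.
Variables (s b : R).
Hypothesis s0 : (0 < s)%R.
Let T (x : measurableTypeR R) : measurableTypeR R := (s * (x + b))%R.

Let mT : measurable_fun setT T.
Proof.
apply: measurable_funM; first exact: measurable_cst.
by apply: measurable_funD; [exact: measurable_id|exact: measurable_cst].
Qed.

(** The image measure, multiplied by [s], gives half-open intervals their length and is therefore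
    Lebesgue measure. *)
Lemma lebesgue_measure_affine (A : set R) : measurable A ->
  lambda [set x | A (s * (x + b))%R] = (s^-1)%:E * lambda A.
Proof.
move=> mA.
pose m := mscale (NngNum (ltW s0)) (pushforward lambda T).
have -> : lambda A = m mT A.
  apply: lebesgue_measure_unique => // _ [[a c] _ <-].
  rewrite /m /mscale/= /pushforward.
  rewrite [X in _ = _ * lambda X](_ : _ = `](s^-1 * a - b)%R, (s^-1 * c - b)%R]%classic); last first.
    apply/seteqP; split=> x; rewrite /T/= !in_itv/=.
      by rewrite !lerBrDr !ltrBlDr ler_pdivlMl// ltr_pdivrMl.
    by rewrite !lerBrDr !ltrBlDr ler_pdivlMl// ltr_pdivrMl.
  rewrite [X in _ = _ * X](lebesgue_measure_itv `](s^-1 * a - b)%R, (s^-1 * c - b)%R]).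
  rewrite [LHS](lebesgue_measure_itv `]a, c])/= !lte_fin ltrD2r ltr_pM2l ?invr_gt0//.
  case: ifPn => _; last by rewrite mule0.
  rewrite -!EFinB -EFinM; congr EFin; field.
  by rewrite gt_eqF.
by rewrite /m /mscale/= muleA -EFinM mulVf ?mul1e// gt_eqF.
Qed.
End affine1.

(** The shift precedes the scaling, so that an integer vector [b] maps the unit grid to the grid of
    width [s]. *)
Definition affine n (s : R) (b : 'rV[R]_n) (x : 'rV[R]_n) : 'rV[R]_n :=
  (s *: (x + b))%R.

Lemma measurable_affine n s (b : 'rV[R]_n) : measurable_fun setT (affine s b).
Proof.
apply: measurable_fun_coordP => i; under eq_fun do rewrite !mxE.
apply: measurable_funM; first exact: measurable_cst.
by apply: measurable_funD; [exact: measurable_coord|exact: measurable_cst].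
Qed.

Lemma leb_affine n s (b : 'rV[R]_n) (A : set 'rV[R]_n) : (0 < s)%R ->
  measurable A ->
  leb n (affine s b @^-1` A) = (s ^- n)%:E * leb n A.
Proof.
move=> s0; elim: n b A => [|n IHn] b A mA.
  rewrite expr0 invr1 mul1e; congr (leb 0 _).
  apply/seteqP; split=> x /=; congr (A _); apply/rowP => -[]//.
have mTA : measurable (affine s b @^-1` A).
  by rewrite -[X in measurable X]setTI; exact: measurable_affine.
rewrite !leb_section//.
pose b' : 'rV[R]_n := \row_j b ord0 (lift ord0 j).
pose g y := lambda [set t | A (rV_cons (t, y))].
have gm : measurable_fun setT g by exact: measurable_section.
transitivity (\int[leb n]_y ((s^-1)%:E * g (affine s b' y))).
  apply: eq_integral => y _; rewrite /g -(@lebesgue_measure_affine s (b ord0 ord0))//.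
    congr (lambda _); apply/seteqP; split=> t /=; congr (A _); apply/rowP => j;
      by rewrite !mxE; case: unliftP => [k ->|->]; rewrite ?mxE.
  rewrite -[X in measurable X]setTI.
  exact: (measurable_rV_cons_r (affine s b' y) measurableT mA).
rewrite ge0_integralZl//; last 2 first.
- exact: (measurableT_comp gm (measurable_affine s b')).
- by rewrite lee_fin invr_ge0 ltW.
have sn0 : (0 <= s ^- n)%R by rewrite invr_ge0 exprn_ge0 ?(ltW s0).
have -> : \int[leb n]_y g (affine s b' y) = (s ^- n)%:E * \int[leb n]_y g y.
  rewrite -(@ge0_integral_mscale _ _ _ (leb n) _ measurableT (NngNum sn0))//.
  have hp := @ge0_integral_pushforward _ _ _ _ _ _ (measurable_affine s b')
    (leb n) setT g measurableT gm (fun y _ => measure_ge0 _ _).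
  apply: (etrans (esym hp)); apply: eq_measure_integral => [|mf B mB _].
    exact: measurable_affine.
  exact: IHn.
by rewrite muleA -EFinM -invfM exprS.
Qed.

Lemma ge0_integral_affine n s (b : 'rV[R]_n) (D : set 'rV[R]_n)
    (f : 'rV[R]_n -> \bar R) : (0 < s)%R -> measurable D ->
  measurable_fun D f -> (forall x, D x -> 0 <= f x) ->
  \int[leb n]_(x in affine s b @^-1` D) f (affine s b x) =
  (s ^- n)%:E * \int[leb n]_(x in D) f x.
Proof.
move=> s0 mD mf f0.
have sn0 : (0 <= s ^- n)%R by rewrite invr_ge0 exprn_ge0 ?(ltW s0).
rewrite -(@ge0_integral_mscale _ _ _ (leb n) _ mD (NngNum sn0))//.
have hp := @ge0_integral_pushforward _ _ _ _ _ _ (measurable_affine s b)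
  (leb n) D f mD mf (fun y Dy => f0 y (set_mem Dy)).
apply: (etrans (esym hp)); apply: eq_measure_integral => [|mf' B mB _].
  exact: measurable_affine.
exact: leb_affine.
Qed.

End leb_fubini.

Section rV_lines.
Context {R : realType}.

Lemma continuous_rV_coord (T : topologicalType) n (f : T -> 'rV[R]_n) :
  (forall l, continuous (fun t => f t ord0 l)) -> continuous f.
Proof.
move=> cf t A /nbhs_rVP[e e0 eA].
have : \forall t' \near t, forall l, `|f t' ord0 l - f t ord0 l| < e.
  apply: filter_forall => l; near=> t'; rewrite distrC; near: t'.
  exact: (@cvgr_dist_lt _ _ _ _ _ _ _ (cf l t)).
by apply: filterS => t' h; exact: eA.
Unshelve. all: by end_near. Qed.

Lemma continuous_rV_cons_l n (t : R) :
  continuous (fun y : 'rV[R]_n => rV_cons (t, y)).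
Proof.
apply: continuous_rV_coord => l y; under eq_fun do rewrite mxE.
by case: unlift => [j|]; [exact: coord_continuous|exact: (@cst_continuous _ _ t y)].
Qed.

Lemma continuous_rV_cons_r n (y : 'rV[R]_n) :
  continuous (fun t : R => rV_cons (t, y) : 'rV[R]_n.+1).
Proof.
apply: continuous_rV_coord => l t; under eq_fun do rewrite mxE.
by case: unlift => [j|]; [exact: (@cst_continuous _ _ (y ord0 j) t)|exact: cvg_id].
Qed.

(** The two difference quotients are the same function of [h]. This passes between partial
    derivatives and derivatives of restrictions to lines or to hyperplanes. *)
Lemma is_derive_lineP (V W : normedModType R) (p : V -> W) (F : W -> R)
    (t w : V) (v : W) (d : R) :
  (forall h : R, p (h *: w + t) = h *: v + p t) ->
  is_derive t w (F \o p) d <-> is_derive (p t) v F d.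
Proof.
move=> pl.
have e : (fun h : R => h^-1 *: ((F \o p \o shift t) (h *: w) - (F \o p) t)) =
         (fun h : R => h^-1 *: ((F \o shift (p t)) (h *: v) - F (p t))).
  by apply/funext => h; rewrite /= pl.
split=> -[dF Fd].
  by split; [move: dF; rewrite /derivable e|move: Fd; rewrite /derive e].
by split; [move: dF; rewrite /derivable e|move: Fd; rewrite /derive e].
Qed.

Lemma is_derive_line (V W : normedModType R) (p : V -> W) (F : W -> R)
    (t w : V) (v : W) (d : R) :
  (forall h : R, p (h *: w + t) = h *: v + p t) ->
  is_derive (p t) v F d -> is_derive t w (F \o p) d.
Proof. by move=> /is_derive_lineP h /h. Qed.

End rV_lines.

Section leb_integrals.
Context {R : realType}.
Local Notation lambda := (@lebesgue_measure R).

Lemma measurable_fun_prod_ord d (T : measurableType d) n (h : 'I_n -> T -> R) :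
  (forall l, measurable_fun setT (h l)) ->
  measurable_fun setT (fun x => \prod_l h l x).
Proof.
elim: n h => [|n IHn] h mh.
  by under eq_fun do rewrite big_ord0; exact: measurable_cst.
under eq_fun do rewrite big_ord_recl.
by apply: measurable_funM; [exact: mh|apply: IHn => l; exact: mh].
Qed.

Lemma ge0_integral_tensor n (f : 'I_n -> R -> R) (c : 'I_n -> R) :
  (forall l, measurable_fun setT (f l)) -> (forall l t, 0 <= f l t) ->
  (forall l, \int[lambda]_t (f l t)%:E = (c l)%:E)%E ->
  (\int[leb n]_x (\prod_l f l (x ord0 l))%:E = (\prod_l c l)%:E)%E.
Proof.
elim: n f c => [|n IHn] f c mf f0 fc.
  under eq_integral do rewrite big_ord0.
  by rewrite integral_cst//= diracE mem_set// mul1e big_ord0.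
have mF k (g : 'I_k -> R -> R) : (forall l, measurable_fun setT (g l)) ->
    measurable_fun setT (fun x : 'rV[R]_k => \prod_l g l (x ord0 l)).
  move=> mg; apply: (@measurable_fun_prod_ord _ 'rV[R]_k k (fun l x => g l (x ord0 l))) => l.
  by apply: (measurableT_comp (mg l)); exact: measurable_coord.
rewrite ge0_integral_leb_yx; last 2 first.
- by apply/measurable_EFinP; exact: mF.
- by move=> x; rewrite lee_fin prodr_ge0.
transitivity (\int[leb n]_y ((c ord0)%:E *
    (\prod_l f (lift ord0 l) (y ord0 l))%:E))%E.
  apply: eq_integral => y _; rewrite -fc -ge0_integralZr//=; last 3 first.
  - by apply/measurable_EFinP; exact: mf.
  - by move=> t _; rewrite lee_fin.
  - by rewrite lee_fin prodr_ge0.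
  apply: eq_integral => t _; rewrite big_ord_recl EFinM mxE unlift_none.
  congr (_ * _%:E)%E; apply: eq_bigr => l _.
  by rewrite mxE liftK.
rewrite ge0_integralZl//; last 3 first.
- by apply/measurable_EFinP; apply: (mF _ (fun l => f (lift ord0 l))) => l; exact: mf.
- by move=> y _; rewrite lee_fin prodr_ge0.
- by rewrite -fc; apply: integral_ge0 => t _; rewrite lee_fin.
rewrite (IHn (fun l => f (lift ord0 l)) (fun l => c (lift ord0 l)))//.
by rewrite -EFinM big_ord_recl.
Qed.

Definition cbox n (a b : 'I_n -> R) : set 'rV[R]_n :=
  [set x | forall l, a l <= x ord0 l <= b l].
Definition obox n (a b : 'I_n -> R) : set 'rV[R]_n :=
  [set x | forall l, a l < x ord0 l < b l].

Lemma compact_cbox n (a b : 'I_n -> R) : compact (cbox a b).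
Proof.
have := @rV_compact R n (fun l => `[a l, b l]%classic) (fun l => @segment_compact R _ _).
by congr compact; apply/seteqP; split=> x /= h l; have := h l; rewrite /= in_itv.
Qed.

Lemma compact_closed_rV n (K : set 'rV[R]_n) : compact K -> closed K.
Proof.
move=> cK; refine (compact_closed (@norm_hausdorff R 'rV[R]_n) cK).
Qed.

Lemma measurable_cbox n (a b : 'I_n -> R) : measurable (cbox a b).
Proof.
by apply: closed_measurable_rV; apply: compact_closed_rV; exact: compact_cbox.
Qed.

Lemma open_obox n (a b : 'I_n -> R) : open (obox a b).
Proof.
rewrite openE => x xab; apply/nbhs_rVP.
have h l : \forall e \near (0 : R)^'+, a l < x ord0 l - e /\ x ord0 l + e < b l.
  have /andP[h1 h2] := xab l; near=> e; split.
    by rewrite ltrBrDr -ltrBrDl; near: e; apply: nbhs_right_lt; rewrite subr_gt0.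
  by rewrite -ltrBrDl; near: e; apply: nbhs_right_lt; rewrite subr_gt0.
near (0 : R)^'+ => e; exists e => // y xy l.
have [h1 h2] : a l < x ord0 l - e /\ x ord0 l + e < b l.
  by move: l; near: e; apply: filter_forall => l; exact: h.
by have := xy l; rewrite ltr_distl => /andP[h3 h4]; apply/andP; split; lra.
Unshelve. all: by end_near. Qed.

Lemma measurable_obox n (a b : 'I_n -> R) : measurable (obox a b).
Proof. by apply: open_measurable_rV; exact: open_obox. Qed.

Lemma leb_cbox n (a b : 'I_n -> R) : (forall l, a l <= b l) ->
  leb n (cbox a b) = (\prod_l (b l - a l))%:E.
Proof.
move=> ab.
rewrite (_ : cbox a b = [set x | forall l, `[a l, b l]%classic (x ord0 l)]); last first.
  by apply/seteqP; split=> x /= h l; have := h l; rewrite /= in_itv.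
apply: (leb_box (I := fun l => `[a l, b l]%classic) (c := fun l => b l - a l)) => l; first exact: measurable_itv.
apply: (etrans (lebesgue_measure_itv `[a l, b l])) => /=; rewrite lte_fin.
by case: ltgtP (ab l) => // -> _; rewrite subrr.
Qed.

Lemma leb_obox n (a b : 'I_n -> R) : (forall l, a l <= b l) ->
  leb n (obox a b) = (\prod_l (b l - a l))%:E.
Proof.
move=> ab.
rewrite (_ : obox a b = [set x | forall l, `]a l, b l[%classic (x ord0 l)]); last first.
  by apply/seteqP; split=> x /= h l; have := h l; rewrite /= in_itv.
apply: (leb_box (I := fun l => `]a l, b l[%classic) (c := fun l => b l - a l)) => l; first exact: measurable_itv.
apply: (etrans (lebesgue_measure_itv `]a l, b l[)) => /=; rewrite lte_fin.
by case: ltgtP (ab l) => // -> _; rewrite subrr.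
Qed.

Lemma leb_bounded n (D : set 'rV[R]_n) (r : R) : measurable D ->
  (forall x, D x -> forall l, `|x ord0 l| <= r) -> (leb n D < +oo)%E.
Proof.
move=> mD Dr.
apply: (@le_lt_trans _ _ (leb n (cbox (fun=> - `|r|) (fun=> `|r|)))).
  rewrite le_measure ?inE//; first exact: measurable_cbox.
  move=> x Dx l; rewrite -ler_norml (le_trans (Dr x Dx l))//.
  exact: ler_norm.
by rewrite leb_cbox ?ltry// => l; rewrite ge0_cp.
Qed.

Lemma bounded_integrable n (D : set 'rV[R]_n) (f : 'rV[R]_n -> R) (C : R) :
  measurable D -> (leb n D < +oo)%E -> measurable_fun D f ->
  (forall x, D x -> `|f x| <= C) -> (leb n).-integrable D (EFin \o f).
Proof.
move=> mD Doo mf fC; apply/integrableP; split; first exact/measurable_EFinP.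
apply: (@le_lt_trans _ _ (\int[leb n]_(x in D) (cst C%:E x))%E).
  apply: ge0_le_integral => //=.
    by apply/measurable_EFinP; exact: measurableT_comp.
rewrite integral_cst// -(@fineK _ (leb n D)) ?ge0_fin_numE//.
by rewrite -EFinM ltry.
Qed.

Lemma continuous_cbox_bounded n (a b : 'I_n -> R) (f : 'rV[R]_n -> R) :
  continuous f -> exists C, forall x, cbox a b x -> `|f x| <= C.
Proof.
move=> cf.
have /compact_bounded[M [_ hM]] : compact (f @` cbox a b).
  by apply: continuous_compact; [exact: continuous_subspaceT|exact: compact_cbox].
exists (M + 1) => x abx; apply: (hM (M + 1)); first by rewrite ltrDl.
by exists x.
Qed.

Definition supported_cbox n (r : R) (f : 'rV[R]_n -> R) :=
  forall x : 'rV[R]_n, (exists l, r <= `|x ord0 l|) -> f x = 0.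

Lemma supported_integrable n r (f : 'rV[R]_n -> R) : continuous f ->
  supported_cbox r f -> (leb n).-integrable setT (EFin \o f).
Proof.
move=> cf fr.
pose B : set 'rV[R]_n := cbox (fun=> - r) (fun=> r).
have mB : measurable B by exact: measurable_cbox.
have Boo : (leb n B < +oo)%E.
  apply: (@leb_bounded _ _ r) => // x xr l; rewrite ler_norml; exact: xr.
have mf := continuous_measurable_rV cf.
have [C hC] := continuous_cbox_bounded (fun=> - r) (fun=> r) cf.
have fB : (leb n).-integrable B (EFin \o f).
  by apply: bounded_integrable hC => //; exact: measurable_funTS.
apply/integrableP; split; first exact/measurable_EFinP.
case/integrableP : fB => _; rewrite [in X in X -> _]integral_mkcond.
congr (_ < _)%E; apply: eq_integral => x _; rewrite patchE; case: ifPn => //.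
rewrite notin_setE => xB; rewrite /= fr ?normr0//.
apply: contrapT => /forallNP h; apply: xB => l; rewrite -ler_norml.
by move/negP: (h l); rewrite -ltNge => /ltW.
Qed.

Lemma integral_derive_eq0 (k g : R -> R) (r : R) : continuous g ->
  (forall t : R, is_derive t 1 k (g t)) ->
  (forall t, r <= `|t| -> k t = 0 /\ g t = 0) ->
  (\int[lambda]_t (g t)%:E = 0)%E.
Proof.
move=> cg dk kg.
(* Positive and at least [r] even when [r] is negative, so that [k] vanishes at both ends of
   [[- s, s]]. *)
pose s := `|r| + 1.
have rs : r <= s by rewrite (le_trans (ler_norm r))// lerDl.
have s0 : 0 < s by rewrite ltr_pwDr.
have sN : r <= `|- s| by rewrite normrN gtr0_norm.
have sP : r <= `|s| by rewrite gtr0_norm.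
have ck : continuous k.
  by apply: derivable_continuous => t; have [] := dk t.
transitivity (\int[lambda]_(t in `[(- s)%R, s]) (g t)%:E)%E.
  rewrite [RHS]integral_mkcond; apply: eq_integral => t _; rewrite patchE.
  case: ifPn => //; rewrite notin_setE/= in_itv/= -ler_norml => /negP.
  rewrite -ltNge => st; rewrite (kg t _).2//.
  by rewrite (le_trans rs)// ltW.
rewrite (@continuous_FTC2 _ _ k).
- by rewrite (kg s sP).1 (kg (- s) sN).1 subee.
- by rewrite gtrN.
- exact: continuous_subspaceT.
- split.
  + by move=> t _; have [] := dk t.
  + by apply: cvg_at_right_filter; exact: ck.
  + by apply: cvg_at_left_filter; exact: ck.
- by move=> t _; rewrite derive1E; have [] := dk t.
Qed.

(** Integration by parts rests on this. If [l] is the first coordinate, Fubini puts its integral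
    inside and the one-dimensional case applies; otherwise the first coordinate is frozen and the
    induction hypothesis applies to the inner integral. *)
Lemma integral_partial_eq0 n (l : 'I_n) (F G : 'rV[R]_n -> R) r :
  continuous G -> (forall x, is_derive x (delta_mx ord0 l) F (G x)) ->
  supported_cbox r F -> supported_cbox r G ->
  (\int[leb n]_x (G x)%:E = 0)%E.
Proof.
elim: n l F G => [[]//|n IHn] l F G cG dFG Fr Gr.
have iG := supported_integrable cG Gr.
have lineP (j : 'I_n) t (y : 'rV[R]_n) h :
    rV_cons (t, h *: delta_mx ord0 j + y) =
    h *: delta_mx ord0 (lift ord0 j) + rV_cons (t, y) :> 'rV[R]_n.+1.
  apply/rowP => i; rewrite !mxE eqxx/=; case: unliftP => [i' ->|->].
    by rewrite !mxE eqxx/= (inj_eq lift_inj).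
  by rewrite (negbTE (neq_lift _ _)) mulr0 add0r.
have line0 (t : R) (y : 'rV[R]_n) h :
    rV_cons (h *: 1 + t, y) =
    h *: delta_mx ord0 ord0 + rV_cons (t, y) :> 'rV[R]_n.+1.
  apply/rowP => i; rewrite !mxE eqxx/=; case: unliftP => [i' ->|->].
    by rewrite eq_sym (negbTE (neq_lift _ _)) mulr0 add0r.
  by rewrite eqxx.
case: (unliftP ord0 l) dFG => [j ->|->] dFG.
  rewrite integral_leb_xy// (eq_integral (cst 0%E)) ?integral0// => t _.
  apply: (IHn j (fun y => F (rV_cons (t, y)))).
  - by move=> y; apply: continuous_comp; [exact: continuous_rV_cons_l|exact: cG].
  - move=> y; apply: (@is_derive_line _ _ _ (fun y => rV_cons (t, y)) F) => //.
  - by move=> x [i xi]; apply: Fr; exists (lift ord0 i); rewrite mxE liftK.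
  - by move=> x [i xi]; apply: Gr; exists (lift ord0 i); rewrite mxE liftK.
rewrite integral_leb_yx// (eq_integral (cst 0%E)) ?integral0// => y _.
apply: (@integral_derive_eq0 (fun t => F (rV_cons (t, y))) _ r).
- by move=> t; apply: continuous_comp; [exact: continuous_rV_cons_r|exact: cG].
- move=> t; apply: (@is_derive_line _ _ _ (fun t => rV_cons (t, y)) F) => //.
- move=> t rt; split; [apply: Fr|apply: Gr]; exists ord0;
    by rewrite mxE unlift_none.
Qed.

End leb_integrals.

(** * Finite sums of tensor products *)

Section tensor_sums.
Context {R : realType} {d : nat}.
Notation Rd := 'rV[R]_d.
Implicit Types (x y : Rd) (l : 'I_d) (s : seq 'I_d) (f g : Rd -> R).

Lemma continuous_mulR f g : continuous f -> continuous g ->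
  continuous (fun x => f x * g x).
Proof. by move=> cf cg x; apply: cvgM; [exact: nbhs_filter|exact: cf|exact: cg]. Qed.

Lemma continuous_addR f g : continuous f -> continuous g ->
  continuous (fun x => f x + g x).
Proof. by move=> cf cg x; apply: cvgD; [exact: nbhs_filter|exact: cf|exact: cg]. Qed.

Lemma continuous_coord (h : R -> R) l : continuous h ->
  continuous (fun x : Rd => h (x ord0 l)).
Proof.
move=> ch x A hA; exact: (@coord_continuous R 1 d ord0 l x _ (ch _ _ hA)).
Qed.

Definition sm1 := {f : R -> R | smooth1 f}.

Definition sm1_deriven n (f : sm1) : sm1 :=
  exist _ (derive1n n (sval f)) (smooth1_deriven n (svalP f)).

Definition tens (F : 'I_d -> sm1) x : R := \prod_l sval (F l) (x ord0 l).

(** Only the multiplicities in [s] enter, which is the symmetry of mixed partial derivatives. *)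
Definition tens_deriv s (F : 'I_d -> sm1) : 'I_d -> sm1 :=
  fun j => sm1_deriven (count_mem j s) (F j).

Lemma tens_is_derive s F l x :
  is_derive x (delta_mx ord0 l) (tens (tens_deriv s F))
    (tens (tens_deriv (l :: s) F) x).
Proof.
pose p (t : R) : Rd := \row_j (if j == l then t else x ord0 j).
have px : p (x ord0 l) = x.
  by apply/rowP => j; rewrite mxE; case: eqP => [->|].
rewrite -[X in is_derive X]px.
apply/(@is_derive_lineP _ _ _ p _ (x ord0 l) 1).
  move=> h; apply/rowP => j; rewrite !mxE eqxx/=.
  by case: eqVneq => _; rewrite ?mulr0 ?add0r.
pose C := \prod_(j | j != l) sval (tens_deriv s F j) (x ord0 j).
have -> : tens (tens_deriv s F) \o p =
    (fun t => C * sval (tens_deriv s F l) t).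
  apply/funext => t; rewrite /tens/= (bigD1 l)//= mxE eqxx mulrC; congr (_ * _).
  by apply: eq_bigr => j /negPf jl; rewrite mxE jl.
have dF : is_derive (x ord0 l) 1 (sval (tens_deriv s F l))
    (sval (tens_deriv (l :: s) F l) (x ord0 l)).
  have e : count_mem l (l :: s) = (count_mem l s).+1 by rewrite /= eqxx.
  rewrite (_ : sval (tens_deriv (l :: s) F l) =
    derive1n (count_mem l s).+1 (sval (F l))); last by rewrite -e.
  rewrite derive1nS derive1E.
  split; last by [].
  by apply: smooth1_derivable; apply: smooth1_deriven; exact: svalP.
rewrite [X in is_derive _ _ _ X](_ : _ =
   C *: sval (tens_deriv (l :: s) F l) (x ord0 l)); last first.
  rewrite /tens (bigD1 l)//= mulrC; congr (_ * _).
  by apply: eq_bigr => j /negPf jl; rewrite /= eq_sym jl.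
exact: is_deriveZ.
Qed.

Lemma tens_continuous F : continuous (tens F).
Proof.
rewrite /tens; elim: (index_enum _) => [|l r IH].
  rewrite (_ : (fun _ => _) = cst 1); first exact: cst_continuous.
  by apply/funext => x; rewrite big_nil.
rewrite (_ : (fun _ => _) = fun x => sval (F l) (x ord0 l) *
    \prod_(j <- r) sval (F j) (x ord0 j)); last first.
  by apply/funext => x; rewrite big_cons.
apply: continuous_mulR IH; apply: continuous_coord.
exact: (smooth1_continuous (svalP (F l))).
Qed.

Definition tterm := (R * ('I_d -> sm1))%type.

Definition tsum (r : seq tterm) x : R := \sum_(p <- r) p.1 * tens p.2 x.

Definition tsum_deriv s (r : seq tterm) : seq tterm :=
  [seq (p.1, tens_deriv s p.2) | p <- r].

Lemma tens_deriv_nil F x : tens (tens_deriv [::] F) x = tens F x.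
Proof. by apply: eq_bigr. Qed.

Lemma tsum_deriv_nil r : tsum (tsum_deriv [::] r) = tsum r.
Proof.
apply/funext => x; rewrite /tsum big_map; apply: eq_bigr => p _ /=.
by rewrite tens_deriv_nil.
Qed.

Lemma tsum_deriv_perm s s' r : perm_eq s s' ->
  tsum (tsum_deriv s r) = tsum (tsum_deriv s' r).
Proof.
move=> /permP ss'; apply/funext => x; rewrite /tsum !big_map.
apply: eq_bigr => p _ /=; congr (_ * _); apply: eq_bigr => l _.
by rewrite /tens_deriv ss'.
Qed.

Lemma tsum_is_derive s r l x :
  is_derive x (delta_mx ord0 l) (tsum (tsum_deriv s r))
    (tsum (tsum_deriv (l :: s) r) x).
Proof.
rewrite /tsum big_map.
under [X in is_derive _ _ X]eq_fun do rewrite big_map.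
elim: r => [|p r IH].
  rewrite big_nil; under [X in is_derive _ _ X]eq_fun do rewrite big_nil.
  exact: is_derive_cst.
rewrite big_cons; under [X in is_derive _ _ X]eq_fun do rewrite big_cons.
apply: (@is_deriveD _ _ _ (fun x => p.1 * tens (tens_deriv s p.2) x)) => //.
by apply: is_deriveZ; exact: tens_is_derive.
Qed.

Lemma tsum_iter_partial s r : iter_partial s (tsum r) = tsum (tsum_deriv s r).
Proof.
elim: s => [|l s IH]; first by rewrite tsum_deriv_nil.
rewrite /= -/(iter_partial s _) IH; apply/funext => x.
by have [_ ->] := tsum_is_derive s r l x.
Qed.

Lemma tsum_continuous r : continuous (tsum r).
Proof.
rewrite /tsum; elim: r => [|p r IH].
  rewrite (_ : (fun _ => _) = cst 0); first exact: cst_continuous.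
  by apply/funext => x; rewrite big_nil.
rewrite (_ : (fun _ => _) = fun x => p.1 * tens p.2 x +
    \sum_(q <- r) q.1 * tens q.2 x); last first.
  by apply/funext => x; rewrite big_cons.
apply: continuous_addR IH; apply: continuous_mulR (@tens_continuous _).
exact: cst_continuous.
Qed.

(* The functions of [V_space] and the cut-off functions have this form, for
   which partial derivatives commute and act factor by factor. *)
Definition is_tsum g := exists r, g = tsum r.

Lemma is_tsum_continuous g : is_tsum g -> continuous g.
Proof. by case=> r ->; exact: tsum_continuous. Qed.

Lemma is_tsum_iter_partial s g : is_tsum g -> is_tsum (iter_partial s g).
Proof. by case=> r ->; exists (tsum_deriv s r); rewrite tsum_iter_partial. Qed.

Lemma is_tsum_derive g l x : is_tsum g ->
  is_derive x (delta_mx ord0 l) g (iter_partial [:: l] g x).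
Proof.
case=> r ->; rewrite tsum_iter_partial -[X in is_derive _ _ X]tsum_deriv_nil.
exact: tsum_is_derive.
Qed.

Lemma iter_partial_cat s s' g :
  iter_partial s (iter_partial s' g) = iter_partial (s ++ s') g.
Proof. by rewrite /iter_partial foldr_cat. Qed.

Lemma is_tsum_perm s s' g : is_tsum g -> perm_eq s s' ->
  iter_partial s g = iter_partial s' g.
Proof. by case=> r -> ss'; rewrite !tsum_iter_partial; exact: tsum_deriv_perm. Qed.

Lemma is_tsum_smooth g : is_tsum g -> smooth g.
Proof.
move=> tg s; split; first exact/is_tsum_continuous/is_tsum_iter_partial.
move=> l x; by have [] := is_tsum_derive l x (is_tsum_iter_partial s tg).
Qed.

Lemma is_tsum0 : is_tsum (fun=> 0).
Proof. by exists [::]; apply/funext => x; rewrite /tsum big_nil. Qed.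

Lemma is_tsumD f g : is_tsum f -> is_tsum g -> is_tsum (fun x => f x + g x).
Proof.
move=> [r ->] [r' ->]; exists (r ++ r'); apply/funext => x.
by rewrite /tsum big_cat.
Qed.

Lemma is_tsumZ c f : is_tsum f -> is_tsum (fun x => c * f x).
Proof.
move=> [r ->]; exists [seq (c * p.1, p.2) | p <- r]; apply/funext => x.
by rewrite /tsum big_map mulr_sumr; apply: eq_bigr => p _; rewrite mulrA.
Qed.

Lemma is_tsum_sum (I : Type) (r : seq I) (P : pred I) (F : I -> Rd -> R) :
  (forall i, P i -> is_tsum (F i)) -> is_tsum (fun x => \sum_(i <- r | P i) F i x).
Proof.
move=> tF; elim: r => [|i r IH].
  by under eq_fun do rewrite big_nil; exact: is_tsum0.
under eq_fun do rewrite big_cons.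
by case Pi: (P i); [exact: (is_tsumD (tF i Pi) IH)|exact: IH].
Qed.

Lemma is_tsum_tens (F : 'I_d -> R -> R) : (forall l, smooth1 (F l)) ->
  is_tsum (fun x => \prod_l F l (x ord0 l)).
Proof.
move=> sF; exists [:: (1, fun l => exist _ (F l) (sF l))]; apply/funext => x.
by rewrite /tsum big_seq1 mul1r.
Qed.

Lemma iter_partialD s f g : is_tsum f -> is_tsum g ->
  iter_partial s (fun x => f x + g x) =
  fun x => iter_partial s f x + iter_partial s g x.
Proof.
move=> [r ->] [r' ->]; rewrite (_ : (fun x => tsum r x + _) = tsum (r ++ r')).
  rewrite !tsum_iter_partial; apply/funext => x.
  by rewrite /tsum /tsum_deriv map_cat big_cat.
by apply/funext => x; rewrite /tsum big_cat.
Qed.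

Lemma iter_partialZ s c f : is_tsum f ->
  iter_partial s (fun x => c * f x) = fun x => c * iter_partial s f x.
Proof.
move=> [r ->].
rewrite (_ : (fun x => _) = tsum [seq (c * p.1, p.2) | p <- r]); last first.
  apply/funext => x; rewrite /tsum big_map mulr_sumr.
  by apply: eq_bigr => p _; rewrite mulrA.
rewrite !tsum_iter_partial; apply/funext => x; rewrite /tsum !big_map mulr_sumr.
by apply: eq_bigr => p _; rewrite mulrA.
Qed.

Lemma iter_partial_sum s (I : Type) (r : seq I) (P : pred I) (F : I -> Rd -> R) :
  (forall i, P i -> is_tsum (F i)) ->
  iter_partial s (fun x => \sum_(i <- r | P i) F i x) =
  fun x => \sum_(i <- r | P i) iter_partial s (F i) x.
Proof.
move=> tF; elim: r => [|i r IH].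
  have -> : (fun x => \sum_(i <- [::] | P i) F i x) = tsum [::].
    by apply/funext => x; rewrite /tsum !big_nil.
  by rewrite tsum_iter_partial; apply/funext => x; rewrite /tsum !big_nil.
under eq_fun do rewrite big_cons; under [RHS]eq_fun do rewrite big_cons.
case Pi: (P i); last exact: IH.
by rewrite (iter_partialD s (tF i Pi) (is_tsum_sum r tF)) IH.
Qed.

Lemma iter_partial_tens s (F : 'I_d -> R -> R) : (forall l, smooth1 (F l)) ->
  iter_partial s (fun x => \prod_l F l (x ord0 l)) =
  fun x => \prod_l derive1n (count_mem l s) (F l) (x ord0 l).
Proof.
move=> sF.
rewrite (_ : (fun x => _) = tsum [:: (1, fun l => exist _ (F l) (sF l))]).
  by rewrite tsum_iter_partial; apply/funext => x; rewrite /tsum big_seq1 mul1r.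
by apply/funext => x; rewrite /tsum big_seq1 mul1r.
Qed.

Lemma iter_partial_local (U : set Rd) s f g : open U ->
  (forall x, U x -> f x = g x) ->
  forall x, U x -> iter_partial s f x = iter_partial s g x.
Proof.
move=> oU fg; elim: s => [//|l s IH] x Ux /=.
rewrite -/(iter_partial s f) -/(iter_partial s g).
apply: near_eq_derive.
have : nbhs x U by exact: open_nbhs_nbhs.
by apply: filterS => y; exact: IH.
Qed.

End tensor_sums.

(** * Square-integrable functions and weak derivatives *)

Section L2_theory.
Context {R : realType} {d : nat}.
Notation Rd := 'rV[R]_d.
Notation mu := (@leb R d).
Implicit Types (U V D : set Rd) (f g h : Rd -> R).

Lemma L2_mul_integrable U f g : measurable U -> L2 U f -> L2 U g ->
  mu.-integrable U (EFin \o (fun x => f x * g x)).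
Proof.
move=> mU [mf f2] [mg g2].
apply: (@le_integrable _ _ _ mu U mU _ (fun x => (f x ^+ 2)%:E + (g x ^+ 2)%:E)%E).
- by apply/measurable_EFinP; exact: measurable_funM.
- move=> x _; rewrite -EFinD /= lee_fin normrM (ger0_norm (addr_ge0 _ _)) ?sqr_ge0//.
  rewrite -(real_normK (num_real (f x))) -(real_normK (num_real (g x))).
  by have := normr_ge0 (f x); have := normr_ge0 (g x); nra.
- exact: integrableD.
Qed.

Lemma L2_cst0 U : measurable U -> L2 U (fun=> 0).
Proof.
move=> mU; split; first exact: measurable_cst.
by under eq_fun do rewrite expr0n/=; exact: integrable0.
Qed.

Lemma L2Z U c f : measurable U -> L2 U f -> L2 U (fun x => c * f x).
Proof.
move=> mU [mf f2]; split; first by apply: measurable_funM.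
under eq_fun do rewrite exprMn EFinM.
exact: integrableZl.
Qed.

Lemma L2D U f g : measurable U -> L2 U f -> L2 U g -> L2 U (fun x => f x + g x).
Proof.
move=> mU Lf Lg; have fg := L2_mul_integrable mU Lf Lg.
case: Lf Lg => mf f2 [mg g2]; split; first by apply: measurable_funD.
rewrite (_ : (fun x => _) = (fun x => (f x ^+ 2)%:E + (2%:E * (f x * g x)%:E +
   (g x ^+ 2)%:E))%E); last first.
  by apply/funext => x; rewrite -EFinM -!EFinD; congr EFin; ring.
apply: integrableD => //; apply: integrableD => //.
exact: integrableZl.
Qed.

Lemma L2N U f : measurable U -> L2 U f -> L2 U (fun x => - f x).
Proof.
move=> mU Lf; rewrite (_ : (fun x => _) = fun x => - 1 * f x); first exact: L2Z.
by apply/funext => x; rewrite mulN1r.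
Qed.

Lemma L2B U f g : measurable U -> L2 U f -> L2 U g -> L2 U (fun x => f x - g x).
Proof. by move=> mU Lf Lg; exact: (L2D mU Lf (L2N mU Lg)). Qed.

Lemma L2_sum U (I : Type) (r : seq I) (P : pred I) (F : I -> Rd -> R) :
  measurable U -> (forall i, P i -> L2 U (F i)) ->
  L2 U (fun x => \sum_(i <- r | P i) F i x).
Proof.
move=> mU LF; elim: r => [|i r IH].
  by under eq_fun do rewrite big_nil; exact: L2_cst0.
under eq_fun do rewrite big_cons.
by case Pi: (P i); [exact: (L2D mU (LF i Pi) IH)|exact: IH].
Qed.

Lemma L2_subset U V f : measurable U -> measurable V -> V `<=` U ->
  L2 U f -> L2 V f.
Proof.
move=> mU mV VU [mf f2]; split; first exact: measurable_funS mf.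
exact: integrableS f2.
Qed.

Lemma L2_bounded U f C : measurable U -> (mu U < +oo)%E ->
  measurable_fun U f -> (forall x, U x -> `|f x| <= C) -> L2 U f.
Proof.
move=> mU Uoo mf fC; split=> //.
apply: (@bounded_integrable _ _ _ (fun x => f x ^+ 2) (C ^+ 2)) => //.
  by apply: measurable_funX.
move=> x Ux; rewrite normrX lerXn2r ?nnegrE//; last exact: fC.
by rewrite (le_trans _ (fC x Ux)).
Qed.

Lemma L2_integrable U f : measurable U -> (mu U < +oo)%E -> L2 U f ->
  mu.-integrable U (EFin \o f).
Proof.
move=> mU Uoo Lf; have L1 : L2 U (fun=> 1).
  by apply: (@L2_bounded _ _ 1) => // x _; rewrite normr1.
have := L2_mul_integrable mU Lf L1.
by under [X in _.-integrable _ (_ \o X)]eq_fun do rewrite mulr1.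
Qed.

Lemma L2_supported f r U : measurable U -> continuous f -> supported_cbox r f ->
  L2 U f.
Proof.
move=> mU cf fr; split.
  by apply: measurable_funTS; exact: continuous_measurable_rV.
apply: (@integrableS _ _ _ _ setT) => //.
apply: (@supported_integrable _ _ r (fun x => f x ^+ 2)).
  by rewrite (_ : (fun x => _) = fun x => f x * f x)//; exact: continuous_mulR.
by move=> x xr; rewrite fr// expr0n.
Qed.

End L2_theory.

Section cutoff.
Context {R : realType} {d : nat}.
Notation Rd := 'rV[R]_d.
Notation mu := (@leb R d).
Variables a b : 'I_d -> R.

(** The offset 3/2 makes the first factor 0 for [t <= a l + 1/k] and 1 for [t >= a l + 2/k],
    symmetrically for the second one. Hence the support is compact in the open box, while the
    cut-offs tend to 1 at each of its points. *)
Definition cutoff1 (k : nat) (l : 'I_d) (t : R) : R :=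
  zstep (k%:R * t + (- k%:R * a l - 3 / 2)) *
  zstep (- k%:R * t + (k%:R * b l - 3 / 2)).

Definition cutoff (k : nat) (x : Rd) : R := \prod_l cutoff1 k l (x ord0 l).

Lemma cutoff_tsum k : is_tsum (cutoff k).
Proof.
apply: is_tsum_tens => l; apply: smooth1M; apply: smooth1_aff;
  exact: smooth1_zstep.
Qed.

Lemma cutoff1_ge0 k l t : 0 <= cutoff1 k l t.
Proof. by rewrite mulr_ge0 ?zstep_ge0. Qed.

Lemma cutoff1_le1 k l t : cutoff1 k l t <= 1.
Proof. by rewrite mulr_ile1 ?zstep_ge0 ?zstep_le1. Qed.

Lemma cutoff_norm_le1 k x : `|cutoff k x| <= 1.
Proof.
rewrite ger0_norm; last by rewrite prodr_ge0// => l _; exact: cutoff1_ge0.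
by apply: prodr_ile1 => l _; rewrite cutoff1_ge0 cutoff1_le1.
Qed.

Lemma cutoff_eq0 k x : ~ cbox (fun l => a l + k.+1%:R^-1) (fun l => b l - k.+1%:R^-1) x ->
  cutoff k.+1 x = 0.
Proof.
move=> /existsNP[l /negP]; rewrite negb_and -!ltNge => h.
rewrite /cutoff (bigD1 l)//= /cutoff1.
have k0 : 0 < k.+1%:R :> R by rewrite ltr0n.
have kV : k.+1%:R * k.+1%:R^-1 = 1 :> R by rewrite mulfV// gt_eqF.
case/orP: h => h.
  rewrite (@zstep_le _ (_ * _ + (- _ * _ - _))) ?mul0r//.
  by move: h; rewrite -(ltr_pM2l k0) mulrDr kV; lra.
rewrite (@zstep_le _ (- _ * _ + _)) ?mulr0 ?mul0r//.
by move: h; rewrite -(ltr_pM2l k0) mulrBr kV; lra.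
Qed.

Lemma cutoff_eq1 x : obox a b x -> \forall k \near \oo, cutoff k x = 1.
Proof.
move=> abx.
have h l : \forall k \near \oo, cutoff1 k l (x ord0 l) = 1.
  have /andP[h1 h2] := abx l.
  have e1 : 0 < x ord0 l - a l by rewrite subr_gt0.
  have e2 : 0 < b l - x ord0 l by rewrite subr_gt0.
  near=> k; rewrite /cutoff1 !zstep_ge ?mulr1//.
    have : 2 / (b l - x ord0 l) <= k%:R by near: k; exact: nbhs_infty_ger.
    by rewrite ler_pdivrMr//; lra.
  have : 2 / (x ord0 l - a l) <= k%:R by near: k; exact: nbhs_infty_ger.
  by rewrite ler_pdivrMr//; lra.
near=> k; rewrite /cutoff big1// => l _; move: l; near: k.
by apply: filter_forall => l; exact: h.
Unshelve. all: by end_near. Qed.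

Lemma cutoff_test k U : obox a b `<=` U -> test_function U (cutoff k.+1).
Proof.
move=> abU; split; first exact/is_tsum_smooth/cutoff_tsum.
exists (cbox (fun l => a l + k.+1%:R^-1) (fun l => b l - k.+1%:R^-1)); split.
- exact: compact_cbox.
- move=> x xab; apply: abU => l; have := xab l.
  have : 0 < k.+1%:R^-1 :> R by rewrite invr_gt0.
  by move: k.+1%:R^-1 => t; lra.
- by move=> x /cutoff_eq0.
Qed.

End cutoff.

(** * The fundamental lemma of the calculus of variations *)

Section fundamental_lemma.
Context {R : realType} {d : nat}.
Notation Rd := 'rV[R]_d.
Notation mu := (@leb R d).
Implicit Types (U V D : set Rd) (f g h : Rd -> R) (a b : 'I_d -> R).

Lemma oboxI a b a' b' : obox a b `&` obox a' b' =
  obox (fun l => Num.max (a l) (a' l)) (fun l => Num.min (b l) (b' l)).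
Proof.
apply/seteqP; split=> x.
  move=> [h1 h2] l; rewrite gt_max lt_min.
  by have /andP[-> ->] := h1 l; have /andP[-> ->] := h2 l.
move=> h; split=> l; have := h l; rewrite gt_max lt_min.
  by move=> /andP[/andP[-> _] /andP[-> _]].
by move=> /andP[/andP[_ ->] /andP[_ ->]].
Qed.

(** Together with [oboxI] this makes the open boxes a generating family closed under intersection,
    as the Dynkin argument in [test_ae_obox] requires. *)
Lemma measurable_obox_gen :
  @measurable _ Rd = <<s [set A | exists a b, A = obox a b] >>.
Proof.
apply/seteqP; split; last first.
  apply: smallest_sub; first exact: sigma_algebra_measurable.
  by move=> _ [a [b ->]]; exact: measurable_obox.
set G := [set A | _].
apply: smallest_sub; first exact: smallest_sigma_algebra.
rewrite -bigcup_seq => B [l _ [C mC <-]]; rewrite setTI.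
suff : @measurable _ (measurableTypeR R) `<=`
    [set C | <<s G >> ((fun x : Rd => x ord0 l) @^-1` C)] by exact.
rewrite (RGenOpens.measurableE R); apply: smallest_sub.
  split => /=; first by rewrite preimage_set0; exact: sigma_algebra0.
    by move=> A sA; rewrite setTD -preimage_setC; exact: sigma_algebraC.
  by move=> F sF; rewrite preimage_bigcup; exact: sigma_algebra_bigcup.
move=> _ [s [t ->]] /=.
rewrite (_ : _ @^-1` _ = \bigcup_k
    obox (fun j => if j == l then s else - k%:R) (fun j => if j == l then t else k%:R)).
  apply: sigma_algebra_bigcup => k; apply: sub_gen_smallest.
  by do 2 eexists.
apply/seteqP; split=> x /=.
  rewrite in_itv/= => sxt; exists (Num.truncn (\sum_j `|x ord0 j|)).+1 => // j.
  case: eqP => [->//|_]; rewrite -ltr_norml (le_lt_trans _ (truncnS_gt _))//.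
  by rewrite (bigD1 j)//= lerDl sumr_ge0.
by move=> [k _ /(_ l)]; rewrite eqxx in_itv.
Qed.

Section local.
Variables (U : set Rd) (h : Rd -> R).
Hypotheses (mU : measurable U) (Lh : L2 U h).
Hypothesis h_test : forall psi, test_function U psi ->
  \int[mu]_(x in U) (h x * psi x) = 0.

(** The indicator of the box is a bounded pointwise limit of test functions, and [h] is integrable
    on a box of finite measure, so dominated convergence applies. *)
Lemma test_obox a b : obox a b `<=` U -> (mu (obox a b) < +oo)%E ->
  (\int[mu]_(x in obox a b) (h x)%:E = 0)%E.
Proof.
move=> abU aboo; set D := obox a b.
have mD : measurable D by exact: measurable_obox.
have LhD : L2 D h by exact: L2_subset Lh.
have hD := L2_integrable mD aboo LhD.
pose f_ k x : \bar R := (h x * cutoff a b k.+1 x)%:E.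
have Lc k (V : set Rd) : measurable V -> V `<=` D -> L2 V (cutoff a b k.+1).
  move=> mV VD; apply: (@L2_bounded _ _ _ _ 1) => //.
  - by apply: le_lt_trans aboo; apply: le_measure; rewrite ?inE.
  - apply: measurable_funTS; apply: continuous_measurable_rV.
    exact/is_tsum_continuous/cutoff_tsum.
  - by move=> x _; exact: cutoff_norm_le1.
have cU k x : ~ D x -> cutoff a b k.+1 x = 0.
  move=> nD; apply: cutoff_eq0 => xab; apply: nD => l; have := xab l.
  have : 0 < k.+1%:R^-1 :> R by rewrite invr_gt0.
  by move: k.+1%:R^-1 => t; lra.
have f0 k : (\int[mu]_(x in D) f_ k x = 0)%E.
  have := h_test (@cutoff_test _ _ _ _ k _ abU).
  rewrite /Rintegral (_ : (\int[mu]_(x in U) _)%E = (\int[mu]_(x in D) f_ k x)%E).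
    move=> fk; rewrite -[LHS]fineK ?fk//; apply: integrable_fin_num => //.
    by apply: L2_mul_integrable => //; exact: Lc.
  rewrite integral_mkcond [RHS]integral_mkcond; apply: eq_integral => x _.
  rewrite !patchE; case: ifPn => xU; case: ifPn => xD //.
    by rewrite notin_setE in xD; rewrite cU// mulr0.
  by move: xU xD; rewrite notin_setE inE => + /abU.
have cv := @dominated_cvg _ _ R mu D mD (fun k => f_ k) (fun x => (h x)%:E)
  (fun x => `|h x|%:E).
have {}cv : (\int[mu]_(x in D) f_ k x)%E @[k --> \oo] --> (\int[mu]_(x in D) (h x)%:E)%E.
  apply: cv.
  - by move=> k; apply/measurable_EFinP; apply: measurable_funM; [exact: LhD.1|exact: (Lc _ _ mD _).1].
  - move=> x Dx; apply: cvg_EFin; first exact: nearW.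
    rewrite /f_/=; apply: cvg_near_cst.
    have [N _ hN] := cutoff_eq1 Dx.
    exists N => // k /= Nk; rewrite hN ?mulr1//=; exact: leqW.
  - by [].
  - exact: (integrable_abse hD).
  - move=> k x Dx; rewrite /f_ /= lee_fin normrM ler_piMr//.
    exact: cutoff_norm_le1.
have e : (fun k => \int[mu]_(x in D) f_ k x)%E = cst 0%E.
  by apply/funext => k; exact: f0.
by rewrite e in cv; apply: (cvg_unique (@ereal_hausdorff R) cv); exact: cvg_cst.
Qed.

(** The measurable sets over which [h] integrates to zero within the box form a Dynkin system; it
    contains the open boxes by [test_obox], hence all measurable sets. *)
Lemma test_ae_obox a b : obox a b `<=` U -> (mu (obox a b) < +oo)%E ->
  ae_eq mu (obox a b) (EFin \o h) (cst 0%E).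
Proof.
move=> abU aboo; set D := obox a b.
have mD : measurable D by exact: measurable_obox.
have LhD : L2 D h by exact: L2_subset Lh.
have hD := L2_integrable mD aboo LhD.
apply: integral_ae_eq => // E ED mE; rewrite integral0.
suff : (\int[mu]_(x in D `&` E) (h x)%:E = 0)%E by rewrite setIidr.
have := mE; rewrite {1}measurable_obox_gen.
apply: (dynkin_induction (G := [set A | exists a b, A = obox a b])
  (P := fun E => \int[mu]_(x in D `&` E) (h x)%:E = 0)%E).
- exact: measurable_obox_gen.
- by move=> _ _ [s [t ->]] [s' [t' ->]]; rewrite oboxI; do 2 eexists.
- by rewrite setIT; exact: test_obox.
- move=> _ [s [t ->]]; rewrite oboxI; apply: test_obox.
    by rewrite -oboxI => x [/abU].
  rewrite -oboxI; apply: le_lt_trans aboo; apply: le_measure; rewrite ?inE//.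
  by apply: measurableI => //; exact: measurable_obox.
- move=> S mS hS.
  have : (\int[mu]_(x in D) (h x)%:E = 0)%E by exact: test_obox.
  rewrite -{1}(setUIDK D S) integral_setU//=.
  + by rewrite hS add0e -setDE.
  + exact: measurableI.
  + exact: measurableD.
  + by rewrite setUIDK; exact: (measurable_int _ hD).
  + by apply/disj_setPS => x [[_ ?] [_ ?]].
- move=> F mF tF hF; rewrite setI_bigcupr integral_bigcup.
  + by rewrite eseries0// => i _ _; exact: hF.
  + exact: trivIset_setIl.
  + by move=> k; exact: measurableI.
  + rewrite -setI_bigcupr; apply: integrableS hD => //.
    by apply: measurableI => //; exact: bigcupT_measurable.
Qed.

End local.

(** The family enumerates all rational boxes and those not contained in [U] are ignored afterwards,
    so that countably many null sets exhaust [U]. *)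
Lemma open_obox_cover U : open U -> exists (a b : nat -> 'I_d -> R),
  (forall k, (mu (obox (a k) (b k)) < +oo)%E) /\
  (forall x, U x -> exists k, obox (a k) (b k) `<=` U /\ obox (a k) (b k) x).
Proof.
move=> oU.
pose F (p : 'rV[rat]_d * nat) := (fun l : 'I_d => ratr (p.1 ord0 l) - p.2.+1%:R^-1 : R).
pose G (p : 'rV[rat]_d * nat) := (fun l : 'I_d => ratr (p.1 ord0 l) + p.2.+1%:R^-1 : R).
pose c (k : nat) := odflt (0, 0%N) (unpickle k) : 'rV[rat]_d * nat.
exists (fun k => F (c k)), (fun k => G (c k)); split.
  move=> k; rewrite leb_obox ?ltry// => l; rewrite /F /G.
  by rewrite lerD2l ge0_cp// invr_ge0.
move=> x Ux.
have /nbhs_rVP[e e0 eU] := open_nbhs_nbhs (conj oU Ux).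
have [k ke] : exists k : nat, k.+1%:R^-1 < e / 2.
  exists (Num.truncn (e / 2)^-1); rewrite invf_plt ?posrE ?divr_gt0//.
  by exact: (truncnS_gt).
have q l : exists r : rat, `|x ord0 l - ratr r| < k.+1%:R^-1.
  have [|r] := @rat_in_itvoo R (x ord0 l - k.+1%:R^-1) (x ord0 l + k.+1%:R^-1).
    by rewrite ltrD2l gt0_cp// invr_gt0.
  by rewrite in_itv/= => xr; exists r; rewrite distrC ltr_distl.
pose r := \row_l projT1 (cid (q l)).
have xr l : `|x ord0 l - ratr (r ord0 l)| < k.+1%:R^-1.
  by rewrite mxE; case: cid => s /=.
exists (pickle (r, k)); rewrite /c pickleK/= /F /G/=; split.
  move=> y yr; apply: eU => l; have := yr l; have := xr l; move: (ratr _) => t.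
  rewrite !ltr_norml; move: k.+1%:R^-1 ke => u; lra.
by move=> l; have := xr l; rewrite ltr_norml; move: (ratr _) k.+1%:R^-1 => t u; lra.
Qed.

Lemma fundamental_lemma U h : open U -> L2 U h ->
  (forall psi, test_function U psi -> \int[mu]_(x in U) (h x * psi x) = 0) ->
  {ae mu, forall x, U x -> h x = 0}.
Proof.
move=> oU Lh hU; have mU := open_measurable_rV oU.
have [a [b [aboo cover]]] := open_obox_cover oU.
pose N k := if `[< obox (a k) (b k) `<=` U >] then
  ~` [set x | obox (a k) (b k) x -> h x = 0] else set0.
have : mu.-negligible (\bigcup_k N k).
  apply: negligible_bigcup => k; rewrite /N; case: ifPn => [/asboolP kU|_].
    have := test_ae_obox mU Lh hU kU (aboo k).
    apply: filterS => x /= hx Dx.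
    by have [] := hx Dx.
  exact: negligible_set0.
apply: negligibleS => x /= /not_implyP[Ux hx].
have [k [kU kx]] := cover x Ux.
by exists k => //; rewrite /N asboolT//= => /(_ kx).
Qed.

End fundamental_lemma.

Section weak_derivatives.
Context {R : realType} {d : nat}.
Notation Rd := 'rV[R]_d.
Notation mu := (@leb R d).
Implicit Types (U V D : set Rd) (f g h psi : Rd -> R) (s : seq 'I_d).

Lemma smooth_is_derive s l psi x : smooth psi ->
  is_derive x (delta_mx ord0 l) (iter_partial s psi) (iter_partial (l :: s) psi x).
Proof. by move=> sp; split; [exact: (sp s).2|]. Qed.

Lemma test_support U psi : test_function U psi -> exists r : R,
  forall s, supported_cbox r (iter_partial s psi) /\
    forall x, ~ U x -> iter_partial s psi x = 0.
Proof.
move=> [sp [K [cK KU K0]]].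
have oK : open (~` K) by apply: closed_openC; exact: compact_closed_rV.
have z s x : ~ K x -> iter_partial s psi x = 0.
  move=> nK; rewrite (@iter_partial_local _ _ (~` K) s psi (fun=> 0) oK K0)//.
  elim: s {nK} x => [//|l s IH] x /=; rewrite -/(iter_partial s _).
  have -> : iter_partial s (fun=> 0) = cst 0 :> (Rd -> R) by apply/funext.
  exact: derive_cst.
have /compact_bounded[M [_ hM]] := cK.
exists (`|M| + 2) => s; split; last by move=> x nU; apply: z => /KU.
move=> x [l xl]; apply: z => Kx.
have : `|x| <= `|M| + 1.
  by apply: hM => //; rewrite (le_lt_trans (ler_norm _))// ltrDl.
move=> xM; have : ball (0 : Rd) (`|M| + 2) x.
  by rewrite -ball_normE /ball_/= sub0r normrN; lra.
by move=> [_ /(_ ord0 l)]; rewrite /ball/= mxE sub0r normrN ltNge xl.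
Qed.

Lemma test_L2 U D psi s : measurable D -> test_function U psi ->
  L2 D (iter_partial s psi).
Proof.
move=> mD tp; have [r h] := test_support tp.
by apply: L2_supported (h s).1 => //; exact: (tp.1 s).1.
Qed.

(** The outermost derivative of [psi] moves first and becomes the innermost one of [g], hence
    [rev s]; [weak_tsum] restores the order through [is_tsum_perm]. *)
Lemma tsum_parts U psi g s : test_function U psi -> is_tsum g ->
  \int[mu]_x (g x * iter_partial s psi x) =
  (-1) ^+ size s * \int[mu]_x (iter_partial (rev s) g x * psi x).
Proof.
move=> tp; have [r hr] := test_support tp.
elim: s g => [|l s IH] g tg; first by rewrite expr0 mul1r.
have tg1 := is_tsum_iter_partial [:: l] tg.
rewrite rev_cons -cats1 -iter_partial_cat /= exprS -mulrA -IH//.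
pose F x := g x * iter_partial s psi x.
pose G1 x := g x * iter_partial (l :: s) psi x.
pose G2 x := iter_partial [:: l] g x * iter_partial s psi x.
have cps t : continuous (iter_partial t psi) := (tp.1 t).1.
have cG1 : continuous G1 by apply: continuous_mulR => //; exact: is_tsum_continuous.
have cG2 : continuous G2 by apply: continuous_mulR => //; exact: is_tsum_continuous.
have sup t f : supported_cbox r (fun x => f x * iter_partial t psi x).
  by move=> x xr; rewrite (hr t).1// mulr0.
have iG1 := supported_integrable cG1 (sup (l :: s) g).
have iG2 := supported_integrable cG2 (sup s _).
have : (\int[mu]_x (G1 x + G2 x)%:E = 0)%E.
  apply: (@integral_partial_eq0 _ _ l F (fun x => G1 x + G2 x) r).
  - exact: continuous_addR.
  - move=> x; have := is_deriveM (is_tsum_derive l x tg) (smooth_is_derive s l x tp.1).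
    set D1 := (X in is_derive _ _ _ X -> _) => h.
    rewrite [X in is_derive _ _ _ X](_ : _ = D1); first exact: h.
    by rewrite /D1 /G1 /G2 /GRing.scale/= [X in _ + X]mulrC.
  - exact: sup.
  - by move=> x xr; rewrite /G1 (sup (l :: s) g x xr) add0r; exact: (sup s _ x xr).
move=> e; have : \int[mu]_x (G1 x + G2 x) = 0 by rewrite /Rintegral e.
rewrite RintegralD// => /eqP; rewrite addr_eq0 => /eqP ->.
by rewrite mulN1r.
Qed.

Lemma size_partial_seq k (a : multi k) :
  size (flatten [seq nseq (a l) l | l <- enum 'I_d]) = morder a.
Proof.
rewrite size_flatten /shape -map_comp /morder sumnE big_map big_enum/=.
by apply: eq_bigr => l _; rewrite size_nseq.
Qed.

Lemma test_integral U psi f s : test_function U psi ->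
  \int[mu]_(x in U) (f x * iter_partial s psi x) =
  \int[mu]_x (f x * iter_partial s psi x).
Proof.
move=> tp; have [r hr] := test_support tp.
rewrite Rintegral_mkcond; apply: eq_Rintegral => x _; rewrite patchE.
case: ifPn => //; rewrite notin_setE => nU.
by rewrite (hr s).2// mulr0.
Qed.

Lemma weak_tsum U k (a : multi k) g : is_tsum g ->
  weak_partial U a g (partial a g).
Proof.
move=> tg psi tp; rewrite /partial test_integral// (tsum_parts _ tp tg).
rewrite size_partial_seq (@is_tsum_perm _ _ _ (flatten [seq nseq (a l) l | l <- enum 'I_d])) //.
  by rewrite -(@test_integral U psi _ [::]).
by rewrite perm_rev.
Qed.

Lemma weak_unique U k (a : multi k) f g g' : open U -> L2 U g -> L2 U g' ->
  weak_partial U a f g -> weak_partial U a f g' ->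
  {ae mu, forall x, U x -> g x = g' x}.
Proof.
move=> oU Lg Lg' wg wg'; have mU := open_measurable_rV oU.
have := @fundamental_lemma _ _ U (fun x => g x - g' x) oU (L2B mU Lg Lg').
suff h : forall psi, test_function U psi ->
    \int[mu]_(x in U) ((g x - g' x) * psi x) = 0.
  move=> /(_ h); apply: filterS => x gg' Ux.
  by apply/eqP; rewrite -subr_eq0 gg'.
move=> psi tp; have Lp := test_L2 [::] mU tp.
under eq_Rintegral do rewrite mulrBl.
rewrite RintegralB//; [|exact: L2_mul_integrable|exact: L2_mul_integrable].
apply/eqP; rewrite subr_eq0; apply/eqP.
have := wg psi tp; rewrite (wg' psi tp) => /(congr1 (fun t => (-1) ^+ morder a * t)).
by rewrite !mulrA -expr2 -exprM mulnC exprM sqrrN expr1n expr1n !mul1r.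
Qed.

Lemma weak_lin U k (a : multi k) c f g f' g' : measurable U ->
  L2 U f -> L2 U g -> L2 U f' -> L2 U g' ->
  weak_partial U a f g -> weak_partial U a f' g' ->
  weak_partial U a (fun x => c * f x + f' x) (fun x => c * g x + g' x).
Proof.
move=> mU Lf Lg Lf' Lg' wf wf' psi tp.
have split_ (p q psi1 : Rd -> R) : L2 U p -> L2 U q -> L2 U psi1 ->
    \int[mu]_(x in U) ((c * p x + q x) * psi1 x) =
    c * \int[mu]_(x in U) (p x * psi1 x) + \int[mu]_(x in U) (q x * psi1 x).
  move=> Lp Lq Ls; rewrite -RintegralZl//; last exact: L2_mul_integrable.
  rewrite -RintegralD//; last 2 first.
  - rewrite (_ : EFin \o _ = fun x => (c%:E * (p x * psi1 x)%:E)%E)//.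
    by apply: integrableZl => //; exact: L2_mul_integrable.
  - exact: L2_mul_integrable.
  by apply: eq_Rintegral => x _; rewrite mulrDl mulrA.
have Lp := test_L2 [::] mU tp; have Lpa := test_L2 _ mU tp.
rewrite !split_//; last exact: Lpa.
by rewrite wf// wf'// mulrDr; congr (_ + _); rewrite mulrCA.
Qed.

Lemma test_subset U V psi : V `<=` U -> test_function V psi -> test_function U psi.
Proof.
by move=> VU [sp [K [cK KV K0]]]; split=> //; exists K; split=> // x /KV /VU.
Qed.

Lemma weak_subset U V k (a : multi k) f g : V `<=` U ->
  weak_partial U a f g -> weak_partial V a f g.
Proof.
move=> VU wf psi tp; have tU := test_subset VU tp.
have := wf psi tU; rewrite /partial !test_integral// => ->; congr (_ * _).
by rewrite (test_integral g [::] tU) (test_integral g [::] tp).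
Qed.

Lemma weak_partial_eq U k (a : multi k) f f' g g' :
  (forall x, U x -> f x = f' x) -> (forall x, U x -> g x = g' x) ->
  weak_partial U a f g -> weak_partial U a f' g'.
Proof.
move=> ff' gg' w psi tp; have := w psi tp.
rewrite (@eq_Rintegral _ _ _ mu _ (fun x => f' x * partial a psi x)); last first.
  by move=> x; rewrite inE => Ux; rewrite ff'.
move=> ->; congr (_ * _); apply: eq_Rintegral => x; rewrite inE => Ux.
by rewrite gg'.
Qed.

Lemma L2_eq U f f' : measurable U -> (forall x, U x -> f x = f' x) -> L2 U f -> L2 U f'.
Proof.
move=> mU ff' [mf f2]; split.
  by apply: eq_measurable_fun mf => x; rewrite inE => /ff'.
by apply: eq_integrable f2 => // x; rewrite inE => /ff' ->.
Qed.

Lemma wpartial_eq U k (a : multi k) f f' : (forall x, U x -> f x = f' x) ->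
  wpartial U a f = wpartial U a f'.
Proof.
move=> ff'; rewrite /wpartial; congr xget; apply/seteqP; split=> g [Lg wg];
  split=> //; apply: weak_partial_eq wg => // x /ff' //.
Qed.

(** The witness [g] excludes the default value of the choice in [wpartial], and uniqueness compares
    the choice with [g]. *)
Lemma wpartialP U k (a : multi k) f g : open U -> L2 U g -> weak_partial U a f g ->
  [/\ L2 U (wpartial U a f), weak_partial U a f (wpartial U a f) &
      {ae mu, forall x, U x -> wpartial U a f x = g x}].
Proof.
move=> oU Lg wg; have [Lw ww] : [set g | L2 U g /\ weak_partial U a f g] (wpartial U a f).
  by apply: (@xgetPex _ (fun=> 0)); exists g.
by split=> //; exact: weak_unique ww wg.
Qed.

End weak_derivatives.

(** * Domination of quadratic forms *)

Section quadratic_forms.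
Context {R : realFieldType}.

(** All Cauchy-Schwarz inequalities below come from here. The cases [c <= 0] are included, so that
    the leading coefficient may degenerate. *)
Lemma discriminant_le (a b c : R) :
  (forall t, 0 <= a + 2 * t * b + t ^+ 2 * c) -> b ^+ 2 <= a * c.
Proof.
move=> h.
have [c0|c0|c0] := ltgtP c 0.
- have a0 : 0 <= a by have := h 0; lra.
  (* For [c < 0] the values at [1 + w] and [- (1 + w)] add up to a negative number, the linear terms
     cancelling. *)
  pose w := (a + 1) / - c.
  have w0 : 0 <= w by rewrite divr_ge0//; lra.
  have wc : w * - c = a + 1 by rewrite mulfVK// oppr_eq0 lt_eqF.
  have := h (1 + w); have := h (- (1 + w)).
  have : (1 + w) ^+ 2 * - c = - c + 2 * (a + 1) + w * (a + 1).
    by rewrite -[in RHS]wc; ring.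
  have : 0 <= w * (a + 1) by rewrite mulr_ge0//; lra.
  by rewrite sqrrN; lra.
- have := h (- b / c).
  have -> : a + 2 * (- b / c) * b + (- b / c) ^+ 2 * c = (a * c - b ^+ 2) / c.
    by field; rewrite gt_eqF.
  by rewrite pmulr_lge0 ?invr_gt0// subr_ge0.
- subst c; rewrite mulr0.
  have [->|b0] := eqVneq b 0; first by rewrite expr0n.
  have := h (- (a + 1) / (2 * b)).
  have -> : a + 2 * (- (a + 1) / (2 * b)) * b + (- (a + 1) / (2 * b)) ^+ 2 * 0 = -1.
    by field.
  by rewrite oppr_ge0 ler10.
Qed.

Definition qform N (A : 'M[R]_N) (c : 'rV[R]_N) : R := (c *m A *m c^T) ord0 ord0.

(* Cauchy-Schwarz for a positive semidefinite form. *)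
Lemma qform_cross N (A : 'M[R]_N) (c e : 'rV[R]_N) : A^T = A ->
  (forall c, 0 <= qform A c) ->
  ((c *m A *m e^T) ord0 ord0) ^+ 2 <= qform A c * qform A e.
Proof.
move=> sA pA; apply: discriminant_le => t.
have sym : (e *m A *m c^T) ord0 ord0 = (c *m A *m e^T) ord0 ord0.
  rewrite -[in RHS](trmxK (c *m A *m e^T)) [in RHS]mxE !trmx_mul trmxK sA.
  by rewrite mulmxA.
have := pA (c + t *: e); rewrite /qform.
rewrite linearD linearZ/= !mulmxDl !mulmxDr -!scalemxAl -!scalemxAr.
rewrite !mxE; rewrite -!/((_ *m _) ord0 ord0).
move: sym; rewrite !mxE => ->.
congr (0 <= _); ring.
Qed.

(** Inclusion of the kernels gives a factorization [A = B Z B]. Then [qform A c] is a quadratic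
    expression in the entries of [c B], and Cauchy-Schwarz bounds the square of each entry by
    [qform B c] times a diagonal entry of [B]. The constant is explicit and no compactness
    enters. *)
Lemma form_domination N (A B : 'M[R]_N) : A^T = A -> B^T = B ->
  (forall c, 0 <= qform A c) -> (forall c, 0 <= qform B c) ->
  (forall c, qform B c = 0 -> qform A c = 0) ->
  exists2 C, 0 <= C & forall c, qform A c <= C * qform B c.
Proof.
move=> sA sB pA pB BA.
have ker (D : 'M[R]_N) c : D^T = D -> (forall c, 0 <= qform D c) ->
    qform D c = 0 -> c *m D = 0.
  move=> sD pD Dc; apply/rowP => j; have := qform_cross c (delta_mx ord0 j) sD pD.
  rewrite Dc mul0r trmx_delta -colE mxE => h.
  have : (c *m D) ord0 j ^+ 2 == 0 by rewrite eq_le h sqr_ge0.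
  by rewrite sqrf_eq0 [RHS]mxE => /eqP.
(* As both matrices are symmetric, the inclusion of kernels dualizes to an inclusion of row
   spaces. *)
have AB : (A <= B)%MS.
  suff : (kermx B <= kermx A)%MS.
    move=> h.
    have rk : (A *m cokermx B = 0).
      have : (cokermx B)^T *m B = 0 by rewrite -[X in _ *m X]sB -trmx_mul mulmx_coker trmx0.
      move=> /sub_kermxP/submx_trans/(_ h)/sub_kermxP cA.
      by rewrite -[LHS]trmxK trmx_mul sA cA trmx0.
    by rewrite submxE rk.
  apply/rV_subP => u /sub_kermxP uB; apply/sub_kermxP.
  apply: (ker _ _ sA pA); apply: BA; by rewrite /qform uB mul0mx mxE.
(* With the pseudo-inverse B' this identity and its transpose give [Z = B'^T A B']. *)
have e1 : A *m pinvmx B *m B = A by exact: mulmxKpV.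
move: (pinvmx B) e1 => pB' e1.
have e2 : B *m pB'^T *m A = A.
  by move/(congr1 trmx): e1; rewrite !trmx_mul sA sB mulmxA.
have [Z AZ] : exists Z, A = B *m Z *m B.
  by exists (pB'^T *m A *m pB'); rewrite !mulmxA e2 e1.
pose K j := qform B (delta_mx ord0 j).
exists (\sum_i \sum_j `|Z i j| * (K i + K j)).
  by apply: sumr_ge0 => i _; apply: sumr_ge0 => j _; rewrite mulr_ge0// addr_ge0// pB.
move=> c; pose y := c *m B.
have yK j : y ord0 j ^+ 2 <= qform B c * K j.
  have := qform_cross c (delta_mx ord0 j) sB pB.
  by rewrite trmx_delta -colE [X in X ^+ 2 <= _]mxE.
have q0 := pB c.
have -> : qform A c = \sum_i \sum_j y ord0 i * Z i j * y ord0 j.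
  rewrite /qform AZ !mulmxA -/y -mulmxA.
  have -> : B *m c^T = y^T by rewrite /y trmx_mul sB.
  rewrite mxE exchange_big/=; apply: eq_bigr => j _.
  by rewrite [(y *m Z) _ _]mxE [y^T _ _]mxE mulr_suml.
rewrite mulr_suml; apply: ler_sum => i _; rewrite mulr_suml.
apply: ler_sum => j _.
have yi := yK i; have yj := yK j.
apply: (le_trans (ler_norm _)); rewrite !normrM mulrAC mulrC -mulrA ler_wpM2l//.
have h2 : `|y ord0 i| * `|y ord0 j| <= y ord0 i ^+ 2 + y ord0 j ^+ 2.
  rewrite -(real_normK (num_real (y ord0 i))) -(real_normK (num_real (y ord0 j))).
  by have := normr_ge0 (y ord0 i); have := normr_ge0 (y ord0 j); nra.
by apply: le_trans h2 _; rewrite mulrDl ![K _ * _]mulrC; exact: lerD.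
Qed.

Lemma quad_domination (I : finType) (GA GB : I -> I -> R) :
  (forall i j, GA i j = GA j i) -> (forall i j, GB i j = GB j i) ->
  (forall c : I -> R, 0 <= \sum_i \sum_j c i * c j * GA i j) ->
  (forall c : I -> R, 0 <= \sum_i \sum_j c i * c j * GB i j) ->
  (forall c : I -> R, \sum_i \sum_j c i * c j * GB i j = 0 ->
     \sum_i \sum_j c i * c j * GA i j = 0) ->
  exists2 C, 0 <= C & forall c : I -> R,
    \sum_i \sum_j c i * c j * GA i j <= C * \sum_i \sum_j c i * c j * GB i j.
Proof.
move=> sA sB pA pB BA.
pose mat (G : I -> I -> R) : 'M[R]_#|I| := \matrix_(i, j) G (enum_val i) (enum_val j).
pose vec (c : I -> R) : 'rV[R]_#|I| := \row_i c (enum_val i).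
pose cev (v : 'rV[R]_#|I|) (i : I) := v ord0 (enum_rank i).
have matE G c : qform (mat G) (vec c) = \sum_i \sum_j c i * c j * G i j.
  rewrite /qform mxE [RHS]exchange_big/= [RHS](reindex_onto enum_val enum_rank)/=; last first.
    by move=> i _; rewrite enum_rankK.
  apply: eq_big => [j|j _]; first by rewrite enum_valK eqxx.
  rewrite !mxE mulr_suml [RHS](reindex_onto enum_val enum_rank)/=; last first.
    by move=> i _; rewrite enum_rankK.
  apply: eq_big => [i|i _]; first by rewrite enum_valK eqxx.
  by rewrite !mxE mulrAC.
have vecK v : vec (cev v) = v by apply/rowP => j; rewrite mxE /cev enum_valK.
have [|||||C C0 hC] := @form_domination _ (mat GA) (mat GB).
- by apply/matrixP => i j; rewrite !mxE.
- by apply/matrixP => i j; rewrite !mxE.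
- by move=> v; rewrite -(vecK v) matE.
- by move=> v; rewrite -(vecK v) matE.
- by move=> v; rewrite -(vecK v) !matE; exact: BA.
by exists C => // c; rewrite -!matE.
Qed.

End quadratic_forms.

(** Bounded overlap: for a fixed offset the translated list is again free of duplicates, so each of
    the finitely many offsets contributes at most [X]. *)
Lemma shift_sum (R : realDomainType) (I : zmodType) (m : I -> R) (X : R)
    (T : finType) (off : T -> I) (s : seq I) :
  (forall s, uniq s -> \sum_(j <- s) m j <= X) -> uniq s ->
  \sum_(i <- s) \sum_t m (i + off t) <= #|T|%:R * X.
Proof.
move=> mX us; rewrite exchange_big/=.
rewrite (_ : #|T|%:R * X = \sum_(t : T) X); last first.
  by rewrite sumr_const mulr_natl.
apply: ler_sum => t _; rewrite -(big_map (fun i => i + off t) predT m).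
by apply: mX; rewrite map_inj_uniq// => i j /addIr.
Qed.

(** * The partition functions as tensor products *)

Section phi_formula.
Context {R : realType} {d : nat}.
Variable sigma : R.
Hypothesis sigma0 : 0 < sigma.
Local Notation lambda := (@lebesgue_measure R).

Let kern (i : int) (x y : R) : R :=
  \1_(`](i%:~R - 2^-1) * sigma, (i%:~R + 2^-1) * sigma[) y *
  (sigma^-1 * zeta1 (sigma^-1 * (x - y))).

(** As a function of [y] the rescaled [zeta1] has the primitive [k], a reflected [zstep]; its values
    at the two ends of the core differ by [phi1]. *)
Lemma kern_integral (i : int) (x : R) :
  (\int[lambda]_y (kern i x y)%:E = (phi1 (sigma^-1 * x - i%:~R))%:E)%E.
Proof.
pose a : R := (i%:~R - 2^-1) * sigma; pose b : R := (i%:~R + 2^-1) * sigma.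
have ab : a < b by rewrite ltr_pM2r//; lra.
pose g (y : R) : R := sigma^-1 * zeta1 (sigma^-1 * (x - y)).
have cg : continuous g.
  apply: smooth1_continuous; apply: smooth1Z.
  rewrite (_ : (fun y => _) = fun y => zeta1 (- sigma^-1 * y + sigma^-1 * x)).
    by apply: smooth1_aff; exact: smooth1_zeta1.
  by apply/funext => y; congr zeta1; ring.
pose k (y : R) : R := - zstep (- sigma^-1 * y + sigma^-1 * x).
have dk (y : R) : is_derive y 1 k (g y).
  have dl : is_derive y 1 (fun y : R => - sigma^-1 * y + sigma^-1 * x) (- sigma^-1).
    by apply: is_derive_eq; rewrite addr0 scaler1.
  have := @is_derive1_comp _ (@zstep R) (fun y : R => - sigma^-1 * y + sigma^-1 * x) y _ _
    (zstep_derive _) dl.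
  move=> /is_deriveN; rewrite (_ : - (zeta1 _ * _) = g y)//.
  by rewrite mulrN opprK mulrC /g; congr (_ * zeta1 _); ring.
have ck : continuous k by apply: derivable_continuous => y; have [] := dk y.
transitivity (\int[lambda]_(y in `[a, b]) (g y)%:E)%E.
  rewrite -integral_itv_obnd_cbnd; last first.
    by apply/measurable_EFinP; apply: measurable_funTS; exact: continuous_measurable_fun.
  rewrite -integral_itv_bndo_bndc; last first.
    by apply/measurable_EFinP; apply: measurable_funTS; exact: continuous_measurable_fun.
  rewrite [RHS]integral_mkcond; apply: eq_integral => y _.
  by rewrite patchE /kern indicE; case: ifPn => _; rewrite ?mul1r ?mul0r.
rewrite (@continuous_FTC2 _ _ k)//.
- rewrite -EFinB; congr EFin; rewrite /k /phi1 opprK addrC; congr (zstep _ - zstep _).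
    by rewrite /a; field; rewrite gt_eqF.
  by rewrite /b; field; rewrite gt_eqF.
- exact: continuous_subspaceT.
- split.
  + by move=> y _; have [] := dk y.
  + by apply: cvg_at_right_filter; exact: ck.
  + by apply: cvg_at_left_filter; exact: ck.
- by move=> y _; rewrite derive1E; have [] := dk y.
Qed.

Lemma phiE (i : {ffun 'I_d -> int}) (x : 'rV[R]_d) :
  phi sigma i x = \prod_l phi1 (sigma^-1 * x ord0 l - (i l)%:~R).
Proof.
rewrite /phi /Rintegral.
rewrite (_ : (\int[leb d]_y _)%E = (\int[leb d]_y (\prod_l kern (i l) (x ord0 l) (y ord0 l))%:E)%E).
  rewrite (@ge0_integral_tensor _ _ (fun l => kern (i l) (x ord0 l))
    (fun l => phi1 (sigma^-1 * x ord0 l - (i l)%:~R)))// => [l|l t|l].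
  - apply: measurable_funM; first exact: measurable_indic.
    apply: continuous_measurable_fun; apply: smooth1_continuous; apply: smooth1Z.
    rewrite (_ : (fun y => _) = fun y => zeta1 (- sigma^-1 * y + sigma^-1 * x ord0 l)).
      by apply: smooth1_aff; exact: smooth1_zeta1.
    by apply/funext => y; congr zeta1; ring.
  - by rewrite mulr_ge0// mulr_ge0 ?zeta1_ge0// invr_ge0 ltW.
  - exact: kern_integral.
apply: eq_integral => y _; congr EFin.
rewrite /zeta_sigma /zeta /kern [RHS]big_split/=; congr (_ * _).
  rewrite indicE; case: (boolP (y \in core sigma i)) => yc /=.
    rewrite big1// => l _; rewrite indicE mem_set//= in_itv/=.
    by move: yc; rewrite inE => /(_ l).
  have /existsNP[l yl] : ~ core sigma i y by rewrite -notin_setE.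
  by rewrite (bigD1 l)//= indicE memNset ?mul0r//= in_itv.
rewrite [RHS]big_split/= prodr_const card_ord exprVn; congr (_ * _).
by apply: eq_bigr => l _; rewrite !mxE.
Qed.

End phi_formula.

(** * Grid and elements *)

Lemma open_subset_interior (T : topologicalType) (U A : set T) : open U ->
  U `<=` A -> U `<=` interior A.
Proof. by move=> oU UA x Ux; apply: filterS UA _; exact: open_nbhs_nbhs. Qed.

Section open_positive.
Context {R : realType} {d : nat}.
Notation Rd := 'rV[R]_d.
Notation mu := (@leb R d).

Lemma open_leb_gt0 (U : set Rd) : open U -> U !=set0 -> (0 < mu U)%E.
Proof.
move=> oU [x Ux]; have /nbhs_rVP[e e0 eU] := open_nbhs_nbhs (conj oU Ux).
pose a l := x ord0 l - e / 2; pose b l := x ord0 l + e / 2.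
apply: (@lt_le_trans _ _ (mu (obox a b))).
  rewrite leb_obox => [|l]; last by rewrite /a /b; lra.
  by rewrite lte_fin; apply: prodr_gt0 => l _; rewrite /a /b; lra.
apply: le_measure; rewrite ?inE; [exact: measurable_obox|exact: open_measurable_rV|].
by move=> y yab; apply: eU => l; have := yab l; rewrite /a /b ltr_norml; lra.
Qed.

(** Otherwise [f] would be nonzero on a nonempty open set, which has positive measure by
    [open_leb_gt0]. *)
Lemma continuous_int0 (U : set Rd) (f : Rd -> R) : open U -> continuous f ->
  mu.-integrable U (EFin \o (fun x => f x ^+ 2)) ->
  \int[mu]_(x in U) (f x ^+ 2) = 0 -> forall x, U x -> f x = 0.
Proof.
move=> oU cf fi f0 x Ux; apply: contrapT => /eqP fx.
have mU := open_measurable_rV oU.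
have : (\int[mu]_(x in U) `|(f x ^+ 2)%:E| = 0)%E.
  under eq_integral do rewrite gee0_abs ?lee_fin ?sqr_ge0//.
  by rewrite -[LHS]fineK ?[X in X%:E]f0//; exact: integrable_fin_num.
move=> /(ae_eq_integral_abs _ mU (measurable_int _ fi))[N [mN N0 subN]].
pose V := U `&` [set y | f y != 0].
have oV : open V.
  apply: openI => //; rewrite (_ : [set y | _] = f @^-1` [set t | t != 0]).
    by move/continuousP : cf; apply; exact: open_neq.
  by apply/seteqP; split.
have := open_leb_gt0 oV (ex_intro _ x (conj Ux fx)).
suff -> : mu V = 0 by rewrite ltxx.
apply: (subset_measure0 _ mN _ N0); first exact: open_measurable_rV.
move=> y [Uy fy]; apply: subN => /= /(_ Uy)/eqP.
by rewrite /= eqe sqrf_eq0 (negbTE fy).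
Qed.

End open_positive.

Lemma intrD1 (R : pzRingType) (z : int) : (z + 1)%:~R = z%:~R + 1 :> R.
Proof. by rewrite intrD. Qed.

Section grid_geometry.
Context {R : realType} {d : nat}.
Variable sigma : R.
Hypothesis sigma0 : 0 < sigma.
Notation Rd := 'rV[R]_d.
Notation mu := (@leb R d).
Notation index := {ffun 'I_d -> int}.
Notation elem := (@elem R d sigma).
Implicit Types (i j k : index) (Omega U D : set Rd) (I : set index).

Definition celem i : set Rd :=
  cbox (fun l => (i l)%:~R * sigma) (fun l => ((i l)%:~R + 1) * sigma).

Lemma open_elem i : open (elem i). Proof. exact: open_obox. Qed.

Lemma measurable_elem i : measurable (elem i).
Proof. exact: measurable_obox. Qed.

Definition center i : Rd := \row_l (((i l)%:~R + 2^-1) * sigma).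

Lemma elem_center i : elem i (center i).
Proof.
by move=> l; rewrite mxE; apply/andP; split; rewrite ltr_pM2r// ?ltrDl ?ltrD2l; lra.
Qed.

Lemma subset_elem_celem i : elem i `<=` celem i.
Proof. by move=> x h l; have /andP[/ltW -> /ltW ->] := h l. Qed.

Lemma closure_elem i : closure (elem i) = celem i.
Proof.
apply/seteqP; split.
  rewrite [X in _ `<=` X](closure_id _).1.
    exact: closure_subset (@subset_elem_celem i).
  by apply: compact_closed_rV; exact: compact_cbox.
move=> x xi A /nbhs_rVP[e e0 eA].
(* Moving [x] towards the center by the fraction [t] enters the open element and displaces each
   coordinate by at most [t * sigma < e]. *)
pose t := Num.min 2^-1 (e / (2 * sigma)).
have t0 : 0 < t by rewrite lt_min divr_gt0 ?mulr_gt0// andbT; lra.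
have t1 : t <= 2^-1 by rewrite ge_min lexx.
have te : t * sigma < e.
  have : t <= e / (2 * sigma) by rewrite ge_min lexx orbT.
  by rewrite ler_pdivlMr ?mulr_gt0//; lra.
pose y : Rd := (1 - t) *: x + t *: center i.
have dist l : `|center i ord0 l - x ord0 l| <= sigma.
  have := xi l; rewrite mxE mulrDl mul1r => h.
  by rewrite ler_norml mulrDl; move: (_ * sigma) h => u h; lra.
exists y; split; last first.
  apply: eA => l; rewrite !mxE.
  have := dist l; rewrite mxE; set c := _ * sigma => dl.
  rewrite (_ : _ - _ = t * (c - x ord0 l)); last by ring.
  rewrite normrM gtr0_norm// (le_lt_trans _ te)// ler_pM2l//.
move=> l; rewrite !mxE; have := xi l; have := elem_center i l; rewrite mxE.
set c := (_ + _^-1) * sigma; set a := _%:~R * sigma; set b := (_ + 1) * sigma.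
move=> /andP[h1 h2] /andP[h3 h4].
have q : 0 < t * (c - a) by rewrite mulr_gt0// subr_gt0.
have q' : 0 < t * (b - c) by rewrite mulr_gt0// subr_gt0.
have p : 0 <= (1 - t) * (x ord0 l - a) by rewrite mulr_ge0//; lra.
have p' : 0 <= (1 - t) * (b - x ord0 l) by rewrite mulr_ge0//; lra.
by apply/andP; split; lra.
Qed.

Lemma elem_celem_inj i j x : elem i x -> celem j x -> i = j.
Proof.
move=> xi xj; apply/ffunP => l.
have /andP[h1 h2] := xi l; have /andP[h3 h4] := xj l.
have : (i l)%:~R < (j l)%:~R + 1 :> R by rewrite -(ltr_pM2r sigma0) (lt_le_trans h1).
have : (j l)%:~R < (i l)%:~R + 1 :> R by rewrite -(ltr_pM2r sigma0) (le_lt_trans h3).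
by rewrite -!intrD1 !ltr_int !ltzD1 => a b; apply/le_anti; rewrite a b.
Qed.

Lemma elem_inj i j x : elem i x -> elem j x -> i = j.
Proof. by move=> xi /subset_elem_celem; exact: elem_celem_inj. Qed.

(** The center of [elem i] lies in some closed element with index in [I], and an open element meets
    no closed element except its own closure. *)
Lemma elems_domP I i : elem i `<=` elems_dom sigma I <-> I i.
Proof.
split=> [h|Ii].
  have := h _ (@elem_center i) => /interior_subset[j Ij].
  by rewrite closure_elem => /(elem_celem_inj (@elem_center i)) ->.
apply: (open_subset_interior (@open_elem i)) => x xi.
by exists i => //; rewrite closure_elem; exact: subset_elem_celem.
Qed.

Lemma open_elems_dom I : open (elems_dom sigma I).
Proof. exact: open_interior. Qed.

Definition floor_index (x : Rd) : index :=
  [ffun l => Num.floor (x ord0 l / sigma)].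

Lemma celem_floor (x : Rd) : celem (floor_index x) x.
Proof.
move=> l; rewrite /floor_index !ffunE.
have := floor_itv (x ord0 l / sigma); rewrite intrD1 ler_pdivlMr// ltr_pdivrMr//.
by move=> /andP[-> /ltW ->].
Qed.

(** A point of [Omega] lies in a closed element; the open element then meets [Omega] in a nonempty
    open set, which has positive measure. *)
Lemma subset_fict_dom Omega : open Omega -> Omega `<=` fict_dom sigma Omega.
Proof.
move=> oO; apply: (open_subset_interior oO) => y Oy.
exists (floor_index y); last first.
  by rewrite closure_elem; exact: celem_floor.
have := @celem_floor y; rewrite -closure_elem => /(_ Omega (open_nbhs_nbhs (conj oO Oy))) ne.
apply: open_leb_gt0; first by apply: openI => //; exact: open_elem.
exact: ne.
Qed.

(** Off this null set every point lies in an open element, so integrals may be split over open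
    elements. *)
Definition grid_planes : set Rd :=
  [set x : Rd | exists l (z : int), x ord0 l = z%:~R * sigma].

Lemma grid_planes_negligible : mu.-negligible grid_planes.
Proof.
pose F (n : nat) : set Rd := if unpickle n is Some (l, z) then
  [set x : Rd | x ord0 l = (z : int)%:~R * sigma] else set0.
have : mu.-negligible (\bigcup_n F n).
  apply: negligible_bigcup => n; rewrite /F; case: unpickle => [[l z]|].
    exists [set x : Rd | x ord0 l = (z : int)%:~R * sigma]; split=> //.
      rewrite -[X in measurable X]setTI.
      exact: (measurable_coord l measurableT (measurable_set1 _)).
    exact: leb_hyperplane.
  exact: negligible_set0.
apply: negligibleS => x [l [z xz]]; exists (pickle (l, z)) => //.
by rewrite /F pickleK.
Qed.

Lemma elem_floor (x : Rd) : ~ grid_planes x -> elem (floor_index x) x.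
Proof.
move=> nx l; have /andP[h1 h2] := celem_floor x l.
rewrite lt_neqAle h1 andbT; apply/andP; split.
  by apply/eqP => e; apply: nx; exists l; eexists; rewrite -e.
rewrite lt_neqAle h2 andbT; apply/eqP => e; apply: nx; exists l.
by eexists (_ + 1); rewrite intrD e.
Qed.

Lemma elem_fict_dom Omega i : elem i `<=` fict_dom sigma Omega <->
  (0 < mu (elem i `&` Omega))%E.
Proof. exact: elems_domP. Qed.

Lemma neighbor_dist i j : neighbor sigma i j -> forall l, `|i l - j l| <= 1.
Proof.
move=> [k []]; rewrite !closure_elem => ki kj l.
have := ki l; have := kj l; rewrite !mxE !ler_pM2r//.
by rewrite -!intrD1 !ler_int; lia.
Qed.

End grid_geometry.

Section element_sums.
Context {R : realType} {d : nat}.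
Variable sigma : R.
Hypothesis sigma0 : 0 < sigma.
Notation Rd := 'rV[R]_d.
Notation mu := (@leb R d).
Notation index := {ffun 'I_d -> int}.
Notation elem := (@elem R d sigma).
Implicit Types (i j : index) (Omega U D E : set Rd) (s : seq index).

Definition sqint D (f : Rd -> R) : R := \int[mu]_(x in D) (f x ^+ 2).

Lemma sqint_ge0 D f : 0 <= sqint D f.
Proof. by apply: Rintegral_ge0 => x _; exact: sqr_ge0. Qed.

Lemma sqintE D f : measurable D -> L2 D f ->
  (\int[mu]_(x in D) (f x ^+ 2)%:E = (sqint D f)%:E)%E.
Proof. by move=> mD [_ f2]; rewrite fineK//; exact: integrable_fin_num. Qed.

Lemma sqint_eq D f g : (forall x, D x -> f x = g x) -> sqint D f = sqint D g.
Proof.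
by move=> fg; apply: eq_Rintegral => x; rewrite inE => Dx; rewrite fg.
Qed.

Lemma sqint_ae D E f g : measurable D -> measurable E -> D `<=` E ->
  L2 E f -> L2 E g -> {ae mu, forall x, E x -> f x = g x} ->
  sqint D f = sqint D g.
Proof.
move=> mD mE DE Lf Lg fg; congr fine.
have [mf _] := L2_subset mE mD DE Lf; have [mg _] := L2_subset mE mD DE Lg.
apply: ae_eq_integral => //.
- by apply/measurable_EFinP; exact: measurable_funX.
- by apply/measurable_EFinP; exact: measurable_funX.
- by apply: filterS fg => x fg /DE Ex; rewrite fg.
Qed.

Lemma sqint_subset D E f : measurable D -> measurable E -> D `<=` E ->
  L2 E f -> sqint D f <= sqint E f.
Proof.
move=> mD mE DE Lf; rewrite -lee_fin -!sqintE//; last exact: L2_subset Lf.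
apply: ge0_subset_integral => //; first by case: Lf => _ /(measurable_int _).
by move=> x _; rewrite lee_fin sqr_ge0.
Qed.

Definition elems s : set Rd := \big[setU/set0]_(j <- s) elem j.

Lemma elemsP s x : elems s x <-> exists2 j, j \in s & elem j x.
Proof.
rewrite /elems; elim: s => [|i s IH]; first by rewrite big_nil; split => // -[].
rewrite big_cons; split=> [[xi|/IH[j js xj]]|[j]].
- by exists i => //; rewrite mem_head.
- by exists j => //; rewrite inE js orbT.
- rewrite inE => /orP[/eqP ->|js xj]; first by left.
  by right; apply/IH; exists j.
Qed.

Lemma measurable_elems s : measurable (elems s).
Proof. by apply: bigsetU_measurable => j _; exact: measurable_elem. Qed.

(** [E] is where [f] is known to be square-integrable: the elements that cover [D] may stick out of
    it, as those of the fictitious domain stick out of [Omega]. *)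
Lemma elem_sum_le D E f s : measurable D -> measurable E -> L2 E f ->
  D `<=` E -> (forall j, j \in s -> elem j `<=` E) ->
  (forall x, D x -> ~ grid_planes sigma x -> exists2 j, j \in s & elem j x) ->
  sqint D f <= \sum_(j <- s) sqint (elem j) f.
Proof.
move=> mD mE Lf DE sE cover.
have mf V : V `<=` E -> measurable_fun V (fun x => (f x ^+ 2)%:E).
  by move=> VE; apply: measurable_funS VE _ => //; case: Lf => _ /(measurable_int _).
have Lj V : measurable V -> V `<=` E -> L2 V f by move=> mV VE; exact: L2_subset Lf.
have [N [mN N0 subN]] := @grid_planes_negligible R d sigma.
have NE : D `\` N `<=` elems s.
  move=> x [Dx Nx]; apply/elemsP; apply: cover => // gx; apply: Nx; exact: subN.
rewrite -lee_fin -sqintE//; last exact: Lj.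
rewrite (ge0_negligible_integral mN)//; last 2 first.
- exact: mf.
- by move=> x _; rewrite lee_fin sqr_ge0.
have sEE : elems s `<=` E by move=> x /elemsP[j js]; exact: sE.
apply: (@le_trans _ _ (\int[mu]_(x in elems s) (f x ^+ 2)%:E)%E).
  apply: ge0_subset_integral => //.
  - exact: measurableD.
  - exact: measurable_elems.
  - exact: mf.
  - by move=> x _; rewrite lee_fin sqr_ge0.
rewrite {NE cover}/elems; elim: s sE {sEE} => [|i s IH] sE.
  by rewrite !big_nil integral_set0.
have iE : elem i `<=` E by apply: sE; rewrite mem_head.
have {}sE j : j \in s -> elem j `<=` E by move=> js; apply: sE; rewrite inE js orbT.
have sEE : elems s `<=` E by move=> x /elemsP[j js]; exact: sE.
rewrite !big_cons EFinD -sqintE; [|exact: measurable_elem|apply: Lj => //; exact: measurable_elem].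
apply: le_trans (leeD2l _ (IH sE)).
rewrite -(setDUK (@subsetUl _ (elem i) (elems s))) ge0_integral_setU//.
- apply: leeD2l; apply: ge0_subset_integral.
  + by apply: measurableD; [apply: measurableU|]; try exact: measurable_elem; exact: measurable_elems.
  + exact: measurable_elems.
  + exact: mf.
  + by move=> x _; rewrite lee_fin sqr_ge0.
  + by move=> x [[]].
- exact: measurable_elem.
- by apply: measurableD; [apply: measurableU|]; try exact: measurable_elem; exact: measurable_elems.
- by rewrite setDUK//; apply: mf => x [/iE|/sEE].
- by move=> x _; rewrite lee_fin sqr_ge0.
- by apply/disj_setPS => x [? [_ ]].
Qed.

(** Distinct open elements are disjoint; this is where the absence of duplicates in [s] enters. *)
Lemma elem_sum_ge D f s : measurable D -> L2 D f -> uniq s ->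
  (forall j, j \in s -> elem j `<=` D) ->
  \sum_(j <- s) sqint (elem j) f <= sqint D f.
Proof.
move=> mD Lf us sD.
have mf V : V `<=` D -> measurable_fun V (fun x => (f x ^+ 2)%:E).
  by move=> VE; apply: measurable_funS VE _ => //; case: Lf => _ /(measurable_int _).
have sDD : elems s `<=` D by move=> x /elemsP[j js]; exact: sD.
rewrite -lee_fin -sqintE//.
apply: (@le_trans _ _ (\int[mu]_(x in elems s) (f x ^+ 2)%:E)%E); last first.
  apply: ge0_subset_integral => //.
  - exact: measurable_elems.
  - exact: mf.
  - by move=> x _; rewrite lee_fin sqr_ge0.
elim: s us sD sDD => [|i s IH] /=; first by rewrite big_nil /elems big_nil integral_set0.
move=> /andP[nis us] sD sDD.
have iD : elem i `<=` D by apply: sD; rewrite mem_head.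
have {}sD j : j \in s -> elem j `<=` D by move=> js; apply: sD; rewrite inE js orbT.
have {}sDD : elems s `<=` D by move=> x /elemsP[j js]; exact: sD.
rewrite /elems !big_cons EFinD -/(elems s) ge0_integral_setU.
- rewrite -sqintE; last 2 first.
  + exact: measurable_elem.
  + by apply: L2_subset Lf => //; exact: measurable_elem.
  by apply: leeD2l; exact: IH.
- exact: measurable_elem.
- exact: measurable_elems.
- by apply: mf => x [/iD|/sDD].
- by move=> x _; rewrite lee_fin sqr_ge0.
- apply/disj_setPS => x [xi /elemsP[j js xj]].
  by move: nis; rewrite (elem_inj sigma0 xi xj) js.
Qed.

End element_sums.

Section corners.
Context {R : realType} {d : nat}.
Variable sigma : R.
Hypothesis sigma0 : 0 < sigma.
Notation Rd := 'rV[R]_d.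
Notation index := {ffun 'I_d -> int}.
Notation elem := (@elem R d sigma).
Implicit Types (i j : index) (Omega : set Rd).

Lemma index_box_list (N : nat) : exists2 s : seq index, uniq s &
  forall j, (forall l, `|j l| <= N%:Z) -> j \in s.
Proof.
pose F (f : {ffun 'I_d -> 'I_(N.*2.+1)}) : index := [ffun l => (f l)%:Z - N%:Z].
exists (undup [seq F f | f : {ffun 'I_d -> 'I_(N.*2.+1)}]); first exact: undup_uniq.
move=> j jN; rewrite mem_undup; apply/mapP.
exists [ffun l => inord (absz (j l + N%:Z)%R)]; first by rewrite mem_enum.
apply/ffunP => l; rewrite !ffunE inordK.
  have := jN l; rewrite ler_norml => /andP[h _].
  by rewrite gez0_abs ?addrK// -lerBlDr sub0r.
have := jN l; rewrite ler_norml => /andP[h h'].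
rewrite -ltz_nat gez0_abs; last by rewrite -lerBlDr sub0r.
rewrite (le_lt_trans (lerD h' (lexx _)))//.
by rewrite -PoszD ltz_nat addnn.
Qed.

(** The list also holds the neighbors of the elements of the fictitious domain, so it contains the
    index of every [phi] that does not vanish there. *)
Lemma fict_index_list Omega : bounded_set Omega -> exists2 s : seq index, uniq s &
  forall i, elem i `<=` fict_dom sigma Omega ->
    forall j, (forall l, `|i l - j l| <= 1) -> j \in s.
Proof.
move=> [M [_ hM]].
(* The extent of [Omega] in units of [sigma], with a margin: an element that meets [Omega] has
   [- r < i l < r - 1], and a neighbor adds at most 1. *)
pose r := (`|M| + 1) / sigma + 2.
have [s us hs] := index_box_list (Num.truncn r).+2.
exists s => // i iO j ij; apply: hs => l.
have [x [xi Ox]] : elem i `&` Omega !=set0.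
  apply/set0P; apply/eqP => e; move: iO; rewrite elem_fict_dom// e measure0.
  by rewrite ltxx.
have xM : `|x ord0 l| < `|M| + 1 + sigma.
  have := hM (`|M| + 1); rewrite (le_lt_trans (ler_norm M)) ?ltrDl// => /(_ isT x Ox) xM.
  have : ball (0 : Rd) (`|M| + 1 + sigma) x.
    by rewrite -ball_normE /ball_/= sub0r normrN (le_lt_trans xM)// ltrDl.
  by move=> [_ /(_ ord0 l)]; rewrite /ball/= mxE sub0r normrN.
have /andP[h1 h2] := xi l.
have jr : `|(j l)%:~R| <= r + 1 :> R.
  have : `|(i l - j l)%:~R| <= 1 :> R by rewrite -intr_norm (ler_int _ _ 1).
  move: xM; rewrite intrD intrN !ltr_norml ler_norml => /andP[x1 x2] /andP[d1 d2].
  have e : (r - 2) * sigma = `|M| + 1 by rewrite addrK mulfVK// gt_eqF.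
  have i1 : (i l)%:~R < r - 1.
    by rewrite -(ltr_pM2r sigma0) (lt_le_trans (lt_trans h1 x2))//; lra.
  have i2 : - r < (i l)%:~R.
    rewrite -(ltr_pM2r sigma0); have : - (`|M| + 1 + sigma) < ((i l)%:~R + 1) * sigma by exact: lt_trans h2.
    lra.
  by rewrite ler_norml; apply/andP; split; lra.
rewrite -(ler_int R) intr_norm (le_trans jr)// -pmulrn -natr1 lerD2r ltW//.
exact: truncnS_gt.
Qed.

(** The indices [i + cshift e] are the 2^d vertices of [elem i]; by [phi_corner] only their
    functions [phi] are nonzero on that element. *)
Definition cshift (e : {ffun 'I_d -> bool}) : index := [ffun l => (e l : nat)%:Z].

Lemma cshift_inj i : injective (fun e => i + cshift e).
Proof.
move=> e e' /addrI /ffunP h; apply/ffunP => l.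
by have := h l; rewrite !ffunE => -[]; case: (e l); case: (e' l).
Qed.

Lemma phi_ge0 i x : 0 <= phi sigma i x.
Proof. by rewrite phiE// prodr_ge0// => l _; exact: phi1_ge0. Qed.

Lemma phi_le1 i x : phi sigma i x <= 1.
Proof.
by rewrite phiE//; apply: prodr_ile1 => l _; rewrite phi1_ge0 phi1_le1.
Qed.

Lemma phi_corner i j x : elem i x -> (forall e, j <> i + cshift e) ->
  phi sigma j x = 0.
Proof.
move=> xi jn.
have [l jl] : exists l, j l != i l /\ j l != i l + 1.
  apply: contrapT => /forallNP h; apply: (jn [ffun l => j l != i l]).
  apply/ffunP => l; rewrite !ffunE; case: eqVneq => [->|ne]; first by rewrite addr0.
  by have := h l; rewrite ne => /not_andP[//|/negP/negPn/eqP].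
rewrite phiE// (bigD1 l)//= phi1_eq0 ?mul0r//.
have /andP[h1 h2] := xi l; case: jl => ji ji1.
have x1 : (i l)%:~R < sigma^-1 * x ord0 l by rewrite ltr_pdivlMl// mulrC.
have x2 : sigma^-1 * x ord0 l < (i l)%:~R + 1 by rewrite ltr_pdivrMl// mulrC.
rewrite ler_normr; have [lt|gt] : j l <= i l - 1 \/ i l + 2 <= j l by lia.
  by apply/orP; left; move: lt; rewrite -(ler_int R) intrB; lra.
by apply/orP; right; move: gt; rewrite -(ler_int R) intrD; lra.
Qed.

(** The sum over the vertices is the expanded product of [d] one-dimensional partitions of unity. *)
Lemma phi_partition i x : elem i x ->
  \sum_(e : {ffun 'I_d -> bool}) phi sigma (i + cshift e) x = 1.
Proof.
move=> xi; under eq_bigr do rewrite phiE//.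
pose F l (b : bool) : R := phi1 (sigma^-1 * x ord0 l - (i l + (b : nat)%:Z)%:~R).
transitivity (\prod_l \sum_(b : bool) F l b).
  rewrite bigA_distr_bigA/=; apply: eq_bigr => e _; apply: eq_bigr => l _.
  by rewrite /F !ffunE.
apply: big1 => l _; rewrite big_bool /F /= addr0 intrD.
have /andP[h1 h2] := xi l.
have x1 : (i l)%:~R < sigma^-1 * x ord0 l by rewrite ltr_pdivlMl// mulrC.
have x2 : sigma^-1 * x ord0 l < (i l)%:~R + 1 by rewrite ltr_pdivrMl// mulrC.
rewrite addrC (_ : _ - (_ + _) = sigma^-1 * x ord0 l - (i l)%:~R - 1); last by ring.
by apply: phi1_partition; apply/andP; split; lra.
Qed.

Lemma sum_corners i (s : seq index) (F : index -> R) x : uniq s ->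
  (forall e, i + cshift e \in s) -> elem i x ->
  \sum_(j <- s) phi sigma j x * F j =
  \sum_(e : {ffun 'I_d -> bool}) phi sigma (i + cshift e) x * F (i + cshift e).
Proof.
move=> us cs xi.
pose s' := [seq i + cshift e | e : {ffun 'I_d -> bool}].
rewrite (bigID (fun j => j \in s'))/= [X in _ + X]big1 ?addr0; last first.
  move=> j js; rewrite (@phi_corner i j)// ?mul0r// => e ej.
  by move/negP: js; apply; apply/mapP; exists e => //; rewrite mem_enum.
rewrite -big_filter (perm_big s') ?big_map ?big_enum//.
apply: uniq_perm; first exact: filter_uniq.
  by rewrite map_inj_uniq ?enum_uniq//; exact: cshift_inj.
move=> j; rewrite mem_filter; case: (boolP (j \in s')) => //= /mapP[e _ ->].
exact: cs.
Qed.

End corners.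

(** * Inverse and ghost-penalty estimates *)

Section square_integrals.
Context {R : realType} {d : nat}.
Notation Rd := 'rV[R]_d.
Notation mu := (@leb R d).
Implicit Types (D : set Rd) (f g : Rd -> R).

Lemma bounded_tsum_L2 D g (r : R) : measurable D ->
  (forall x, D x -> forall l, `|x ord0 l| <= r) -> is_tsum g -> L2 D g.
Proof.
move=> mD Dr tg; have cg := is_tsum_continuous tg.
have [C hC] := continuous_cbox_bounded (fun=> - r) (fun=> r) cg.
apply: (@L2_bounded _ _ _ _ C) => //.
- exact: leb_bounded Dr.
- by apply: measurable_funTS; exact: continuous_measurable_rV.
- by move=> x Dx; apply: hC => l; rewrite -ler_norml; exact: Dr.
Qed.

Lemma Rintegral_sum D (I : Type) (r : seq I) (F : I -> Rd -> R) : measurable D ->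
  (forall i, mu.-integrable D (EFin \o F i)) ->
  \int[mu]_(x in D) (\sum_(i <- r) F i x) = \sum_(i <- r) \int[mu]_(x in D) F i x.
Proof.
move=> mD iF; elim: r => [|i r IH].
  by under eq_Rintegral do rewrite big_nil; rewrite Rintegral_cst// mul0r big_nil.
under eq_Rintegral do rewrite big_cons.
rewrite RintegralD//; first by rewrite IH big_cons.
rewrite (_ : EFin \o _ = fun x => (\sum_(i <- r) (F i x)%:E)%E).
  by apply: integrable_sum => //= j _; exact: iF.
by apply/funext => x /=; rewrite sumEFin.
Qed.

Lemma sqint_sum D (I : finType) (b : I -> Rd -> R) (c : I -> R) : measurable D ->
  (forall i, L2 D (b i)) ->
  sqint D (fun x => \sum_i c i * b i x) =
  \sum_i \sum_j c i * c j * \int[mu]_(x in D) (b i x * b j x).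
Proof.
move=> mD Lb.
have iM i j : mu.-integrable D (EFin \o (fun x => c i * c j * (b i x * b j x))).
  rewrite (_ : EFin \o _ = fun x => ((c i * c j)%:E * (b i x * b j x)%:E)%E)//.
  by apply: integrableZl => //; exact: L2_mul_integrable.
rewrite /sqint; under eq_Rintegral => x _.
  rewrite expr2 mulr_suml; under eq_bigr do rewrite mulr_sumr.
  over.
rewrite Rintegral_sum//=; last first.
  move=> i; rewrite (_ : EFin \o _ =
      fun x => (\sum_(j <- index_enum I) (c i * c j * (b i x * b j x))%:E)%E).
    by apply: integrable_sum => //= j _; exact: iM.
  by apply/funext => x /=; rewrite sumEFin; congr EFin; apply: eq_bigr => j _; ring.
apply: eq_bigr => i _.
rewrite Rintegral_sum//=; last first.
  move=> j; rewrite (_ : EFin \o _ = EFin \o (fun x => c i * c j * (b i x * b j x)))//.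
  by apply/funext => x /=; congr EFin; ring.
apply: eq_bigr => j _; rewrite -RintegralZl//; last exact: L2_mul_integrable.
by apply: eq_Rintegral => x _; ring.
Qed.

Lemma sqintD_le D f g : measurable D -> L2 D f -> L2 D g ->
  sqint D (fun x => f x + g x) <= 2 * sqint D f + 2 * sqint D g.
Proof.
move=> mD Lf Lg; rewrite -!RintegralZl//; [|exact: Lg.2|exact: Lf.2].
rewrite -RintegralD//; last 2 first.
- by rewrite (_ : EFin \o _ = fun x => (2%:E * (f x ^+ 2)%:E)%E)//; apply: integrableZl => //; exact: Lf.2.
- by rewrite (_ : EFin \o _ = fun x => (2%:E * (g x ^+ 2)%:E)%E)//; apply: integrableZl => //; exact: Lg.2.
apply: le_Rintegral => //.
- exact: (L2D mD Lf Lg).2.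
- rewrite (_ : EFin \o _ = fun x => (2%:E * (f x ^+ 2)%:E + 2%:E * (g x ^+ 2)%:E)%E)//.
  by apply: integrableD => //; apply: integrableZl => //; [exact: Lf.2|exact: Lg.2].
- by move=> x _; have := sqr_ge0 (f x - g x); nra.
Qed.

Lemma sqintZ D c f : measurable D -> L2 D f ->
  sqint D (fun x => c * f x) = c ^+ 2 * sqint D f.
Proof.
move=> mD Lf; rewrite -RintegralZl//; last exact: Lf.2.
by apply: eq_Rintegral => x _; rewrite exprMn.
Qed.

Lemma sqintB_le D f g : measurable D -> L2 D f -> L2 D g ->
  sqint D (fun x => f x - g x) <= 2 * sqint D f + 2 * sqint D g.
Proof.
move=> mD Lf Lg; have := sqintD_le mD Lf (L2N mD Lg).
rewrite (_ : sqint D (fun x => - g x) = sqint D g)//.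
by apply: eq_Rintegral => x _; rewrite sqrrN.
Qed.

Lemma CS_sqint D f g : measurable D -> L2 D f -> L2 D g ->
  (\int[mu]_(x in D) (f x * g x)) ^+ 2 <= sqint D f * sqint D g.
Proof.
move=> mD Lf Lg; apply: discriminant_le => t.
have ifg : mu.-integrable D (EFin \o (fun x => f x * g x)) by exact: L2_mul_integrable.
have e : sqint D (fun x => f x + t * g x) =
    sqint D f + 2 * t * \int[mu]_(x in D) (f x * g x) + t ^+ 2 * sqint D g.
  rewrite -!RintegralZl//; last exact: Lg.2.
  have i1 : mu.-integrable D (EFin \o (fun x => 2 * t * (f x * g x))).
    by rewrite (_ : EFin \o _ = fun x => ((2 * t)%:E * (f x * g x)%:E)%E)//; apply: integrableZl.
  have i2 : mu.-integrable D (EFin \o (fun x => t ^+ 2 * g x ^+ 2)).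
    by rewrite (_ : EFin \o _ = fun x => ((t ^+ 2)%:E * (g x ^+ 2)%:E)%E)//; apply: integrableZl => //; exact: Lg.2.
  rewrite -RintegralD//; last exact: Lf.2.
  rewrite -RintegralD//; last first.
    rewrite (_ : EFin \o _ = fun x => ((f x ^+ 2)%:E + (2 * t * (f x * g x))%:E)%E)//.
    by apply: integrableD => //; exact: Lf.2.
  by apply: eq_Rintegral => x _; ring.
by rewrite -e; exact: sqint_ge0.
Qed.

End square_integrals.

Section reference_space.
Context {R : realType} {d : nat}.
Variable P : nat.
Notation Rd := 'rV[R]_d.
Notation mu := (@leb R d).
Notation index := {ffun 'I_d -> int}.

(* The translates of [phi1] by -1, 0, 1, 2 are those that do not vanish on
   ]-1, 2[, which covers the reference element and its neighbors. *)
Definition widx := ({ffun 'I_d -> 'I_4} * @multi d P)%type.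

Definition wbasis1 (e : 'I_4) (n : nat) (t : R) : R :=
  phi1 (t - ((e : nat)%:R - 1)) * t ^+ n.

Lemma smooth1_wbasis1 e n : smooth1 (wbasis1 e n).
Proof.
apply: smooth1M; last exact: smooth1X.
by apply: smooth1_shift; exact: smooth1_phi1.
Qed.

Definition wbasis (w : widx) (y : Rd) : R :=
  \prod_l wbasis1 (w.1 l) (w.2 l) (y ord0 l).

Lemma wbasis_tsum w : is_tsum (wbasis w).
Proof.
by apply: (is_tsum_tens (F := fun l => wbasis1 (w.1 l) (w.2 l))) => l; exact: smooth1_wbasis1.
Qed.

Definition wfun (c : widx -> R) (y : Rd) : R := \sum_w c w * wbasis w y.

Lemma wfun_tsum c : is_tsum (wfun c).
Proof. by apply: is_tsum_sum => w _; apply: is_tsumZ; exact: wbasis_tsum. Qed.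

Lemma wfun_partial s c :
  iter_partial s (wfun c) = fun y => \sum_w c w * iter_partial s (wbasis w) y.
Proof.
rewrite iter_partial_sum => [|w _]; last by apply: is_tsumZ; exact: wbasis_tsum.
apply/funext => y; apply: eq_bigr => w _.
by rewrite iter_partialZ//; exact: wbasis_tsum.
Qed.

Notation elem1 := (@elem R d 1).

Lemma elem1_L2 (i : index) g : is_tsum g -> L2 (elem1 i) g.
Proof.
apply: (@bounded_tsum_L2 _ _ _ _ (\sum_l (`|(i l)%:~R| + 1))); first exact: measurable_elem.
move=> x xi l; have /andP[] := xi l; rewrite !mulr1 => h1 h2.
apply: (@le_trans _ _ (`|(i l)%:~R| + 1)).
  rewrite ler_norml; have := ler_norm ((i l)%:~R : R).
  have := ler_norm (- (i l)%:~R : R); rewrite normrN.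
  by move=> a b; apply/andP; split; lra.
by rewrite (bigD1 l)//= lerDl sumr_ge0// => j _; rewrite addr_ge0.
Qed.

(** The functions [wbasis] are in general dependent on this element, so equivalence of norms is
    replaced by domination of Gram forms: a combination that vanishes on the open element has
    vanishing derivatives there. *)
Lemma ref_inverse k (a : @multi d k) : exists2 C, 0 <= C & forall c,
  sqint (elem1 0) (partial a (wfun c)) <= C * sqint (elem1 0) (wfun c).
Proof.
set D := elem1 0; have mD : measurable D by exact: measurable_elem.
pose GA i j := \int[mu]_(x in D) (partial a (wbasis i) x * partial a (wbasis j) x).
pose GB i j := \int[mu]_(x in D) (wbasis i x * wbasis j x).
have tp i := is_tsum_iter_partial (flatten [seq nseq (a l) l | l <- enum 'I_d]) (wbasis_tsum i).
have LA i : L2 D (partial a (wbasis i)) by apply: elem1_L2; exact: tp.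
have LB i : L2 D (wbasis i) by apply: elem1_L2; exact: wbasis_tsum.
have EA c : sqint D (partial a (wfun c)) = \sum_i \sum_j c i * c j * GA i j.
  by rewrite /partial wfun_partial sqint_sum.
have EB c : sqint D (wfun c) = \sum_i \sum_j c i * c j * GB i j by rewrite sqint_sum.
have [|||||C C0 hC] := @quad_domination _ _ GA GB.
- by move=> i j; apply: eq_Rintegral => x _; rewrite mulrC.
- by move=> i j; apply: eq_Rintegral => x _; rewrite mulrC.
- by move=> c; rewrite -EA sqint_ge0.
- by move=> c; rewrite -EB sqint_ge0.
- move=> c; rewrite -EA -EB => c0.
  have w0 : forall x, D x -> wfun c x = 0.
    apply: continuous_int0 => //.
    + exact: open_elem.
    + exact: (is_tsum_continuous (wfun_tsum c)).
    + exact: (elem1_L2 0 (wfun_tsum c)).2.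
  rewrite (@sqint_eq _ _ D _ (fun=> 0)).
    by rewrite /sqint (@eq_Rintegral _ _ _ mu _ (cst 0)) ?Rintegral_cst ?mul0r// => x _; rewrite expr0n.
  move=> x Dx; rewrite /partial (@iter_partial_local _ _ D _ _ (fun=> 0) _ w0)//.
    rewrite (_ : (fun=> 0) = tsum [::]); last by apply/funext => y; rewrite /tsum big_nil.
    by rewrite tsum_iter_partial /tsum big_nil.
  exact: open_elem.
by exists C => // c; rewrite EA EB.
Qed.

End reference_space.

Section ghost.
Context {R : realType} {d : nat}.
Notation Rd := 'rV[R]_d.
Notation mu := (@leb R d).
Notation index := {ffun 'I_d -> int}.

Lemma is_tsum_count (s s' : seq 'I_d) (g : Rd -> R) : is_tsum g ->
  (forall l, count_mem l s = count_mem l s') ->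
  iter_partial s g = iter_partial s' g.
Proof.
case=> r -> ss'; rewrite !tsum_iter_partial; apply/funext => x.
rewrite /tsum !big_map; apply: eq_bigr => p _ /=; congr (_ * _).
by apply: eq_bigr => l _; rewrite /tens_deriv ss'.
Qed.

Lemma count_partial_seq k (a : @multi d k) (l : 'I_d) :
  count_mem l (flatten [seq nseq (a j) j | j <- enum 'I_d]) = a l.
Proof.
rewrite count_flatten -map_comp sumnE big_map big_enum/= (bigD1 l)//=.
rewrite count_nseq/= eqxx mul1n big1 ?addn0// => j jl.
by rewrite count_nseq/= (negbTE jl) mul0n.
Qed.

Lemma sum_count_mem (s : seq 'I_d) : (\sum_l count_mem l s)%N = size s.
Proof.
elim: s => [|x s IH]; first by rewrite big1.
rewrite /= big_split/= IH (bigD1 x)//= eqxx big1// => l lx.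
by rewrite eq_sym (negbTE lx).
Qed.

Definition multi_of_seq k (s : seq 'I_d) : @multi d k :=
  [ffun l => inord (count_mem l s)].

Lemma multi_of_seqE k (s : seq 'I_d) l : (size s <= k)%N ->
  multi_of_seq k s l = count_mem l s :> nat.
Proof.
by move=> sk; rewrite ffunE inordK// ltnS (leq_trans (count_size _ _)).
Qed.

Lemma morder_multi_of_seq k (s : seq 'I_d) : (size s <= k)%N ->
  morder (multi_of_seq k s) = size s.
Proof.
move=> sk; rewrite /morder -sum_count_mem; apply: eq_bigr => l _.
exact: multi_of_seqE.
Qed.

Lemma partial_multi_of_seq k (s : seq 'I_d) (g : Rd -> R) : is_tsum g -> (size s <= k)%N ->
  partial (multi_of_seq k s) g = iter_partial s g.
Proof.
move=> tg sk; apply: is_tsum_count => // l.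
by rewrite count_partial_seq multi_of_seqE.
Qed.

Lemma is_derive0_itv_cst (h h' : R -> R) (a b : R) :
  (forall t : R, is_derive t 1 h (h' t)) ->
  (forall t, a <= t <= b -> h' t = 0) ->
  forall s t, a <= s <= b -> a <= t <= b -> h s = h t.
Proof.
move=> dh h0.
suff st s t : s <= t -> a <= s <= b -> a <= t <= b -> h s = h t.
  by move=> s t; case: (leP s t) => [|/ltW] /st h1 h2 h3; [|apply/esym]; exact: h1.
move=> slt /andP[sa sb] /andP[ta tb].
have [|c] := @MVT_segment R h h' s t slt (fun x _ => dh x).
  apply: continuous_subspaceT; apply: derivable_continuous => x.
  by have [] := dh x.
rewrite in_itv/= => /andP[sc ct] /eqP; rewrite (h0 c) ?mul0r; last first.
  by rewrite (le_trans sa sc) (le_trans ct tb).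
by rewrite subr_eq0 => /eqP.
Qed.

(** The coordinates of [x] are replaced by those of [y] one at a time. The intermediate points
    [mix r] stay in the box, and along each segment the one-dimensional mean value theorem
    applies. *)
Lemma cbox_cst (f : Rd -> R) (g : 'I_d -> Rd -> R) (a b : 'I_d -> R) :
  (forall l x, is_derive x (delta_mx ord0 l) f (g l x)) ->
  (forall l x, cbox a b x -> g l x = 0) ->
  forall x y, cbox a b x -> cbox a b y -> f x = f y.
Proof.
move=> df g0 x y xab yab.
pose mix (r : seq 'I_d) : Rd := \row_l (if l \in r then y ord0 l else x ord0 l).
have mab r : cbox a b (mix r) by move=> l; rewrite mxE; case: ifP.
suff h r : f (mix r) = f x.
  rewrite -(h (enum 'I_d)); congr f; apply/rowP => l.
  by rewrite mxE mem_enum.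
elim: r => [|l r IH]; first by congr f; apply/rowP => l; rewrite mxE.
rewrite -IH.
pose p (t : R) : Rd := \row_j (if j == l then t else mix r ord0 j).
have pl (h t : R) : p (h *: 1 + t) = h *: delta_mx ord0 l + p t.
  by apply/rowP => j; rewrite !mxE eqxx/=; case: eqVneq => _; rewrite ?mulr0 ?add0r.
have pab t : a l <= t <= b l -> cbox a b (p t).
  by move=> tab j; rewrite mxE; case: eqVneq => [->//|_]; exact: mab.
have -> : mix (l :: r) = p (y ord0 l).
  by apply/rowP => j; rewrite !mxE inE; case: eqVneq => [->|].
have -> : mix r = p (mix r ord0 l).
  by apply/rowP => j; rewrite [RHS]mxE; case: eqVneq => [->|].
apply: (@is_derive0_itv_cst (f \o p) (g l \o p) (a l) (b l)).
- by move=> t; apply: (is_derive_line (p := p)).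
- by move=> t tab; apply: g0; exact: pab.
- exact: yab.
- exact: mab.
Qed.

Lemma closure_eq0 (A : set Rd) (f : Rd -> R) : continuous f ->
  (forall x, A x -> f x = 0) -> forall x, closure A x -> f x = 0.
Proof.
move=> cf f0 x Ax; apply: contrapT => /eqP fx.
have oV : open [set y | f y != 0].
  rewrite (_ : [set y | _] = f @^-1` [set t | t != 0]); last by apply/seteqP; split.
  by move/continuousP : cf; apply; exact: open_neq.
have [y [/f0 fy /=]] := Ax _ (open_nbhs_nbhs (conj oV fx)).
by rewrite fy eqxx.
Qed.

Notation elem1 := (@elem R d 1).

(* [W] and all its derivatives vanish at a common vertex [y0] of the two
   elements, so the derivatives of order [k], [k - 1], ..., 0 vanish on
   [elem1 0] one after the other. *)
Lemma ghost_vanish (k : nat) (t : index) (W : Rd -> R) : is_tsum W ->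
  (forall l, `|t l| <= 1) ->
  (forall x, elem1 t x -> W x = 0) ->
  (forall a : @multi d k, morder a = k -> forall x, elem1 0 x -> partial a W x = 0) ->
  forall x, elem1 0 x -> W x = 0.
Proof.
move=> tW t1 Wt W0.
pose y0 : Rd := \row_l (if (0 < t l)%R then 1 else 0).
have y0c : celem 1 0 y0.
  by move=> l; rewrite !mxE ffunE !mulr1; case: ifP => _; apply/andP; split; rewrite ?add0r.
have y0t : celem 1 t y0.
  move=> l; rewrite !mxE !mulr1; have := t1 l; rewrite ler_norml => /andP[h1 h2].
  case: ltP => h; apply/andP; split.
  - by rewrite -[leRHS]/(1%:~R) ler_int.
  - by rewrite lerDr ler0z ltW.
  - by rewrite lerz0.
  - by rewrite -(intrD1 R) ler0z -lerBlDr sub0r.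
have cW s : continuous (iter_partial s W).
  exact/is_tsum_continuous/is_tsum_iter_partial.
have vy s : iter_partial s W y0 = 0.
  apply: (closure_eq0 (cW s) (A := elem1 t)); last by rewrite closure_elem.
  move=> x xt; rewrite (@iter_partial_local _ _ (elem1 t) s W (fun=> 0) _ Wt)//.
    rewrite (_ : (fun=> 0) = tsum [::]); last by apply/funext => y; rewrite /tsum big_nil.
    by rewrite tsum_iter_partial /tsum big_nil.
  exact: open_elem.
suff h n s : size s = (k - n)%N -> (n <= k)%N ->
    forall x, celem 1 0 x -> iter_partial s W x = 0.
  move=> x x0; apply: (h k [::]); rewrite ?subnn//.
  exact: subset_elem_celem.
elim: n s => [|n IH] s sn nk x xc.
  rewrite subn0 in sn.
  rewrite -closure_elem// in xc.
  apply: (closure_eq0 (cW s) (A := elem1 0)) xc => z z0.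
  rewrite -(@partial_multi_of_seq k) ?sn//; apply: W0 => //.
  by rewrite morder_multi_of_seq sn.
rewrite -(vy s).
apply: (cbox_cst (g := fun l => iter_partial (l :: s) W)) xc y0c.
  move=> l z; have := is_tsum_derive l z (is_tsum_iter_partial s tW).
  by [].
move=> l z zc; apply: IH => //=; last exact: ltnW.
by rewrite sn subnSK.
Qed.

Variable P : nat.

(** The inclusion of kernels that [quad_domination] asks for is [ghost_vanish], once vanishing
    integrals have been turned into pointwise vanishing. *)
Lemma ref_ghost (k : nat) (t : index) : (forall l, `|t l| <= 1) ->
  exists2 C, 0 <= C & forall c,
  sqint (elem1 0) (@wfun R d P c) <= C * (sqint (elem1 t) (wfun c) +
     \sum_(a : multi k | morder a == k) sqint (elem1 0) (partial a (wfun c))).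
Proof.
move=> t1; set D := elem1 0; have mD : measurable D by exact: measurable_elem.
set E := elem1 t; have mE : measurable E by exact: measurable_elem.
pose wb := @wbasis R d P.
pose GA i j := \int[mu]_(x in D) (wb i x * wb j x).
pose GB i j := \int[mu]_(x in E) (wb i x * wb j x) +
  \sum_(a : multi k | morder a == k)
     \int[mu]_(x in D) (partial a (wb i) x * partial a (wb j) x).
have tp (a : @multi d k) i := is_tsum_iter_partial (flatten [seq nseq (a l) l | l <- enum 'I_d]) (wbasis_tsum (R := R) (P := P) i).
have La (a : @multi d k) i : L2 D (partial a (wb i)).
  by apply: elem1_L2; exact: (tp a i).
have LD i : L2 D (wb i) by apply: elem1_L2; exact: wbasis_tsum.
have LE i : L2 E (wb i) by apply: elem1_L2; exact: wbasis_tsum.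
have EA c : sqint D (wfun c) = \sum_i \sum_j c i * c j * GA i j by rewrite sqint_sum.
have EB c : sqint E (wfun c) +
     \sum_(a : multi k | morder a == k) sqint D (partial a (wfun c)) =
     \sum_i \sum_j c i * c j * GB i j.
  rewrite sqint_sum//.
  under [X in _ + X]eq_bigr => a _.
    rewrite /partial wfun_partial sqint_sum; [|by []|by move=> i; exact: La].
    over.
  rewrite [X in _ + X]exchange_big/= -big_split/=; apply: eq_bigr => i _.
  rewrite [X in _ + X]exchange_big/= -big_split/=; apply: eq_bigr => j _.
  by rewrite mulrDr mulr_sumr.
have [|||||C C0 hC] := @quad_domination _ _ GA GB.
- by move=> i j; apply: eq_Rintegral => x _; rewrite mulrC.
- move=> i j; congr (_ + _); first by apply: eq_Rintegral => x _; rewrite mulrC.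
  by apply: eq_bigr => a _; apply: eq_Rintegral => x _; rewrite mulrC.
- by move=> c; rewrite -EA sqint_ge0.
- by move=> c; rewrite -EB addr_ge0 ?sqint_ge0// sumr_ge0// => a _; exact: sqint_ge0.
- move=> c; rewrite -EA -EB => /eqP.
  rewrite paddr_eq0 ?sqint_ge0//; last by rewrite sumr_ge0// => a _; exact: sqint_ge0.
  move=> /andP[/eqP c0]; rewrite psumr_eq0 => [|a _]; last exact: sqint_ge0.
  move=> /allP ca.
  rewrite (@sqint_eq _ _ D _ (fun=> 0)).
    by rewrite /sqint (@eq_Rintegral _ _ _ mu _ (cst 0)) ?Rintegral_cst ?mul0r// => x _; rewrite expr0n.
  apply: (@ghost_vanish k t) => //; first exact: wfun_tsum.
    apply: continuous_int0 c0.
    + exact: open_elem.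
    + exact: (is_tsum_continuous (wfun_tsum c)).
    + exact: (elem1_L2 _ (wfun_tsum c)).2.
  move=> a ak; apply: continuous_int0.
  + exact: open_elem.
  + exact: (is_tsum_continuous (is_tsum_iter_partial _ (wfun_tsum c))).
  + exact: (elem1_L2 _ (is_tsum_iter_partial _ (wfun_tsum c))).2.
  + by have := ca a; rewrite mem_index_enum ak eqxx/= => /(_ isT)/eqP.
by exists C => // c; rewrite EA EB.
Qed.

End ghost.

Section affine_tsum.
Context {R : realType} {d : nat}.
Notation Rd := 'rV[R]_d.
Notation mu := (@leb R d).

Lemma derive1n_aff (f : R -> R) n a b : smooth1 f ->
  derive1n n (fun t => f (a * t + b)) = fun t => a ^+ n * derive1n n f (a * t + b).
Proof.
move=> sf; elim: n => [|n IH]; first by apply/funext => t; rewrite !derive1n0 mul1r.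
rewrite derive1nS IH; apply/funext => t; rewrite derive1E.
have dl : is_derive t 1 (fun t : R => a * t + b) a.
  by apply: is_derive_eq; rewrite addr0 scaler1.
have df : is_derive (a * t + b) 1 (derive1n n f) (derive1n n.+1 f (a * t + b)).
  split; first by apply: smooth1_derivable; exact: smooth1_deriven.
  by rewrite derive1nS derive1E.
have dfl := @is_derive1_comp _ _ (fun t : R => a * t + b) t _ _ df dl.
have [_ ->] := is_deriveZ (a ^+ n) dfl.
by rewrite /GRing.scale/= exprSr mulrAC mulrA.
Qed.

Definition sm1_aff (a b : R) (f : @sm1 R) : @sm1 R :=
  exist _ (fun t => sval f (a * t + b)) (smooth1_aff a b (svalP f)).

Variables (sigma : R) (b : Rd).

Definition tsum_aff (r : seq (@tterm R d)) : seq (@tterm R d) :=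
  [seq (p.1, fun l => sm1_aff sigma (sigma * b ord0 l) (p.2 l)) | p <- r].

Lemma tsum_affE r : tsum r \o affine sigma b = tsum (tsum_aff r).
Proof.
apply/funext => y; rewrite /tsum big_map; apply: eq_bigr => p _ /=.
by congr (_ * _); apply: eq_bigr => l _; rewrite !mxE mulrDr.
Qed.

Lemma is_tsum_affine g : is_tsum g -> is_tsum (g \o affine sigma b).
Proof. by case=> r ->; exists (tsum_aff r); rewrite tsum_affE. Qed.

Lemma iter_partial_affine s g : is_tsum g ->
  iter_partial s (g \o affine sigma b) =
  fun y => sigma ^+ size s * iter_partial s g (affine sigma b y).
Proof.
case=> r ->; rewrite tsum_affE !tsum_iter_partial; apply/funext => y.
rewrite /tsum !big_map mulr_sumr; apply: eq_bigr => p _ /=.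
rewrite mulrCA; congr (_ * _).
rewrite -sum_count_mem -prodrXr -big_split/=; apply: eq_bigr => l _.
rewrite !mxE mulrDr; exact: (congr1 (@^~ (y ord0 l)) (derive1n_aff _ _ _ (svalP (p.2 l)))).
Qed.

Hypothesis sigma0 : 0 < sigma.

Lemma sqint_affine (D : set Rd) (g : Rd -> R) : measurable D -> L2 D g ->
  sqint D g = sigma ^+ d * sqint (affine sigma b @^-1` D) (g \o affine sigma b).
Proof.
move=> mD Lg.
have := @ge0_integral_affine R d sigma b D (fun x => (g x ^+ 2)%:E) sigma0 mD.
move=> /(_ (measurable_int _ Lg.2)) h.
rewrite {2}/sqint /Rintegral (_ : (\int[mu]_(x in _) _)%E = ((sigma ^- d)%:E * (sqint D g)%:E)%E).
  by rewrite -EFinM /= mulVKf// gt_eqF// exprn_gt0.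
rewrite -sqintE// -h// => x _; first by rewrite lee_fin sqr_ge0.
Qed.

End affine_tsum.

Section V_functions.
Context {R : realType} {d : nat}.
Variable P : nat.
Notation Rd := 'rV[R]_d.
Notation mu := (@leb R d).
Notation index := {ffun 'I_d -> int}.

Definition Vfun (sigma : R) (s : seq index) (c : index -> @multi d P -> R) (x : Rd) : R :=
  \sum_(i <- s) \sum_(a : multi P | (morder a <= P)%N)
     c i a * (phi sigma i x * monomial a x).

Definition idx_vec (i : index) : Rd := \row_l (i l)%:~R.

Lemma affine_elem sigma (i t : index) : 0 < sigma ->
  affine sigma (idx_vec i) @^-1` elem sigma (i + t) = elem 1 t.
Proof.
move=> s0; apply/seteqP; split=> y /= h l; have := h l;
  rewrite /affine !mxE ffunE !mulr1 [sigma * _]mulrC !ltr_pM2r// intrD.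
  by move=> /andP[h1 h2]; apply/andP; split; lra.
by move=> /andP[h1 h2]; apply/andP; split; lra.
Qed.

Section fixed_sigma.
Variable sigma : R.
Hypothesis sigma0 : 0 < sigma.

Lemma phi_monomial_tsum i (a : @multi d P) :
  is_tsum (fun x => phi sigma i x * monomial a x).
Proof.
rewrite (_ : (fun x => _) = fun x : Rd =>
    \prod_l (phi1 (sigma^-1 * x ord0 l - (i l)%:~R) * x ord0 l ^+ a l)); last first.
  by apply/funext => x; rewrite phiE// /monomial -big_split.
apply: (is_tsum_tens (F := fun l t => phi1 (sigma^-1 * t - (i l)%:~R) * t ^+ a l)) => l.
apply: smooth1M; last exact: smooth1X.
by apply: smooth1_aff; exact: smooth1_phi1.
Qed.

Lemma Vfun_tsum s c : is_tsum (Vfun sigma s c).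
Proof.
apply: (@is_tsum_sum _ _ _ s predT (fun i x => \sum_(a : multi P | (morder a <= P)%N)
   c i a * (phi sigma i x * monomial a x))) => i _.
apply: (@is_tsum_sum _ _ _ _ _ (fun a x => c i a * (phi sigma i x * monomial a x))) => a _.
apply: (@is_tsumZ _ _ (c i a) (fun x => phi sigma i x * monomial a x)).
exact: phi_monomial_tsum.
Qed.

Let box : set Rd := obox (fun=> -1) (fun=> 2).

(** The pulled-back [phi] is the product of the [phi1 (y_l - (j l - i l))], which is zero on the box
    unless all [j l - i l] lie between -1 and 2. Each power of an affine coordinate expands into
    powers of degree at most [P]. *)
Lemma phi_monomial_local (i j : index) (a : @multi d P) : exists c, forall y, box y ->
  phi sigma j (affine sigma (idx_vec i) y) * monomial a (affine sigma (idx_vec i) y) =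
  wfun (P := P) c y.
Proof.
have pE (y : Rd) l : sigma^-1 * affine sigma (idx_vec i) y ord0 l - (j l)%:~R =
    y ord0 l - (j l - i l)%:~R.
  rewrite /affine !mxE mulKf ?gt_eqF// intrB; ring.
have [jn|jn] := pselect (forall l, (0 <= j l - i l + 1 < 4)%R); last first.
  have /existsNP[l /negP jl] := jn.
  exists (fun=> 0) => y yb; rewrite /wfun big1; last by move=> w _; rewrite mul0r.
  rewrite phiE// (bigD1 l)//= pE phi1_eq0 ?mul0r//.
  have /andP[h1 h2] := yb l.
  move: jl; rewrite negb_and -!ltNge -leNgt ler_normr => /orP[h|h].
    have : (j l - i l)%:~R <= -2 :> R by rewrite -[leRHS]/((-2)%:~R) ler_int; lia.
    by move=> h3; apply/orP; left; lra.
  have : 3 <= (j l - i l)%:~R :> R by rewrite -[leLHS]/(3%:~R) ler_int; lia.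
  by move=> h3; apply/orP; right; lra.
pose e : {ffun 'I_d -> 'I_4} := [ffun l => inord (absz (j l - i l + 1))].
have eE l : ((e l : nat)%:R - 1 : R) = (j l - i l)%:~R.
  have /andP[h1 h2] := jn l; rewrite ffunE inordK; last by rewrite -ltz_nat gez0_abs.
  by rewrite natr_absz ger0_norm// intrD addrK.
(* The one-variable factor of the pulled-back monomial; its coefficients are those of [c] at the
   single translate [e]. *)
pose q l : {poly R} := (sigma *: 'X + (sigma * (i l)%:~R)%:P) ^+ a l.
have qs l : (size (q l) <= P.+1)%N.
  apply: (leq_trans (size_poly_exp_leq _ _)); rewrite ltnS.
  have : (size (sigma *: 'X + (sigma * (i l)%:~R)%:P)%R <= 2)%N.
    rewrite (leq_trans (size_polyD _ _))// geq_max (leq_trans (size_scale_leq _ _)) ?size_polyX//.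
    by rewrite (leq_trans (size_polyC_leq1 _)).
  rewrite -(leq_subLR _ 1) subn1 => h.
  by rewrite (leq_trans (leq_mul h (leqnn (a l))))// mul1n -ltnS.
pose c (w : widx P) : R := if w.1 == e then \prod_l (q l)`_(w.2 l) else 0.
exists c => y yb.
rewrite phiE// /monomial; under eq_bigr do rewrite pE.
have mE l : affine sigma (idx_vec i) y ord0 l ^+ a l =
    \sum_(k < P.+1) (q l)`_k * y ord0 l ^+ k.
  rewrite -(horner_coef_wide _ (qs l)) /q horner_exp !hornerE; congr (_ ^+ _).
  by rewrite /affine !mxE mulrDr.
under [X in _ * X]eq_bigr do rewrite mE.
rewrite bigA_distr_bigA/= mulr_sumr /wfun.
rewrite (eq_bigr (fun w : widx P => (fun u v => c (u, v) * wbasis (u, v) y) w.1 w.2)); last by case.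
rewrite -(pair_bigA _ (fun u v => c (u, v) * wbasis (u, v) y))/=.
rewrite [RHS](bigD1 e)//= [X in _ + X]big1 ?addr0; last first.
  by move=> u /negPf ue; apply: big1 => f _; rewrite /c /= ue mul0r.
apply: eq_bigr => f _; rewrite /c/= eqxx /wbasis/= big_split/=.
rewrite mulrCA; congr (_ * _); rewrite -big_split/=; apply: eq_bigr => l _.
by rewrite /wbasis1 eE.
Qed.

Lemma Vfun_local s c i : exists c', forall y, box y ->
  Vfun sigma s c (affine sigma (idx_vec i) y) = wfun (P := P) c' y.
Proof.
pose isW (f : Rd -> R) := exists c', forall y, box y -> f y = wfun (P := P) c' y.
have W0 : isW (fun=> 0).
  by exists (fun=> 0) => y _; rewrite /wfun big1// => w _; rewrite mul0r.
have WD f g : isW f -> isW g -> isW (fun y => f y + g y).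
  move=> [u fu] [v gv]; exists (fun w => u w + v w) => y yb.
  rewrite fu// gv// /wfun -big_split/=; apply: eq_bigr => w _.
  by rewrite mulrDl.
have WZ k f : isW f -> isW (fun y => k * f y).
  move=> [u fu]; exists (fun w => k * u w) => y yb.
  by rewrite fu// /wfun mulr_sumr; apply: eq_bigr => w _; rewrite mulrA.
have WS (I : Type) (r : seq I) (Q : pred I) (F : I -> Rd -> R) :
    (forall i, isW (F i)) -> isW (fun y => \sum_(i <- r | Q i) F i y).
  move=> WF; elim: r => [|k r IH].
    by under eq_fun do rewrite big_nil.
  under eq_fun do rewrite big_cons.
  by case: (Q k); [exact: (WD _ _ (WF k) IH)|exact: IH].
apply: (WS _ s predT (fun j y => \sum_(a : multi P | (morder a <= P)%N)
   c j a * (phi sigma j (affine sigma (idx_vec i) y) *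
   monomial a (affine sigma (idx_vec i) y)))) => j.
apply: (WS _ _ _ (fun a y => c j a * (phi sigma j (affine sigma (idx_vec i) y) *
   monomial a (affine sigma (idx_vec i) y)))) => a.
by apply: WZ; exact: phi_monomial_local.
Qed.

Lemma elem_L2 (i : index) (g : Rd -> R) : is_tsum g -> L2 (elem sigma i) g.
Proof.
apply: (@bounded_tsum_L2 _ _ _ _ (\sum_l (`|(i l)%:~R| + 1) * sigma)); first exact: measurable_elem.
move=> x xi l; have /andP[h1 h2] := xi l.
apply: (@le_trans _ _ ((`|(i l)%:~R| + 1) * sigma)).
  have : (i l)%:~R * sigma <= `|(i l)%:~R| * sigma by rewrite ler_pM2r// ler_norm.
  have : - (i l)%:~R * sigma <= `|(i l)%:~R| * sigma.
    by rewrite ler_pM2r// (le_trans (ler_norm _))// normrN.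
  by rewrite ler_norml => a b; apply/andP; split; lra.
by rewrite (bigD1 l)//= lerDl sumr_ge0// => j _; rewrite mulr_ge0 ?addr_ge0// ltW.
Qed.

(** The same [c'] serves for the element and all its neighbors, so that estimates comparing two
    elements can be transported. Each derivative contributes one factor [sigma], squared under the
    integral. *)
Lemma sqint_elem_ref s c (i t : index) (a : forall k, @multi d k) : exists c', forall t : index,
   (forall l, `|t l| <= 1) ->
   sqint (elem sigma (i + t)) (Vfun sigma s c) =
      sigma ^+ d * sqint (elem 1 t) (wfun (P := P) c') /\
   forall k (a : @multi d k), sigma ^+ (2 * morder a) *
      sqint (elem sigma (i + t)) (partial a (Vfun sigma s c)) =
      sigma ^+ d * sqint (elem 1 t) (partial a (wfun (P := P) c')).
Proof.
have [c' hc'] := Vfun_local s c i.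
have tV := Vfun_tsum s c.
exists c' => {}t t1.
have tb x : elem 1 t x -> box x.
  move=> xt l; have := xt l; have := t1 l; rewrite !mulr1 ler_norml -!(ler_int R) intrN.
  by move=> /andP[a1 a2] /andP[a3 a4]; apply/andP; split; lra.
split.
  rewrite (sqint_affine (idx_vec i) sigma0)//; last 2 first.
  - exact: measurable_elem.
  - exact: elem_L2.
  rewrite affine_elem//; congr (_ * _); apply: sqint_eq => x xt.
  by rewrite /= hc'//; exact: tb.
move=> k {}a; have tp : is_tsum (partial a (Vfun sigma s c)) by exact: is_tsum_iter_partial.
rewrite (sqint_affine (idx_vec i) sigma0)//; last 2 first.
- exact: measurable_elem.
- exact: elem_L2.
rewrite affine_elem// mulrCA; congr (_ * _).
rewrite mulnC exprM -sqintZ; last 2 first.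
- exact: measurable_elem.
- by apply: elem1_L2; exact: is_tsum_affine.
apply: sqint_eq => x xt.
rewrite -[RHS](@iter_partial_local _ _ (elem 1 t) _ (Vfun sigma s c \o affine sigma (idx_vec i)))//.
- by rewrite iter_partial_affine// size_partial_seq.
- exact: open_elem.
- by move=> z /tb; exact: hc'.
Qed.

End fixed_sigma.

Lemma elem_inverse k : exists2 C, 0 <= C & forall sigma, 0 < sigma ->
  forall s c i (a : @multi d k),
  sigma ^+ (2 * morder a) * sqint (elem sigma i) (partial a (Vfun sigma s c)) <=
  C * sqint (elem sigma i) (Vfun sigma s c).
Proof.
pose Ca (a : @multi d k) := projT1 (cid2 (@ref_inverse R d P k a)).
have Ca0 a : 0 <= Ca a by rewrite /Ca; case: cid2.
exists (\sum_a Ca a); first by apply: sumr_ge0.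
move=> sigma s0 s c i a.
have [c' hc'] := sqint_elem_ref s0 s c i 0 (fun k => [ffun=> ord0]).
have [|e1 e2] := hc' 0; first by move=> l; rewrite ffunE normr0.
rewrite -[i]addr0 e2 e1 mulrCA ler_pM2l ?exprn_gt0//.
have h : sqint (elem 1 0) (partial a (wfun c')) <= Ca a * sqint (elem 1 0) (wfun c').
  by rewrite /Ca; case: cid2 => C /= _; exact.
apply: (le_trans h); apply: ler_wpM2r; first exact: sqint_ge0.
by rewrite (bigD1 a)//= lerDl sumr_ge0.
Qed.

(** Up to translation there are only 3^d relative positions of [i] and [j], and the sum of their
    reference constants bounds each of them. *)
Lemma elem_ghost k : exists2 C, 0 <= C & forall sigma, 0 < sigma ->
  forall s c (i j : index), (forall l, `|i l - j l| <= 1) ->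
  sqint (elem sigma i) (Vfun sigma s c) <=
  C * (sqint (elem sigma j) (Vfun sigma s c) +
    sigma ^+ (2 * k) * \sum_(a : multi k | morder a == k)
      sqint (elem sigma i) (partial a (Vfun sigma s c))).
Proof.
pose off (t : {ffun 'I_d -> 'I_3}) : index := [ffun l => (t l : nat)%:Z - 1].
have off1 t l : `|off t l| <= 1.
  by rewrite ffunE; case: (t l) => -[|[|[|]]].
pose Ct t := projT1 (cid2 (@ref_ghost R d P k (off t) (off1 t))).
have Ct0 t : 0 <= Ct t by rewrite /Ct; case: cid2.
exists (\sum_t Ct t); first by apply: sumr_ge0.
move=> sigma s0 s c i j ij.
have [c' hc'] := sqint_elem_ref s0 s c i 0 (fun k => [ffun=> ord0]).
have [|e1 e2] := hc' 0; first by move=> l; rewrite ffunE normr0.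
move: e1 e2; rewrite addr0 => e1 e2.
have [t jt] : exists t, j = i + off t.
  exists [ffun l => inord (absz (j l - i l + 1))]; apply/ffunP => l.
  have := ij l; rewrite ler_norml !ffunE => /andP[h1 h2].
  have h0 : 0 <= j l - i l + 1 by lia.
  rewrite inordK; last by rewrite -ltz_nat gez0_abs//; lia.
  by rewrite gez0_abs// addrK addrC subrK.
have [|e3 _] := hc' (off t); first exact: off1.
rewrite jt e3 mulr_sumr e1.
under [X in _ + X]eq_bigr => a /eqP ak.
  rewrite -[in X in X * _]ak e2; over.
rewrite -mulr_sumr -mulrDr mulrCA ler_pM2l ?exprn_gt0//.
set X := (X in _ <= _ * X).
have X0 : 0 <= X by rewrite addr_ge0 ?sqint_ge0// sumr_ge0// => a _; exact: sqint_ge0.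
have h : sqint (elem 1 0) (wfun c') <= Ct t * X.
  by rewrite /Ct /X; case: cid2 => C /= _; exact.
apply: (le_trans h); apply: (ler_wpM2r X0).
by rewrite (bigD1 t)//= lerDl sumr_ge0.
Qed.

End V_functions.

(** * Norm control by the stabilization *)

Lemma sum_uniq_le (R : numDomainType) (I : eqType) (p : pred I) (n : I -> R)
    (s s0 : seq I) : uniq s -> uniq s0 -> (forall i, p i -> 0 <= n i) ->
  (forall i, i \in s -> p i -> i \in s0) ->
  \sum_(i <- s | p i) n i <= \sum_(i <- s0 | p i) n i.
Proof.
move=> us us0 n0 ss0; rewrite [leRHS](bigID (fun i => i \in s))/=.
rewrite -[leLHS]addr0 lerD//; last by rewrite sumr_ge0// => i /andP[/n0].
rewrite -big_filter -[leRHS]big_filter le_eqVlt (perm_big [seq i <- s0 | p i & i \in s]) ?eqxx//.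
apply: uniq_perm; rewrite ?filter_uniq// => i; rewrite !mem_filter.
case pi: (p i) => //=; case: (boolP (i \in s)) => //= is_; by rewrite ss0.
Qed.

Section global_ghost.
Context {R : realType} {d : nat}.
Variable P : nat.
Notation Rd := 'rV[R]_d.
Notation mu := (@leb R d).
Notation index := {ffun 'I_d -> int}.
Implicit Types (i j : index).

Lemma index_offset (K : nat) i j : (forall l, `|j l - i l| <= K%:Z) ->
  exists t : {ffun 'I_d -> 'I_(K.*2.+1)}, j = i + [ffun l => (t l : nat)%:Z - K%:Z].
Proof.
move=> ij; exists [ffun l => inord (absz (j l - i l + K%:Z))]; apply/ffunP => l.
have := ij l; rewrite ler_norml !ffunE => /andP[h1 h2].
have h0 : 0 <= j l - i l + K%:Z by rewrite -lerBlDr sub0r.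
rewrite inordK; last first.
  rewrite -ltz_nat gez0_abs// (le_lt_trans (lerD h2 (lexx _)))//.
  by rewrite -PoszD ltz_nat addnn.
by rewrite gez0_abs// addrK addrC subrK.
Qed.

Section fixed.
Variables (sigma : R) (Omega : set Rd) (M : set index) (s0 : seq index).
Hypotheses (sigma0 : 0 < sigma) (oO : open Omega) (us0 : uniq s0).
Notation elem := (@elem R d sigma).
Notation fict := (fict_dom sigma Omega).
Hypothesis s0P : forall i, elem i `<=` fict ->
  forall j, (forall l, `|i l - j l| <= 1) -> j \in s0.

Definition cutp i : bool := `[< elem i `<=` cut_dom sigma Omega M >].
Definition fictp i : bool := `[< elem i `<=` fict >].

Lemma elem_mem_list i : elem i `<=` fict -> i \in s0.
Proof. by move=> /s0P; apply => l; rewrite subrr normr0. Qed.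

Lemma cut_fict i : elem i `<=` cut_dom sigma Omega M -> elem i `<=` fict.
Proof. by move=> /elems_domP-/(_ sigma0)[]. Qed.

Lemma uncut_Omega i : elem i `<=` uncut_dom sigma Omega M -> elem i `<=` Omega.
Proof. by move=> /elems_domP-/(_ sigma0)[]. Qed.

Lemma fict_cases i : elem i `<=` fict -> elem i `<=` Omega \/ cutp i.
Proof.
move=> iO; have [iOm|niOm] := pselect (elem i `<=` Omega); first by left.
by right; apply/asboolP/elems_domP => //; split=> //; left.
Qed.

Lemma Omega_elem x : Omega x -> ~ grid_planes sigma x ->
  exists2 j, j \in s0 & elem j x /\ elem j `<=` fict.
Proof.
move=> Ox /(elem_floor sigma0) xj.
have jf : elem (floor_index sigma x) `<=` fict.
  apply/elem_fict_dom => //; apply: open_leb_gt0.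
    by apply: openI => //; exact: open_elem.
  by exists x.
by exists (floor_index sigma x) => //; exact: elem_mem_list.
Qed.

(** The diagonal of [stab_form] with classical derivatives and a sum over the finite list; [A_formE]
    makes the connection. *)
Definition stab (k : nat) (g : Rd -> R) : R :=
  sigma ^+ (2 * k) * \sum_(i <- s0 | cutp i) \sum_(a : @multi d k | morder a == k)
    sqint (elem i) (partial a g).

Lemma stab_ge0 k g : 0 <= stab k g.
Proof.
rewrite mulr_ge0 ?exprn_ge0 ?(ltW sigma0)// sumr_ge0// => i _.
by rewrite sumr_ge0// => a _; exact: sqint_ge0.
Qed.

Lemma measurable_fict : measurable fict.
Proof. by apply: open_measurable_rV; exact: open_elems_dom. Qed.

Hypothesis bO : exists r : R, forall x, fict x -> forall l, `|x ord0 l| <= r.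

Lemma fict_tsum_L2 g : is_tsum g -> L2 fict g.
Proof. by have [r hr] := bO; apply: bounded_tsum_L2 hr; exact: measurable_fict. Qed.

Lemma Omega_sum_le g : is_tsum g ->
  sqint Omega g <= \sum_(i <- s0 | fictp i) sqint (elem i) g.
Proof.
move=> tg; rewrite -big_filter.
apply: (@elem_sum_le _ _ sigma _ fict).
- exact: open_measurable_rV.
- exact: measurable_fict.
- exact: fict_tsum_L2.
- exact: subset_fict_dom.
- by move=> j; rewrite mem_filter => /andP[/asboolP].
- move=> x Ox gx; have [j js [xj jf]] := Omega_elem Ox gx.
  by exists j => //; rewrite mem_filter js andbT; apply/asboolP.
Qed.

Lemma fict_sum_eq0 g : is_tsum g ->
  \sum_(i <- s0 | fictp i) sqint (elem i) g = 0 -> forall x, fict x -> g x = 0.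
Proof.
move=> tg /eqP; rewrite psumr_eq0 => [/allP g0 x|i _]; last exact: sqint_ge0.
move=> /interior_subset[i /=]; rewrite -elem_fict_dom// => iO xi.
apply: (closure_eq0 (is_tsum_continuous tg) _ xi) => {x xi}.
apply: continuous_int0.
- exact: open_elem.
- exact: is_tsum_continuous.
- exact: (elem_L2 sigma0 _ tg).2.
- have := g0 i (elem_mem_list iO); rewrite (_ : fictp i)/=; last exact/asboolP.
  by move/eqP.
Qed.

Section chains.
Variables (K k : nat) (s : seq index) (c : index -> @multi d P -> R) (cg : R).
Hypothesis chain : chain_condition sigma Omega M K.
Let g := Vfun sigma s c.
Hypothesis cg1 : 1 <= cg.
Hypothesis ghost : forall i j : index, (forall l, `|i l - j l| <= 1) ->
  sqint (elem i) g <= cg * (sqint (elem j) g +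
    sigma ^+ (2 * k) * \sum_(a : multi k | morder a == k)
      sqint (elem i) (partial a g)).

Let T := {ffun 'I_d -> 'I_(K.*2.+1)}.
Let off (t : T) : index := [ffun l => (t l : nat)%:Z - K%:Z].
(** [n1] and [n2] record the part of an element that the right-hand side of [chain_sum_le] controls:
    the integral over elements inside [Omega] and the penalty on cut elements. *)
Let n1 j := if `[< elem j `<=` Omega >] then sqint (elem j) g else 0.
Let n2 j := if cutp j then sigma ^+ (2 * k) * \sum_(a : multi k | morder a == k)
      sqint (elem j) (partial a g) else 0.
Let m j := n1 j + n2 j.

Let n10 j : 0 <= n1 j.
Proof. by rewrite /n1; case: ifP => // _; exact: sqint_ge0. Qed.

Let n20 j : 0 <= n2 j.
Proof.
rewrite /n2; case: ifP => // _; rewrite mulr_ge0 ?exprn_ge0 ?(ltW sigma0)//.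
by rewrite sumr_ge0// => a _; exact: sqint_ge0.
Qed.

Let m0 j : 0 <= m j. Proof. exact: addr_ge0. Qed.

(** Bounds everything that a chain starting at [i] can meet. Summing over the whole cube of offsets
    avoids any dependence on the particular chain. *)
Let S i : R := \sum_t m (i + off t).

Let m_le_S i j : (forall l, `|j l - i l| <= K%:Z) -> m j <= S i.
Proof.
move=> /index_offset[t ->]; rewrite /S (bigD1 t)//= lerDl.
by rewrite sumr_ge0// => u _; exact: m0.
Qed.

Let m_sum s' : uniq s' -> \sum_(j <- s') m j <= sqint Omega g + stab k g.
Proof.
move=> us'; rewrite big_split/= lerD//.
  rewrite -big_mkcond/= -big_filter; apply: elem_sum_ge => //.
  - exact: open_measurable_rV.
  - apply: (L2_subset measurable_fict) (fict_tsum_L2 (Vfun_tsum sigma0 s c)).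
      exact: open_measurable_rV.
    exact: subset_fict_dom.
  - exact: filter_uniq.
  - by move=> j; rewrite mem_filter => /andP[/asboolP].
rewrite -big_mkcond/= -mulr_sumr ler_wpM2l ?exprn_ge0 ?(ltW sigma0)//.
apply: sum_uniq_le => // [i _|i _ /asboolP/cut_fict/elem_mem_list//].
by rewrite sumr_ge0// => a _; exact: sqint_ge0.
Qed.

(** Walking along the chain costs a factor [2 * cg] per element: both the bound for the next element
    and the penalty on the present one are at most the accumulated constant times [S i]. *)
Let elem_bound i : fictp i -> sqint (elem i) g <= (2 * cg) ^+ K.+1 * S i.
Proof.
have cg2 : 1 <= 2 * cg by have := cg1; lra.
have Si0 : 0 <= S i by rewrite sumr_ge0// => t _; exact: m0.
move=> /asboolP/fict_cases[iO|/asboolP icut].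
  apply: (@le_trans _ _ (S i)); last by rewrite ler_peMl// exprn_ege1.
  apply: le_trans (m_le_S (j := i) _); last by move=> l; rewrite subrr normr0.
  by rewrite /m /n1 asboolT// lerDl.
have [n [q [nK q0 qcut qn [j [juncut nj]]]]] := chain icut.
have jO := uncut_Omega juncut.
have dist r : (r <= n)%N -> forall l, `|q r l - i l| <= r%:Z.
  elim: r => [|r IH] rn l; first by rewrite q0 subrr normr0.
  have := IH (ltnW rn) l; have := neighbor_dist sigma0 (qn r rn) l.
  rewrite !ler_norml -addn1 PoszD => /andP[? ?] /andP[? ?]; apply/andP; split; lia.
have mq r : (r <= n)%N -> m (q r) <= S i.
  move=> rn; apply: m_le_S => l; apply: (le_trans (dist r rn l)).
  by rewrite lez_nat (leq_trans rn)// ltnW.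
have mj : m j <= S i.
  apply: m_le_S => l; have := dist n (leqnn n) l; have := neighbor_dist sigma0 nj l.
  have : n.+1%:Z <= K%:Z by rewrite lez_nat.
  by rewrite -addn1 PoszD !ler_norml => ? /andP[? ?] /andP[? ?]; apply/andP; split; lia.
have n2q r : (r <= n)%N -> sigma ^+ (2 * k) *
    \sum_(a : multi k | morder a == k) sqint (elem (q r)) (partial a g) <= S i.
  move=> rn; apply: le_trans (mq r rn); rewrite /m /n2 /cutp asboolT ?lerDr//.
  exact: qcut.
have bound u v : u <= v * S i -> 1 <= v ->
    cg * (u + S i) <= 2 * cg * v * S i.
  move=> uv v1; rewrite (_ : 2 * cg * v * S i = cg * (v * S i + v * S i)); last by ring.
  by rewrite ler_pM2l ?(lt_le_trans ltr01)// lerD// ler_peMl.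
have gle u v w : u <= cg * (v + w) -> w <= S i -> u <= cg * (v + S i).
  move=> h1 h2; apply: (le_trans h1); rewrite ler_pM2l ?(lt_le_trans ltr01)//.
  by rewrite lerD2l.
(* The induction starts at the end of the chain, next to the uncut element [j], and goes back to
   [q 0 = i]. *)
have step r : (r <= n)%N -> sqint (elem (q (n - r)%N)) g <= (2 * cg) ^+ r.+1 * S i.
  elim: r => [|r IH] rn.
    rewrite subn0 expr1 -[2 * cg]mulr1.
    apply: (le_trans (gle _ _ _ (ghost (neighbor_dist sigma0 nj)) (n2q n (leqnn n)))).
    apply: bound => //; rewrite mul1r; apply: le_trans mj.
    by rewrite /m /n1 asboolT// lerDl.
  have lt : (n - r.+1 < n)%N by rewrite ltn_subrL (leq_ltn_trans _ rn).
  have nb := qn _ lt; rewrite subnSK// in nb.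
  apply: (le_trans (gle _ _ _ (ghost (neighbor_dist sigma0 nb)) (n2q _ (ltnW lt)))).
  rewrite exprS; apply: bound; first exact: (IH (ltnW rn)).
  exact: exprn_ege1.
have := step n (leqnn n); rewrite subnn q0 => /le_trans; apply.
by rewrite ler_wpM2r// ler_weXn2l// ltnS ltnW.
Qed.

(** The element bounds are added up by [shift_sum]: every element is counted at most once for each
    offset, however many chains pass through it. *)
Lemma chain_sum_le :
  \sum_(i <- s0 | fictp i) sqint (elem i) g <=
  (2 * cg) ^+ K.+1 * #|T|%:R * (sqint Omega g + stab k g).
Proof.
apply: (@le_trans _ _ (\sum_(i <- s0) (2 * cg) ^+ K.+1 * S i)).
  rewrite [leRHS](bigID fictp)/= -[leLHS]addr0 lerD//.
    by apply: ler_sum => i; exact: elem_bound.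
  apply: sumr_ge0 => i _; rewrite mulr_ge0//; first by rewrite exprn_ge0//; have := cg1; lra.
  by rewrite sumr_ge0// => t _; exact: m0.
rewrite -mulr_sumr -mulrA; apply: ler_wpM2l; first by rewrite exprn_ge0//; have := cg1; lra.
exact: shift_sum.
Qed.

End chains.
End fixed.
End global_ghost.

(** * Interpolation *)

Section polynomials.
Context {R : realType} {d : nat}.
Variable P : nat.
Notation Rd := 'rV[R]_d.

Definition poly_fun (c : @multi d P -> R) (x : Rd) : R :=
  \sum_(a : multi P | (morder a <= P)%N) c a * monomial a x.

Lemma monomial_tsum k (a : @multi d k) : is_tsum (@monomial R d k a).
Proof. by apply: (is_tsum_tens (F := fun l t => t ^+ a l)) => l; exact: smooth1X. Qed.

Lemma poly_fun_tsum c : is_tsum (poly_fun c).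
Proof.
apply: (@is_tsum_sum _ _ _ _ _ (fun a x => c a * monomial a x)) => a _.
by apply: is_tsumZ; exact: monomial_tsum.
Qed.

Lemma derive1n_monomial (c : R) m n : (m < n)%N ->
  derive1n n (fun t : R => c * t ^+ m) = fun=> 0.
Proof.
have d0 : forall n, derive1n n (fun=> 0 : R) = (fun=> 0 : R).
  elim=> [//|k IH]; rewrite derive1nS IH; apply/funext => x.
  by rewrite derive1_cst.
elim: m n c => [|m IH] [//|n] c mn; rewrite derive1Sn.
  rewrite (_ : derive1 _ = fun=> 0) ?d0//; apply/funext => x.
  by under eq_fun do rewrite expr0; rewrite derive1_cst.
rewrite (_ : derive1 _ = fun t => (c * m.+1%:R) * t ^+ m); first exact: IH.
apply/funext => x; rewrite derive1Ml; last exact: exprn_derivable.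
by rewrite (exp_derive1 m.+1 x) /= /GRing.scale/= mulrA.
Qed.

(** For each monomial the orders force some coordinate in which the derivative exceeds the
    exponent. *)
Lemma partial_poly_fun k (a : @multi d k) c : (P < morder a)%N ->
  partial a (poly_fun c) = fun=> 0.
Proof.
move=> aP; rewrite /partial iter_partial_sum => [|b _]; last first.
  by apply: is_tsumZ; exact: monomial_tsum.
apply/funext => x; apply: big1 => b bP.
rewrite iter_partialZ; last exact: monomial_tsum.
have [l lb] : exists l, (b l < a l)%N.
  apply: contrapT => /forallNP h; move: aP; rewrite ltnNge => /negP; apply.
  apply: leq_trans bP; apply: leq_sum => l _.
  by rewrite leqNgt; apply/negP; exact: h.
rewrite (iter_partial_tens _ (F := fun l t => t ^+ b l)) => [|j]; last exact: smooth1X.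
rewrite (bigD1 l)//= count_partial_seq.
rewrite (_ : (fun t => t ^+ b l) = fun t => 1 * t ^+ b l); last first.
  by apply/funext => t; rewrite mul1r.
by rewrite derive1n_monomial// mul0r mulr0.
Qed.

End polynomials.

Section multi_index_change.
Context {R : realType} {d : nat}.
Notation Rd := 'rV[R]_d.

(** The type of multi-indices depends on [k], and a seminorm of order [n] is indexed by [multi n].
    The cast is faithful when the order of [a] is at most [k']. *)
Definition multi_cast k k' (a : @multi d k) : @multi d k' := [ffun l => inord (a l)].

Lemma morder_ge k (a : @multi d k) l : (a l <= morder a)%N.
Proof. by rewrite /morder (bigD1 l)//= leq_addr. Qed.

Lemma multi_castE k k' (a : @multi d k) l : (morder a <= k')%N ->
  multi_cast k' a l = a l :> nat.
Proof.
by move=> ak; rewrite ffunE inordK// ltnS (leq_trans (morder_ge a l)).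
Qed.

Lemma morder_cast k k' (a : @multi d k) : (morder a <= k')%N ->
  morder (multi_cast k' a) = morder a.
Proof. by move=> ak; apply: eq_bigr => l _; exact: multi_castE. Qed.

Lemma partial_cast k k' (a : @multi d k) (f : Rd -> R) : (morder a <= k')%N ->
  partial (multi_cast k' a) f = partial a f.
Proof.
move=> ak; rewrite /partial; congr iter_partial; congr flatten.
by apply: eq_map => l; rewrite multi_castE.
Qed.

Lemma weak_partial_cast k k' (a : @multi d k) U (f g : Rd -> R) :
  (morder a <= k')%N -> weak_partial U a f g -> weak_partial U (multi_cast k' a) f g.
Proof. by move=> ak w psi tp; rewrite partial_cast// morder_cast//; exact: w. Qed.

Lemma morder0_weak k (a : @multi d k) U (f : Rd -> R) : morder a = 0%N ->
  weak_partial U a f f.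
Proof.
move=> a0 psi tp; rewrite a0 mul1r /partial.
have := size_partial_seq a; rewrite a0 => /size0nil ->.
by [].
Qed.

Definition multi0 k : @multi d k := [ffun=> ord0].

Lemma morder_multi0 k : morder (multi0 k) = 0%N.
Proof. by rewrite /morder big1// => l _; rewrite ffunE. Qed.

End multi_index_change.

Section sobolev_facts.
Context {R : realType} {d : nat}.
Notation Rd := 'rV[R]_d.
Notation mu := (@leb R d).

Lemma sobolev_wpartial k U (f : Rd -> R) (a : @multi d k) : open U ->
  sobolev k U f -> (morder a <= k)%N ->
  L2 U (wpartial U a f) /\ weak_partial U a f (wpartial U a f).
Proof.
by move=> oU [Lf hf] /hf[g [Lg wg]]; have [] := wpartialP oU Lg wg.
Qed.

Lemma sobolev_subset k U V (f : Rd -> R) : open U -> open V -> V `<=` U ->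
  sobolev k U f -> sobolev k V f.
Proof.
move=> oU oV VU [Lf hf]; have mU := open_measurable_rV oU.
have mV := open_measurable_rV oV; split; first exact: L2_subset Lf.
move=> a /hf[g [Lg wg]]; exists g; split; first exact: L2_subset Lg.
exact: weak_subset wg.
Qed.

Lemma seminormE k U (f : Rd -> R) :
  seminorm k U f ^+ 2 = \sum_(a : @multi d k | morder a == k) sqint U (wpartial U a f).
Proof. by rewrite sqr_sqrtr// sumr_ge0// => a _; exact: sqint_ge0. Qed.

Lemma sobolev_normE k U (f : Rd -> R) :
  sobolev_norm k U f ^+ 2 =
  \sum_(a : @multi d k | (morder a <= k)%N) sqint U (wpartial U a f).
Proof. by rewrite sqr_sqrtr// sumr_ge0// => a _; exact: sqint_ge0. Qed.

Lemma sobolev_norm_ge0 k U (f : Rd -> R) : 0 <= sobolev_norm k U f.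
Proof. exact: sqrtr_ge0. Qed.

(** One derivative of [w - v] is one summand of the squared seminorm. Uniqueness of weak derivatives
    allows the choice made on the whole space to replace the one made on [U]. *)
Lemma sobolev_approx k n U (w v : Rd -> R) (a : @multi d k) : open U ->
  sobolev k setT w -> is_tsum v -> (forall s, L2 U (iter_partial s v)) ->
  morder a = n -> (n <= k)%N ->
  sqint U (fun x => wpartial setT a w x - partial a v x) <=
  seminorm n U (fun x => w x - v x) ^+ 2.
Proof.
move=> oU sw tv Lv an nk; have mU := open_measurable_rV oU.
have ak : (morder a <= k)%N by rewrite an.
have an' : (morder a <= n)%N by rewrite an.
have [Lw ww] := sobolev_wpartial openT sw ak.
have mT : measurable [set: Rd] by [].
have UT : U `<=` [set: Rd] by [].
have LU : L2 U (wpartial setT a w) by exact: L2_subset Lw.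
have LwU : L2 U w by case: sw => Lw' _; exact: L2_subset Lw'.
pose a' := multi_cast n a.
have wk : weak_partial U a' (fun x => w x - v x)
    (fun x => wpartial setT a w x - partial a v x).
  have h := weak_lin (-1) mU (Lv [::]) (Lv _) LwU LU (@weak_tsum R d U k a v tv) (weak_subset UT ww).
  apply: weak_partial_cast => //.
  by apply: weak_partial_eq h => x _; rewrite mulN1r addrC.
have Ld : L2 U (fun x => wpartial setT a w x - partial a v x).
  by apply: L2B => //; exact: Lv.
have [Lw' _ ae] := wpartialP oU Ld wk.
rewrite -(sqint_ae mU mU (@subset_refl _ U) Lw' Ld ae) seminormE.
rewrite (bigD1 a')/=; last by rewrite morder_cast// an.
by rewrite lerDl sumr_ge0// => b _; exact: sqint_ge0.
Qed.

Lemma seminorm_le_setT k U (w : Rd -> R) : open U -> sobolev k setT w ->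
  seminorm k U w ^+ 2 =
  \sum_(a : @multi d k | morder a == k) sqint U (wpartial setT a w).
Proof.
move=> oU sw; rewrite seminormE; apply: eq_bigr => a /eqP ak.
have mU := open_measurable_rV oU.
have [Lw ww] := sobolev_wpartial openT sw (eq_leq ak).
have LU : L2 U (wpartial setT a w) by exact: L2_subset Lw.
have [Lw' _ ae] := wpartialP oU LU (weak_subset (@subsetT _ U) ww).
exact: (sqint_ae mU mU (@subset_refl _ U) Lw' LU ae).
Qed.

End sobolev_facts.

Section interpolation.
Context {R : realType} {d : nat}.
Variable P : nat.
Notation Rd := 'rV[R]_d.
Notation mu := (@leb R d).
Notation index := {ffun 'I_d -> int}.

Lemma sqint_sum_le (I : finType) D (f : I -> Rd -> R) : measurable D ->
  (forall i, L2 D (f i)) ->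
  sqint D (fun x => \sum_i f i x) <= #|I|%:R * \sum_i sqint D (f i).
Proof.
move=> mD Lf; rewrite mulr_sumr.
have iF i : mu.-integrable D (EFin \o (fun x => #|I|%:R * f i x ^+ 2)).
  rewrite (_ : EFin \o _ = fun x => (#|I|%:R%:E * (f i x ^+ 2)%:E)%E)//.
  by apply: integrableZl => //; exact: (Lf i).2.
rewrite (eq_bigr (fun i => \int[mu]_(x in D) (#|I|%:R * f i x ^+ 2))); last first.
  by move=> i _; rewrite RintegralZl//; exact: (Lf i).2.
rewrite -Rintegral_sum//; apply: le_Rintegral => //.
- exact: (L2_sum (index_enum I) (P := predT) mD (fun i _ => Lf i)).2.
- rewrite (_ : EFin \o _ =
      fun x => (\sum_(i <- index_enum I) (#|I|%:R * f i x ^+ 2)%:E)%E).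
    by apply: integrable_sum => //= i _; exact: iF.
  by apply/funext => x /=; rewrite sumEFin.
- move=> x _; rewrite -mulr_sumr.
  have := @discriminant_le _ (\sum_i f i x ^+ 2) (\sum_i f i x) #|I|%:R.
  rewrite [X in _ -> _ <= X]mulrC; apply => t.
  rewrite (_ : _ + _ = \sum_i (f i x + t) ^+ 2); first by rewrite sumr_ge0// => i _; exact: sqr_ge0.
  under [RHS]eq_bigr do rewrite sqrrD.
  rewrite !big_split/= sumr_const; congr (_ + _ + _).
    by rewrite -mulr_suml; ring.
  by rewrite mulr_natr.
Qed.

Implicit Types (i j : index).

Section fixed.
Variables (sigma : R) (Omega : set Rd) (M : set index) (s0 : seq index).
Hypotheses (sigma0 : 0 < sigma) (sigma1 : sigma <= 1) (oO : open Omega) (us0 : uniq s0).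
Notation elem := (@elem R d sigma).
Notation fict := (fict_dom sigma Omega).
Hypothesis s0P : forall i, elem i `<=` fict ->
  forall j, (forall l, `|i l - j l| <= 1) -> j \in s0.
Hypothesis bO : exists r : R, forall x, fict x -> forall l, `|x ord0 l| <= r.
Variable CL : R.
Hypothesis approx : local_approximation sigma Omega P CL.
Variable w : Rd -> R.
Hypothesis sw : sobolev P.+1 setT w.
Let k := P.+1.
Notation patch := (@patch_dom R d sigma).
Let U j : set Rd := fict `&` patch j.

Let oU j : open (U j).
Proof. by apply: openI; [exact: open_elems_dom|exact: open_obox]. Qed.

Let v_ex j : exists c : @multi d P -> R, U j !=set0 -> forall n, (n <= k)%N ->
  seminorm n (U j) (fun x => w x - poly_fun c x) <=
  CL * sigma ^+ (k - n) * seminorm k (U j) w.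
Proof.
(* Patches that miss the fictitious domain receive the zero polynomial, since the approximation
   assumption says nothing about them. *)
have [ne|e] := pselect (U j !=set0); last by exists (fun=> 0) => /e.
have [c hc] := @approx j ne _ (sobolev_subset openT (@oU j) (@subsetT _ _) sw).
by exists c => _.
Qed.

Let c j := projT1 (cid (v_ex j)).
Let v j := poly_fun (c j).
Let Nk j := \sum_(a : @multi d k | morder a == k) sqint (U j) (wpartial setT a w).
Let Dw (a : @multi d k) := wpartial setT a w.

Let UL2 j g : is_tsum g -> L2 (U j) g.
Proof.
move=> tg; apply: (L2_subset (measurable_fict sigma Omega)) (fict_tsum_L2 bO tg).
  exact: open_measurable_rV.
by move=> x [].
Qed.

Let vL2 j s D : measurable D -> D `<=` fict -> L2 D (iter_partial s (v j)).
Proof.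
move=> mD DU; apply: (L2_subset (measurable_fict sigma Omega) mD DU).
by apply: fict_tsum_L2 => //; apply: is_tsum_iter_partial; exact: poly_fun_tsum.
Qed.

Let v_approx j (a : @multi d k) : U j !=set0 -> (morder a <= k)%N ->
  sqint (U j) (fun x => Dw a x - partial a (v j) x) <=
  CL ^+ 2 * sigma ^+ (2 * (k - morder a)) * Nk j.
Proof.
move=> ne ak.
have h := sobolev_approx (@oU j) sw (poly_fun_tsum (c j)) (fun s => UL2 j (is_tsum_iter_partial s (poly_fun_tsum (c j)))) (erefl (morder a)) ak.
apply: (le_trans h).
rewrite /Nk -seminorm_le_setT// mulnC exprM -!exprMn.
have hc : seminorm (morder a) (U j) (fun x => w x - v j x) <=
    CL * sigma ^+ (k - morder a) * seminorm k (U j) w.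
  by rewrite /v /c; case: cid => c' /= /(_ ne); exact.
rewrite lerXn2r ?nnegrE//; first exact: sqrtr_ge0.
by apply: le_trans hc; exact: sqrtr_ge0.
Qed.

Let elem_corner i e : elem i `<=` patch (i + cshift e).
Proof.
move=> x xi l; have /andP[h1 h2] := xi l; rewrite !ffunE intrD.
apply/andP; split.
  by apply: le_lt_trans h1; rewrite ler_pM2r//; case: (e l) => /=; lra.
by apply: (lt_le_trans h2); rewrite ler_pM2r//; case: (e l) => /=; lra.
Qed.

Let E : R := #|{ffun 'I_d -> bool}|%:R.
Let N' i := \sum_(e : {ffun 'I_d -> bool}) Nk (i + cshift e).

Let Nk0 j : 0 <= Nk j.
Proof. by rewrite sumr_ge0// => a _; exact: sqint_ge0. Qed.

Let N'0 i : 0 <= N' i.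
Proof. by rewrite sumr_ge0. Qed.

Let Nk_N' i e : Nk (i + cshift e) <= N' i.
Proof. by rewrite /N' (bigD1 e)//= lerDl sumr_ge0. Qed.

Let i0 i : i = i + cshift [ffun=> false].
Proof. by apply/ffunP => l; rewrite !ffunE addr0. Qed.

Definition interp : Rd -> R := Vfun sigma s0 c.

Let corners i : seq index := [seq i + cshift e | e <- enum {ffun 'I_d -> bool}].
(** The deviation of [interp] from [v i] on [elem i]. It has the form of a [Vfun] so that the
    inverse estimate turns a bound for its L^2 norm into bounds for its derivatives. *)
Let G i := Vfun sigma (corners i) (fun j a => c j a - c i a).

Lemma VfunE s (b : index -> @multi d P -> R) x :
  Vfun sigma s b x = \sum_(j <- s) phi sigma j x * poly_fun (b j) x.
Proof.
apply: eq_bigr => j _; rewrite mulr_sumr; apply: eq_bigr => a _.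
by rewrite mulrCA.
Qed.

Let G_E i x : G i x = \sum_e phi sigma (i + cshift e) x * (v (i + cshift e) x - v i x).
Proof.
rewrite /G VfunE big_map big_enum/=; apply: eq_bigr => e _; congr (_ * _).
rewrite /v /poly_fun -sumrB; apply: eq_bigr => a _.
by rewrite mulrBl.
Qed.

(* By the partition of unity, [interp] is on [elem i] the local polynomial [v i]
   plus a combination of differences of local polynomials of touching patches,
   all of which approximate [w] on [elem i]. *)
Let interp_elem i x : elem i `<=` fict -> elem i x -> interp x = v i x + G i x.
Proof.
move=> iO xi; rewrite G_E /interp VfunE.
rewrite (@sum_corners _ _ sigma sigma0 i s0 (fun j => v j x) x us0)//; last first.
  move=> e; apply: (s0P iO) => l; rewrite !ffunE opprD addNKr.
  by case: (e l).
under [X in _ = _ + X]eq_bigr do rewrite mulrBr.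
by rewrite sumrB -mulr_suml phi_partition// mul1r addrC subrK.
Qed.

Section on_element.
Variable i : index.
Hypothesis iO : elem i `<=` fict.

Let mi : measurable (elem i). Proof. exact: measurable_elem. Qed.

Let iU e : elem i `<=` U (i + cshift e).
Proof. by move=> x xi; split; [exact: iO|exact: elem_corner]. Qed.

Let neU e : U (i + cshift e) !=set0.
Proof. by exists (center sigma i); apply: iU; exact: elem_center. Qed.

Let LDw (a : @multi d k) D : measurable D -> (morder a <= k)%N -> L2 D (Dw a).
Proof.
by move=> mD ak; have [L _] := sobolev_wpartial openT sw ak; exact: L2_subset L.
Qed.

Let v_elem (a : @multi d k) e : (morder a <= k)%N ->
  sqint (elem i) (fun x => Dw a x - partial a (v (i + cshift e)) x) <=
  CL ^+ 2 * sigma ^+ (2 * (k - morder a)) * N' i.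
Proof.
move=> ak; have mU := open_measurable_rV (@oU (i + cshift e)).
apply: (@le_trans _ _ (CL ^+ 2 * sigma ^+ (2 * (k - morder a)) * Nk (i + cshift e))).
  apply: le_trans (v_approx (neU e) ak); apply: sqint_subset => //.
  apply: L2B => //; first exact: LDw.
  by apply: vL2 => // x [].
by rewrite ler_wpM2l// mulr_ge0 ?sqr_ge0// exprn_ge0// ltW.
Qed.

Let Dw0 : {ae mu, forall x, setT x -> Dw (@multi0 d k) x = w x}.
Proof.
have m0 : (morder (@multi0 d k) <= k)%N by rewrite morder_multi0.
have [Lw ww] := sobolev_wpartial openT sw m0.
by apply: (weak_unique openT Lw sw.1 ww); exact: (@morder0_weak _ _ _ _ _ _ (morder_multi0 k)).
Qed.

Let Lw D : measurable D -> L2 D w.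
Proof. by move=> mD; apply: L2_subset sw.1. Qed.

Let w_v e : sqint (elem i) (fun x => w x - v (i + cshift e) x) <=
  CL ^+ 2 * sigma ^+ (2 * k) * N' i.
Proof.
have m0 : (morder (@multi0 d k) <= k)%N by rewrite morder_multi0.
have := v_elem e m0; rewrite morder_multi0 subn0; apply: le_trans.
rewrite le_eqVlt; apply/orP; left; apply/eqP.
have Lv : L2 (elem i) (v (i + cshift e)) := vL2 (i + cshift e) [::] mi iO.
apply: (sqint_ae mi mi (@subset_refl _ _)).
- by apply: L2B => //; exact: Lw.
- by apply: L2B => //; [exact: LDw|exact: vL2].
- apply: filterS Dw0 => x -> // _; congr (_ - _).
  by have := size_partial_seq (@multi0 d k); rewrite morder_multi0 /partial => /size0nil ->.
Qed.

Let C1 : R := E * (E * (4 * CL ^+ 2)).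

Let C10 : 0 <= C1.
Proof. by do 3 (apply: mulr_ge0 => //); exact: sqr_ge0. Qed.

(** On [elem i] the difference v_j - v_i equals (w - v_i) - (w - v_j), and [phi] is at most 1. One
    factor [E] of [C1] comes from squaring a sum of [E] terms, the other from adding up [E]
    bounds. *)
Let G_sq : sqint (elem i) (G i) <= C1 * sigma ^+ (2 * k) * N' i.
Proof.
have Lv e : L2 (elem i) (v (i + cshift e)) := vL2 (i + cshift e) [::] mi iO.
have Lvi : L2 (elem i) (v i) := vL2 i [::] mi iO.
have Lh e : L2 (elem i) (fun x => phi sigma (i + cshift e) x * (v (i + cshift e) x - v i x)).
  have := elem_L2 sigma0 i (Vfun_tsum sigma0 [:: i + cshift e] (fun j a => c j a - c i a)).
  apply: L2_eq => // x _; rewrite VfunE big_seq1; congr (_ * _).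
  by rewrite /v /poly_fun -sumrB; apply: eq_bigr => a _; rewrite mulrBl.
rewrite (@sqint_eq _ _ _ _ (fun x => \sum_e phi sigma (i + cshift e) x *
   (v (i + cshift e) x - v i x))); last by move=> x _; exact: G_E.
apply: (le_trans (sqint_sum_le mi Lh)).
rewrite (_ : C1 * _ * _ = E * (E * (4 * (CL ^+ 2 * (sigma ^+ (2 * k) * N' i))))); last first.
  by rewrite /C1 !mulrA.
rewrite ler_wpM2l//.
have -> : E * (4 * (CL ^+ 2 * (sigma ^+ (2 * k) * N' i))) =
    \sum_(e : {ffun 'I_d -> bool}) (4 * (CL ^+ 2 * (sigma ^+ (2 * k) * N' i))).
  by rewrite sumr_const /E mulr_natl.
apply: ler_sum => e _.
apply: (@le_trans _ _ (sqint (elem i) (fun x => (w x - v i x) - (w x - v (i + cshift e) x)))).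
  rewrite -lee_fin -!sqintE//; last by do 2 (apply: L2B => //); exact: Lw.
  have Lr : L2 (elem i) (fun x => (w x - v i x) - (w x - v (i + cshift e) x)).
    by do 2 (apply: L2B => //); exact: Lw.
  apply: ge0_le_integral => //.
  - by move=> x _; rewrite lee_fin sqr_ge0.
  - exact: (measurable_int _ (Lh e).2).
  - exact: (measurable_int _ Lr.2).
  - move=> x _; rewrite lee_fin exprMn.
    rewrite (_ : _ - (_ - _) = v (i + cshift e) x - v i x); last by ring.
    rewrite ler_piMl ?sqr_ge0//.
    by rewrite exprn_ile1// ?phi_ge0// phi_le1.
have h0 := w_v e; have h1 := w_v [ffun=> false]; rewrite -i0 in h1.
apply: (le_trans (sqintB_le mi (L2B mi (Lw mi) Lvi) (L2B mi (Lw mi) (Lv e)))).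
by move: h0 h1; rewrite -!mulrA; lra.
Qed.

Lemma interp_elem_L2 :
  sqint (elem i) (fun x => w x - interp x) <=
  (2 * CL ^+ 2 + 2 * C1) * sigma ^+ (2 * k) * N' i.
Proof.
have Lvi : L2 (elem i) (v i) := vL2 i [::] mi iO.
rewrite (@sqint_eq _ _ _ _ (fun x => (w x - v i x) - G i x)); last first.
  by move=> x xi; rewrite (interp_elem iO)// opprD addrA.
have LG : L2 (elem i) (G i) by apply: elem_L2 => //; exact: Vfun_tsum.
apply: (le_trans (sqintB_le mi (L2B mi (Lw mi) Lvi) LG)).
by have h1 := w_v [ffun=> false]; rewrite -i0 in h1; move: h1 G_sq; rewrite !mulrDl -!mulrA; lra.
Qed.

Variable Ci : R.
Hypothesis inverse : forall (s : seq index) (b : index -> @multi d P -> R) i (a : @multi d k),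
  sigma ^+ (2 * morder a) * sqint (elem i) (partial a (Vfun sigma s b)) <=
  Ci * sqint (elem i) (Vfun sigma s b).
Hypothesis Ci0 : 0 <= Ci.

Let interp_partial (a : @multi d k) x : elem i x ->
  partial a interp x = partial a (v i) x + partial a (G i) x.
Proof.
move=> xi; rewrite /partial.
rewrite (@iter_partial_local _ _ (elem i) _ _ (fun x => v i x + G i x))//.
- by rewrite iter_partialD//; [exact: poly_fun_tsum|exact: Vfun_tsum].
- exact: open_elem.
- by move=> y yi; apply: (interp_elem iO).
Qed.

Let G_partial (a : @multi d k) :
  sigma ^+ (2 * morder a) * sqint (elem i) (partial a (G i)) <=
  Ci * C1 * sigma ^+ (2 * k) * N' i.
Proof.
apply: (le_trans (inverse _ _ _ _)); rewrite -!mulrA ler_wpM2l//.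
by move: G_sq; rewrite -!mulrA.
Qed.

(** Derivatives of order [P.+1] annihilate [v i], so only [G i] is left; the powers of [sigma] in
    its bound and in the inverse estimate cancel. *)
Lemma interp_elem_top (a : @multi d k) : morder a = k ->
  sqint (elem i) (partial a interp) <= Ci * C1 * N' i.
Proof.
move=> ak; rewrite (@sqint_eq _ _ _ _ (partial a (G i))); last first.
  by move=> x xi; rewrite (interp_partial _ xi)// partial_poly_fun ?ak// add0r.
rewrite -(ler_pM2l (exprn_gt0 (2 * k) sigma0)).
by have := G_partial a; rewrite ak [sigma ^+ (2 * k) * (_ * _)]mulrCA mulrA.
Qed.

(** For lower orders [v i] is compared with the weak derivative of [w], and surplus powers of
    [sigma] are dropped because [sigma <= 1]. *)
Lemma interp_elem_low (a : @multi d k) : (morder a <= k)%N ->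
  sqint (elem i) (partial a interp) <=
  (2 * (Ci * C1) + 4 * CL ^+ 2) * N' i + 4 * sqint (elem i) (Dw a).
Proof.
move=> ak.
have tG : is_tsum (partial a (G i)) by apply: is_tsum_iter_partial; exact: Vfun_tsum.
have LG : L2 (elem i) (partial a (G i)) by exact: elem_L2.
have Lv : L2 (elem i) (partial a (v i)) by exact: vL2.
have LD : L2 (elem i) (Dw a) by exact: LDw.
rewrite (@sqint_eq _ _ _ _ (fun x => partial a (v i) x + partial a (G i) x)); last first.
  by move=> x; exact: interp_partial.
apply: (le_trans (sqintD_le mi Lv LG)).
have sk (n : nat) : sigma ^+ n <= 1 by rewrite exprn_ile1// ltW.
have s2 n : 0 < sigma ^+ n by rewrite exprn_gt0.
have hG : sqint (elem i) (partial a (G i)) <= Ci * C1 * N' i.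
  rewrite -(ler_pM2l (s2 (2 * morder a)%N)); apply: (le_trans (G_partial a)).
  have -> : (2 * k = 2 * morder a + 2 * (k - morder a))%N by rewrite -mulnDr subnKC.
  have X0 : 0 <= Ci * C1 * N' i.
    by apply: mulr_ge0 => //; apply: mulr_ge0.
  rewrite exprD; set q := sigma ^+ (2 * (k - _)).
  rewrite (_ : Ci * C1 * _ * _ = sigma ^+ (2 * morder a) * (Ci * C1 * N' i * q)); last first.
    by move: (Ci * C1) (N' i) => x y; ring.
  by rewrite ler_pM2l// ler_piMr// sk.
have hv : sqint (elem i) (partial a (v i)) <= 2 * sqint (elem i) (Dw a) + 2 * (CL ^+ 2 * N' i).
  rewrite (@sqint_eq _ _ _ _ (fun x => Dw a x - (Dw a x - partial a (v i) x))); last first.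
    by move=> x _; rewrite opprB addrC subrK.
  apply: (le_trans (sqintB_le mi LD (L2B mi LD Lv))); rewrite lerD2l ler_pM2l//.
  have := v_elem [ffun=> false] ak; rewrite -i0 => /le_trans; apply.
  have X0 : 0 <= CL ^+ 2 * N' i by rewrite mulr_ge0// sqr_ge0.
  by rewrite mulrAC ler_piMr.
by move: hG hv; rewrite !mulrDl -!mulrA; lra.
Qed.

End on_element.

Notation T := {ffun 'I_d -> 'I_(1.*2.+1)}.
Let off (t : T) : index := [ffun l => (t l : nat)%:Z - 1%:Z].
Let mass j := \sum_(b : @multi d k | morder b == k) sqint (elem j) (Dw b).
Let X := \sum_(b : @multi d k | morder b == k) sqint setT (Dw b).

Let LDT (b : @multi d k) : (morder b <= k)%N -> L2 setT (Dw b).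
Proof. by move=> bk; have [] := sobolev_wpartial openT sw bk. Qed.

Let mass_sum s : uniq s -> \sum_(j <- s) mass j <= X.
Proof.
move=> us; rewrite exchange_big/=; apply: ler_sum => b /eqP bk.
by apply: elem_sum_ge => //; apply: LDT; rewrite bk.
Qed.

(** Up to grid planes a patch lies in the elements whose index differs from [j] by at most 1 in each
    coordinate, so patch energies overlap boundedly. *)
Let Nk_mass j : Nk j <= \sum_t mass (j + off t).
Proof.
rewrite exchange_big/=; apply: ler_sum => b /eqP bk.
rewrite -(big_map (fun t => j + off t) predT (fun i => sqint (elem i) (Dw b))).
apply: (@elem_sum_le _ _ sigma _ setT) => //.
- exact: open_measurable_rV.
- by apply: LDT; rewrite bk.
- move=> x [_ xj] /(elem_floor sigma0) xf; exists (floor_index sigma x) => //.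
  have [|t ->] := @index_offset d 1 j (floor_index sigma x).
    move=> l; have /andP[a1 a2] := xj l; have /andP[b1 b2] := xf l.
    have h1 : (floor_index sigma x l)%:~R < (j l)%:~R + 1 :> R.
      by rewrite -(ltr_pM2r sigma0); exact: lt_trans a2.
    have h2 : (j l)%:~R - 1 < (floor_index sigma x l)%:~R + 1 :> R.
      by rewrite -(ltr_pM2r sigma0); exact: lt_trans b2.
    have h3 : floor_index sigma x l < j l + 1 by rewrite -(ltr_int R) intrD.
    have h4 : j l - 1 < floor_index sigma x l + 1.
      by rewrite -(ltr_int R) !intrD.
    by rewrite ler_norml; move: h3 h4; clear; move: (floor_index sigma x l) (j l); lia.
  by apply: map_f; rewrite mem_index_enum.
Qed.

Let N'_sum : \sum_(i <- s0 | fictp sigma Omega i) N' i <=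
  #|{: {ffun 'I_d -> bool} * T}|%:R * X.
Proof.
apply: (@le_trans _ _ (\sum_(i <- s0) N' i)).
  by rewrite [leRHS](bigID (fictp sigma Omega))/= lerDl sumr_ge0.
apply: le_trans (@shift_sum _ _ mass X _
  (fun p : {ffun 'I_d -> bool} * T => cshift p.1 + off p.2) s0 mass_sum us0).
apply: ler_sum => i _.
rewrite -(pair_big predT predT (fun e t => mass (i + (cshift e + off t))))/=.
apply: ler_sum => e _; apply: (le_trans (Nk_mass _)).
by apply: ler_sum => t _; rewrite addrA.
Qed.

Let X_S : X <= sobolev_norm k setT w ^+ 2.
Proof.
rewrite sobolev_normE [leRHS](bigID (fun a : @multi d k => morder a == k))/=.
rewrite -[leLHS]addr0 lerD//; last by rewrite sumr_ge0// => a _; exact: sqint_ge0.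
rewrite le_eqVlt; apply/orP; left; apply/eqP; apply: eq_bigl => a.
by rewrite andb_idl// => /eqP ->.
Qed.

Let N'_S : \sum_(i <- s0 | fictp sigma Omega i) N' i <=
  #|{: {ffun 'I_d -> bool} * T}|%:R * sobolev_norm k setT w ^+ 2.
Proof. by apply: (le_trans N'_sum); rewrite ler_wpM2l. Qed.

Lemma interp_global (Ci : R) : 0 <= Ci ->
  (forall (s : seq index) (b : index -> @multi d P -> R) i (a : @multi d k),
    sigma ^+ (2 * morder a) * sqint (elem i) (partial a (Vfun sigma s b)) <=
    Ci * sqint (elem i) (Vfun sigma s b)) ->
  let S := sobolev_norm k setT w ^+ 2 in
  let N : R := #|{: {ffun 'I_d -> bool} * T}|%:R in
  let C1 : R := E * (E * (4 * CL ^+ 2)) in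
  [/\ sqint Omega (fun x => w x - interp x) <=
        (2 * CL ^+ 2 + 2 * C1) * sigma ^+ (2 * k) * (N * S),
      forall a : @multi d k, (morder a <= k)%N -> sqint Omega (partial a interp) <=
        (2 * (Ci * C1) + 4 * CL ^+ 2) * (N * S) + 4 * S &
      stab sigma Omega M s0 k interp <=
        sigma ^+ (2 * k) * (#|@multi d k|%:R * (Ci * C1) * (N * S))].
Proof.
move=> Ci0 inv S N C1.
have C10 : 0 <= C1 by do 3 (apply: mulr_ge0 => //); exact: sqr_ge0.
have ti a : is_tsum (@partial R d k a interp).
  by apply: is_tsum_iter_partial; exact: Vfun_tsum.
have [A1 A2] : 0 <= 2 * CL ^+ 2 + 2 * C1 /\ 0 <= 2 * (Ci * C1) + 4 * CL ^+ 2.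
  by have := sqr_ge0 CL; have := mulr_ge0 Ci0 C10; split; lra.
split.
- apply: (@le_trans _ _ (\sum_(i <- s0 | fictp sigma Omega i)
      sqint (elem i) (fun x => w x - interp x))).
    rewrite -big_filter; apply: (@elem_sum_le _ _ sigma _ fict).
    + exact: open_measurable_rV.
    + exact: measurable_fict.
    + apply: L2B; [exact: measurable_fict| |apply: fict_tsum_L2 => //; exact: Vfun_tsum].
      exact: (L2_subset measurableT (measurable_fict sigma Omega) (@subsetT _ _) sw.1).
    + exact: subset_fict_dom.
    + by move=> j; rewrite mem_filter => /andP[/asboolP].
    + move=> x Ox gx; have [j js [xj jf]] := Omega_elem sigma0 oO s0P Ox gx.
      by exists j => //; rewrite mem_filter js andbT; apply/asboolP.
  apply: (@le_trans _ _ (\sum_(i <- s0 | fictp sigma Omega i)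
      (2 * CL ^+ 2 + 2 * C1) * sigma ^+ (2 * k) * N' i)).
    by apply: ler_sum => i /asboolP iO; exact: interp_elem_L2.
  by rewrite -mulr_sumr ler_wpM2l// mulr_ge0// exprn_ge0// ltW.
- move=> a ak; apply: (le_trans (Omega_sum_le sigma0 oO s0P bO (ti a))).
  apply: (@le_trans _ _ (\sum_(i <- s0 | fictp sigma Omega i)
      ((2 * (Ci * C1) + 4 * CL ^+ 2) * N' i + 4 * sqint (elem i) (Dw a)))).
    by apply: ler_sum => i /asboolP iO; exact: interp_elem_low.
  rewrite big_split/= -!mulr_sumr; apply: lerD; first by rewrite ler_wpM2l.
  rewrite ler_wpM2l// -big_filter.
  apply: (@le_trans _ _ (sqint setT (Dw a))).
    by apply: elem_sum_ge => //; [exact: LDT|exact: filter_uniq].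
  rewrite /S sobolev_normE (bigD1 a)//= lerDl sumr_ge0// => b _; exact: sqint_ge0.
- rewrite /stab ler_wpM2l ?exprn_ge0 ?(ltW sigma0)//.
  apply: (@le_trans _ _ (\sum_(i <- s0 | cutp sigma Omega M i)
      #|@multi d k|%:R * (Ci * C1) * N' i)).
    apply: ler_sum => i /asboolP iO.
    have -> : #|@multi d k|%:R * (Ci * C1) * N' i =
        \sum_(a : @multi d k) Ci * C1 * N' i.
      by rewrite sumr_const -[RHS]mulr_natl [RHS]mulrA.
    rewrite [leRHS](bigID (fun a : @multi d k => morder a == k))/=.
    rewrite -[leLHS]addr0 lerD//; last first.
      by rewrite sumr_ge0// => a _; do 2 (apply: mulr_ge0 => //).
    apply: ler_sum => a /eqP ak; apply: interp_elem_top => //.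
    exact: (cut_fict sigma0 iO).
  rewrite -mulr_sumr ler_wpM2l//; first by do 2 (apply: mulr_ge0 => //).
  apply: le_trans N'_S.
  rewrite [leRHS](bigID (cutp sigma Omega M))/= -[leLHS]addr0 lerD//; last by rewrite sumr_ge0.
  rewrite le_eqVlt; apply/orP; left; apply/eqP; apply: eq_bigl => i.
  by rewrite andb_idl// => /asboolP/(cut_fict sigma0) iO; apply/asboolP.
Qed.

End fixed.

(** The constant is fixed before [sigma], [Omega], the moved elements and [w]; this order of
    quantifiers carries the uniformity of the final bound. *)
Lemma interpolation (CL : R) : exists2 C : R, 0 <= C &
  forall (sigma : R) (Omega : set Rd) (M : set index) (s0 : seq index),
  0 < sigma -> sigma <= 1 -> open Omega -> uniq s0 ->
  (forall i, elem sigma i `<=` fict_dom sigma Omega ->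
     forall j, (forall l, `|i l - j l| <= 1) -> j \in s0) ->
  (exists r : R, forall x, fict_dom sigma Omega x -> forall l, `|x ord0 l| <= r) ->
  local_approximation sigma Omega P CL ->
  forall w : Rd -> R, sobolev P.+1 setT w ->
  exists c : index -> @multi d P -> R,
    let S := sobolev_norm P.+1 setT w ^+ 2 in
    [/\ sqint Omega (fun x => w x - Vfun sigma s0 c x) <= C * sigma ^+ (2 * P.+1) * S,
        forall a : @multi d P.+1, (morder a <= P.+1)%N ->
          sqint Omega (partial a (Vfun sigma s0 c)) <= C * S &
        stab sigma Omega M s0 P.+1 (Vfun sigma s0 c) <= C * sigma ^+ (2 * P.+1) * S].
Proof.
have [Ci Ci0 inv] := @elem_inverse R d P P.+1.
pose E : R := #|{ffun 'I_d -> bool}|%:R.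
pose N : R := #|{: {ffun 'I_d -> bool} * {ffun 'I_d -> 'I_(1.*2.+1)}}|%:R.
pose C1 : R := E * (E * (4 * CL ^+ 2)).
have N0 : 0 <= N by exact: ler0n.
have C10 : 0 <= C1.
  by apply: mulr_ge0; [exact: ler0n|apply: mulr_ge0; [exact: ler0n|]]; rewrite mulr_ge0 ?sqr_ge0.
pose A1 := (2 * CL ^+ 2 + 2 * C1) * N.
pose A2 := (2 * (Ci * C1) + 4 * CL ^+ 2) * N + 4.
pose A3 := #|@multi d P.+1|%:R * (Ci * C1) * N.
have [A10 A20 A30] : [/\ 0 <= A1, 0 <= A2 & 0 <= A3].
  have c0 := sqr_ge0 CL; have c1 := mulr_ge0 Ci0 C10; split.
  - by apply: mulr_ge0 => //; lra.
  - by apply: addr_ge0 => //; apply: mulr_ge0 => //; lra.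
  - by do 2 (apply: mulr_ge0 => //).
exists (A1 + A2 + A3); first by do 2 apply: addr_ge0 => //.
move=> sigma Omega M s0 sigma0 sigma1 oO us0 s0P bO approx w sw.
have [h1 h2 h3] := interp_global M sigma0 sigma1 oO us0 s0P bO approx sw Ci0 (inv sigma sigma0).
rewrite /interp in h1 h2 h3.
set c := (X in Vfun _ _ X) in h1; exists c => S.
have S0 : 0 <= S by exact: sqr_ge0.
have s2 : 0 <= sigma ^+ (2 * P.+1) by rewrite exprn_ge0// ltW.
split.
- apply: (le_trans h1); rewrite -/C1 -/N -/S.
  rewrite (_ : _ * (N * S) = A1 * (sigma ^+ (2 * P.+1) * S)); last by rewrite /A1; ring.
  rewrite -mulrA; apply: ler_wpM2r; first exact: mulr_ge0.
  by rewrite -addrA lerDl; exact: addr_ge0.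
- move=> a ak; apply: (le_trans (h2 a ak)); rewrite -/C1 -/N -/S.
  rewrite (_ : _ + 4 * S = A2 * S); last by rewrite /A2; ring.
  by rewrite ler_wpM2r// addrAC lerDr; exact: addr_ge0.
- apply: (le_trans h3); rewrite -/C1 -/N -/S.
  rewrite (_ : _ * (_ * (N * S)) = A3 * (sigma ^+ (2 * P.+1) * S)); last by rewrite /A3; ring.
  rewrite -mulrA; apply: ler_wpM2r; first exact: mulr_ge0.
  by rewrite lerDr; exact: addr_ge0.
Qed.

End interpolation.

(** * Galerkin solution and error estimate *)

Section linear_solve.
Variables (R : fieldType) (J : finType).
Implicit Types (x y z : J -> R).

Definition lin_form (L : (J -> R) -> R) :=
  forall a x y, L (fun j => a * x j + y j) = a * L x + L y.

Let e (j : J) : J -> R := fun i => (i == j)%:R.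

Lemma lin_form0 L : lin_form L -> L (fun=> 0) = 0.
Proof.
move=> lL; apply/eqP; rewrite -[X in X == _](addrK (L (fun=> 0))) subr_eq0.
by have := lL 1 (fun=> 0) (fun=> 0); rewrite mulr0 addr0 mul1r => <-.
Qed.

Lemma lin_form_expand L x : lin_form L -> L x = \sum_j x j * L (e j).
Proof.
move=> lL.
have h r : L (fun i => \sum_(j <- r) x j * e j i) = \sum_(j <- r) x j * L (e j).
  elim: r => [|j r IH].
    by rewrite big_nil -[RHS](lin_form0 lL); congr L; apply/funext => i; rewrite big_nil.
  rewrite big_cons -IH -lL; congr L; apply/funext => i; by rewrite big_cons.
rewrite -h; congr L; apply/funext => i; rewrite (bigD1 i)//= /e eqxx mulr1.
by rewrite big1 ?addr0// => j ji; rewrite eq_sym (negbTE ji) mulr0.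
Qed.

(** [B] may be singular, the coefficients being redundant. The system is solvable because [F] lies
    in the row space of [B]: a vector annihilated by [B] has [B z z = 0], hence [F z = 0]. *)
Lemma galerkin_exists (B : (J -> R) -> (J -> R) -> R) (F : (J -> R) -> R) :
  (forall z, lin_form (B^~ z)) -> (forall z, lin_form (B z)) -> lin_form F ->
  (forall z, B z z = 0 -> F z = 0) -> exists x, forall y, B x y = F y.
Proof.
move=> Bl Br Fl BF.
pose Bm : 'M[R]_#|J| := \matrix_(i, j) B (e (enum_val i)) (e (enum_val j)).
pose Fm : 'rV[R]_#|J| := \row_j F (e (enum_val j)).
have sumJ (G : J -> R) : \sum_j G j = \sum_(i < #|J|) G (enum_val i).
  by rewrite -(big_enum_val (A := J)).
have sub : (Fm <= Bm)%MS.
  rewrite submxE; apply/eqP/rowP => q; rewrite !mxE.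
  (* A column of the cokernel matrix: it satisfies [B (e i) z = 0] for every [i]. *)
  pose z (j : J) := cokermx Bm (enum_rank j) q.
  have Bz i : B (e i) z = 0.
    rewrite (lin_form_expand z (Br (e i))) sumJ.
    have := congr1 (fun A : 'M[R]_(#|J|) => A (enum_rank i) q) (mulmx_coker Bm).
    rewrite !mxE => h; rewrite -[RHS]h; apply: eq_bigr => j _.
    by rewrite /z !mxE enum_valK enum_rankK mulrC.
  have /BF : B z z = 0.
    by rewrite (lin_form_expand z (Bl z)) big1// => i _; rewrite Bz mulr0.
  rewrite (lin_form_expand z Fl) sumJ => h; rewrite -[RHS]h; apply: eq_bigr => j _.
  by rewrite /z !mxE enum_valK mulrC.
have [D FD] := submxP sub.
exists (fun j => D ord0 (enum_rank j)) => y.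
rewrite (lin_form_expand y (Br _)) (lin_form_expand y Fl); apply: eq_bigr => j _.
congr (_ * _); rewrite (lin_form_expand _ (Bl (e j))) sumJ.
have := congr1 (fun A : 'rV[R]_(#|J|) => A ord0 (enum_rank j)) FD.
rewrite !mxE enum_rankK => ->; apply: eq_bigr => i _.
by rewrite !mxE enum_valK enum_rankK.
Qed.

End linear_solve.

Section sobolev_tsum.
Context {R : realType} {d : nat}.
Notation Rd := 'rV[R]_d.
Notation mu := (@leb R d).
Variables (k : nat) (U : set Rd) (g : Rd -> R).
Hypotheses (oU : open U) (tg : is_tsum g).
Hypothesis Lg : forall s, L2 U (iter_partial s g).

(** Cutting [g] off outside [U] does not affect weak derivatives on [U], so [weak_tsum] and
    uniqueness apply. *)
Lemma wpartial_tsum (a : @multi d k) :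
  L2 U (wpartial U a (g \_ U)) /\
  {ae mu, forall x, U x -> wpartial U a (g \_ U) x = partial a g x}.
Proof.
rewrite (@wpartial_eq _ _ _ _ _ _ g); last by move=> x Ux; rewrite patchE mem_set.
by have [? _ ?] := wpartialP oU (Lg _) (@weak_tsum _ _ U _ a g tg).
Qed.

Lemma sobolev_tsum : sobolev k U (g \_ U).
Proof.
have mU := open_measurable_rV oU.
have gU x : U x -> g x = (g \_ U) x by move=> Ux; rewrite patchE mem_set.
split=> [|a ak]; first by apply: L2_eq (Lg [::]).
exists (partial a g); split; first exact: Lg.
by apply: weak_partial_eq (@weak_tsum _ _ U _ a g tg).
Qed.

Lemma sobolev_norm_tsum : sobolev_norm k U (g \_ U) ^+ 2 =
  \sum_(a : @multi d k | (morder a <= k)%N) sqint U (partial a g).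
Proof.
have mU := open_measurable_rV oU.
rewrite sobolev_normE; apply: eq_bigr => a ak; have [Lw ae] := wpartial_tsum a.
exact: (sqint_ae mU mU (@subset_refl _ U) Lw (Lg _) ae).
Qed.

End sobolev_tsum.

Section galerkin_space.
Context {R : realType} {d : nat}.
Variable P : nat.
Notation Rd := 'rV[R]_d.
Notation mu := (@leb R d).
Notation index := {ffun 'I_d -> int}.
Implicit Types (i j : index) (c : index -> @multi d P -> R).

Variables (sigma : R) (Omega : set Rd) (M : set index) (s0 : seq index).
Hypotheses (sigma0 : 0 < sigma) (oO : open Omega) (us0 : uniq s0).
Notation elem := (@elem R d sigma).
Notation fict := (fict_dom sigma Omega).
Hypothesis s0P : forall i, elem i `<=` fict ->
  forall j, (forall l, `|i l - j l| <= 1) -> j \in s0.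
Hypothesis bO : exists r : R, forall x, fict x -> forall l, `|x ord0 l| <= r.
Let k := P.+1.

Lemma phi_outside j (a : @multi d P) x : j \notin s0 -> fict x ->
  phi sigma j x * monomial a x = 0.
Proof.
move=> js /interior_subset[i /=]; rewrite -elem_fict_dom// => iO xi.
have tp := phi_monomial_tsum sigma0 j a.
apply: (closure_eq0 (is_tsum_continuous tp) _ xi) => y yi.
rewrite (phi_corner sigma0 yi) ?mul0r// => e je; move/negP: js; apply.
rewrite je; apply: (s0P iO) => l; rewrite !ffunE opprD addNKr.
by case: (e l).
Qed.

(** Coefficients of repeated indices are added, and indices outside [s0] are dropped because their
    [phi] vanishes on the fictitious domain. The discrete space thus has a finite set of
    generators. *)
Lemma Vfun_restrict (s : seq index) c : exists c', forall x, fict x ->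
  Vfun sigma s c x = Vfun sigma s0 c' x.
Proof.
exists (fun j a => \sum_(i <- s | i == j) c i a) => x Ox; rewrite /Vfun.
pose G i := \sum_(a : @multi d P | (morder a <= P)%N) c i a * (phi sigma i x * monomial a x).
transitivity (\sum_(i <- s) \sum_(j <- s0 | j == i) G i).
  apply: eq_bigr => i _; rewrite -/(G i); have [is0|is0] := boolP (i \in s0).
    by rewrite -big_filter filter_pred1_uniq// big_seq1.
  rewrite big_seq_cond big1 => [|j /andP[js /eqP ji]]; last by rewrite ji (negbTE is0) in js.
  by rewrite /G big1// => a _; rewrite phi_outside// mulr0.
rewrite (exchange_big_dep predT)//=; apply: eq_bigr => j _.
rewrite (eq_bigl (fun i => i == j)); last by move=> i; rewrite eq_sym.
rewrite exchange_big/=; apply: eq_bigr => a _; rewrite mulr_suml.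
by apply: eq_bigr => i /eqP ->.
Qed.

Lemma V_spaceP v : V_space sigma Omega P v <->
  exists c, v = (Vfun sigma s0 c) \_ fict.
Proof.
split=> [[s [c ->]]|[c ->]]; last by exists s0, c.
have [c' h] := Vfun_restrict s c; exists c'.
apply/funext => x; rewrite !patchE; case: ifPn => // /set_mem xO; exact: h.
Qed.

Lemma Vfun_lin (t : R) c c' :
  Vfun sigma s0 (fun i a => t * c i a + c' i a) =
  fun x => t * Vfun sigma s0 c x + Vfun sigma s0 c' x.
Proof.
apply/funext => x; rewrite /Vfun mulr_sumr -big_split; apply: eq_bigr => i _ /=.
rewrite mulr_sumr -big_split; apply: eq_bigr => a _ /=.
by rewrite mulrDl -mulrA.
Qed.

Definition stab_bil (u v : Rd -> R) : R :=
  sigma ^+ (2 * k) * \sum_(i <- s0 | cutp sigma Omega M i)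
    \sum_(a : @multi d k | morder a == k)
      \int[mu]_(x in elem i) (partial a u x * partial a v x).

Lemma stab_bil_diag u : stab_bil u u = stab sigma Omega M s0 k u.
Proof.
by [].
Qed.

Lemma stab_bilC u v : stab_bil u v = stab_bil v u.
Proof.
rewrite /stab_bil; congr (_ * _); apply: eq_bigr => i _; apply: eq_bigr => a _.
by apply: eq_Rintegral => x _; rewrite mulrC.
Qed.

Lemma Rintegral_mul_lin D (t : R) (u v w : Rd -> R) : measurable D ->
  L2 D u -> L2 D v -> L2 D w ->
  \int[mu]_(x in D) ((t * u x + v x) * w x) =
  t * \int[mu]_(x in D) (u x * w x) + \int[mu]_(x in D) (v x * w x).
Proof.
move=> mD Lu Lv Lw.
have iu := L2_mul_integrable mD Lu Lw; have iv := L2_mul_integrable mD Lv Lw.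
rewrite -RintegralZl// -RintegralD//; last first.
  rewrite (_ : EFin \o _ = fun x => (t%:E * (u x * w x)%:E)%E)//.
  exact: integrableZl.
by apply: eq_Rintegral => x _; rewrite mulrDl mulrA.
Qed.

Lemma stab_bil_lin (t : R) u v w : is_tsum u -> is_tsum v -> is_tsum w ->
  stab_bil (fun x => t * u x + v x) w = t * stab_bil u w + stab_bil v w.
Proof.
move=> tu tv tw; rewrite /stab_bil [t * (_ * _)]mulrCA -mulrDr; congr (_ * _).
rewrite mulr_sumr -big_split; apply: eq_bigr => i _ /=.
rewrite mulr_sumr -big_split; apply: eq_bigr => a _ /=.
have mi := measurable_elem sigma i.
have tp (g : Rd -> R) : is_tsum g -> L2 (elem i) (partial a g).
  by move=> tg; apply: elem_L2 => //; exact: is_tsum_iter_partial.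
rewrite -Rintegral_mul_lin//; try exact: tp.
apply: eq_Rintegral => x _; congr (_ * _).
have tz : is_tsum (fun x => t * u x) by exact: is_tsumZ.
by rewrite /partial (iter_partialD _ tz tv) iter_partialZ.
Qed.

Lemma stab_bil_CS u v : is_tsum u -> is_tsum v ->
  stab_bil u v ^+ 2 <= stab sigma Omega M s0 k u * stab sigma Omega M s0 k v.
Proof.
move=> tu tv; rewrite mulrC; apply: discriminant_le => t.
rewrite -!stab_bil_diag.
have tw : is_tsum (fun x => t * u x + v x) by apply: is_tsumD => //; exact: is_tsumZ.
apply: (le_trans (stab_ge0 Omega M s0 sigma0 k (fun x => t * u x + v x))).
rewrite -stab_bil_diag stab_bil_lin// ![stab_bil _ (fun x => _ + _)]stab_bilC.
rewrite !stab_bil_lin// (stab_bilC v u) le_eqVlt; apply/orP; left; apply/eqP.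
ring.
Qed.

Lemma tsum_L2_Omega u : is_tsum u -> L2 Omega u.
Proof.
move=> tu; have mO := open_measurable_rV oO.
apply: (L2_subset (measurable_fict sigma Omega) mO (subset_fict_dom sigma0 oO)).
exact: fict_tsum_L2.
Qed.

Definition A_bil (eps : R) (u v : Rd -> R) : R :=
  \int[mu]_(x in Omega) (u x * v x) + eps * stab_bil u v.

Lemma A_bilC eps u v : A_bil eps u v = A_bil eps v u.
Proof.
rewrite /A_bil stab_bilC; congr (_ + _).
by apply: eq_Rintegral => x _; rewrite mulrC.
Qed.

Lemma A_bil_lin eps (t : R) u v w : is_tsum u -> is_tsum v -> is_tsum w ->
  A_bil eps (fun x => t * u x + v x) w = t * A_bil eps u w + A_bil eps v w.
Proof.
move=> tu tv tw; rewrite /A_bil stab_bil_lin// Rintegral_mul_lin.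
- ring.
- exact: open_measurable_rV.
- exact: tsum_L2_Omega.
- exact: tsum_L2_Omega.
- exact: tsum_L2_Omega.
Qed.

Lemma A_bil_diag eps u : A_bil eps u u = sqint Omega u + eps * stab sigma Omega M s0 k u.
Proof.
by [].
Qed.

(** The cut elements are all listed in [s0], and on them the weak derivatives of the truncated
    functions agree almost everywhere with the classical ones. *)
Lemma A_formE eps u v : is_tsum u -> is_tsum v ->
  A_form sigma Omega M P eps (u \_ fict) (v \_ fict) = A_bil eps u v.
Proof.
move=> tu tv; rewrite /A_form /A_bil; congr (_ + eps * _).
  apply: eq_Rintegral => x /set_mem /(subset_fict_dom sigma0 oO) xO.
  by rewrite !patchE mem_set.
rewrite /stab_form /stab_bil; congr (_ * _).
rewrite -[RHS]big_filter [RHS]fsbig_seq ?filter_uniq//.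
rewrite (_ : [set i | elem i `<=` _] = [set` [seq i <- s0 | cutp sigma Omega M i]]); last first.
  apply/seteqP; split=> [i /= ic|i /=]; rewrite mem_filter; last by move=> /andP[/asboolP].
  apply/andP; split; first exact/asboolP.
  exact: (elem_mem_list s0P (cut_fict sigma0 ic)).
apply: eq_fsbigr => i /set_mem /=; rewrite mem_filter => /andP[/asboolP ic _].
have iO := cut_fict sigma0 ic.
apply: eq_bigr => a _.
have mi := measurable_elem sigma i; have mf := measurable_fict sigma Omega.
have oF : open fict by exact: open_elems_dom.
have LF (g : Rd -> R) s : is_tsum g -> L2 fict (iter_partial s g).
  by move=> tg; apply: fict_tsum_L2 => //; exact: is_tsum_iter_partial.
have [Lu aeu] := wpartial_tsum oF tu (fun s => LF u s tu) a.
have [Lv aev] := wpartial_tsum oF tv (fun s => LF v s tv) a.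
congr fine; apply: ae_eq_integral => //.
- exact: (measurable_int _ (L2_mul_integrable mi (L2_subset mf mi iO Lu) (L2_subset mf mi iO Lv))).
- exact: (measurable_int _ (L2_mul_integrable mi (L2_subset mf mi iO (LF _ _ tu))
    (L2_subset mf mi iO (LF _ _ tv)))).
- by apply: filterS2 aeu aev => x hu hv xi; rewrite hu ?hv//; exact: iO.
Qed.

End galerkin_space.

(** Squaring the sum and dividing by [b] absorbs the energy [b] of the right-hand sides without
    taking roots. *)
Lemma le_of_sqr_bounds (R : realDomainType) (b p1 p2 p3 c1 c2 c3 : R) :
  0 <= b -> 0 <= c1 -> 0 <= c2 -> 0 <= c3 -> b = p1 + p2 - p3 ->
  p1 ^+ 2 <= c1 * b -> p2 ^+ 2 <= c2 * b -> p3 ^+ 2 <= c3 * b ->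
  b <= 3 * (c1 + c2 + c3).
Proof.
rewrite le_eqVlt => /predU1P[<-|b0] c10 c20 c30; first by rewrite mulr_ge0// !addr_ge0.
move=> e h1 h2 h3; rewrite -(ler_pM2r b0) -expr2.
have : b ^+ 2 <= 3 * (p1 ^+ 2 + p2 ^+ 2 + p3 ^+ 2).
  rewrite e; have := sqr_ge0 (p1 - p2); have := sqr_ge0 (p1 + p3).
  have := sqr_ge0 (p2 + p3); nra.
lra.
Qed.

Lemma sqr_sum4_le (R : realDomainType) (a b c e : R) :
  (a + b - c - e) ^+ 2 <= 4 * (a ^+ 2 + b ^+ 2 + c ^+ 2 + e ^+ 2).
Proof.
have := sqr_ge0 (a - b); have := sqr_ge0 (a + c); have := sqr_ge0 (a + e).
have := sqr_ge0 (b + c); have := sqr_ge0 (b + e); have := sqr_ge0 (c - e).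
nra.
Qed.

(** Of the two factors [t] in the square one is spent on [t * s2 <= b], just as [eps] times the
    penalty is bounded by the energy. *)
Lemma sqr_scale_le (R : realDomainType) (t r s1 s2 y b : R) : 0 <= t ->
  r ^+ 2 <= s1 * s2 -> 0 <= s1 -> 0 <= s2 -> s1 <= y -> t * s2 <= b ->
  (t * r) ^+ 2 <= t * y * b.
Proof.
move=> t0 rs s10 s20 s1y s2b; rewrite exprMn.
apply: (le_trans (ler_wpM2l (sqr_ge0 t) rs)).
rewrite (_ : t ^+ 2 * _ = t * (s1 * (t * s2))); last by ring.
by rewrite -mulrA ler_wpM2l// ler_pM// mulr_ge0.
Qed.

(** * The dual norm on sums of tensor products *)

Section dual_bound.
Context {R : realType} {d : nat}.
Notation Rd := 'rV[R]_d.
Variables (k : nat) (U : set Rd) (G : (Rd -> R) -> R) (X : R).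
Hypotheses (oU : open U) (LU : forall v s, is_tsum v -> L2 U (iter_partial s v)).
Hypothesis GZ : forall t f, sobolev k U f -> G (fun x => t * f x) = t * G f.
Hypothesis GX : (dual_norm k U G <= X%:E)%E.

(** The supremum over the unit ball becomes a homogeneous bound after scaling [v] by [N^(-1/2)]. *)
Lemma dual_norm_tsum v : is_tsum v ->
  G (v \_ U) ^+ 2 <=
  X ^+ 2 * \sum_(a : @multi d k | (morder a <= k)%N) sqint U (partial a v).
Proof.
move=> tv; set N := \sum_(a | _) _; have mU := open_measurable_rV oU.
have N0 : 0 <= N by rewrite sumr_ge0// => a _; exact: sqint_ge0.
have sv : sobolev k U (v \_ U) by apply: sobolev_tsum => // s; exact: LU.
have key t : t ^+ 2 * N <= 1 -> `|t * G (v \_ U)| <= X.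
  move=> tN; rewrite -GZ//; set f := fun x => _.
  have ef : f = (fun x => t * v x) \_ U.
    by apply/funext => x; rewrite /f !patchE; case: ifP; rewrite ?mulr0.
  have tt : is_tsum (fun x => t * v x) by exact: is_tsumZ.
  have sf : sobolev k U f by rewrite ef; apply: sobolev_tsum => // s; exact: LU.
  have nf : sobolev_norm k U f <= 1.
    rewrite -(@ler_pXn2r _ 2)// ?nnegrE ?sobolev_norm_ge0// expr1n ef.
    rewrite (sobolev_norm_tsum k oU tt); last by move=> s; exact: LU.
    apply: le_trans tN; rewrite mulr_sumr ler_sum// => a _.
    by rewrite /partial iter_partialZ// sqintZ//; exact: LU.
  by rewrite -lee_fin; apply: le_trans GX; apply: ereal_sup_ubound; exists f.
have X0 : 0 <= X by have := key 0; rewrite expr0n mul0r mul0r normr0; apply.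
move: N0; rewrite le_eqVlt => /predU1P[N0|N0].
  (* If [N = 0], every multiple of [v] is in the unit ball; were [G] nonzero at [v], some multiple
     would give the value [X + 1]. *)
  rewrite -N0 mulr0; have [->|G0] := eqVneq (G (v \_ U)) 0; first by rewrite expr0n.
  have := key ((X + 1) / G (v \_ U)); rewrite -N0 mulr0 mulfVK//.
  by move=> /(_ ler01); rewrite leNgt (lt_le_trans _ (ler_norm _))// ltrDl.
have s0 : 0 < Num.sqrt N by rewrite sqrtr_gt0.
have := key (Num.sqrt N)^-1; rewrite exprVn (sqr_sqrtr (ltW N0)) mulVf ?gt_eqF//.
move=> /(_ (lexx _)) h.
have : `|(Num.sqrt N)^-1 * G (v \_ U)| ^+ 2 <= X ^+ 2 by rewrite lerXn2r ?nnegrE.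
by rewrite real_normK ?num_real// exprMn exprVn (sqr_sqrtr (ltW N0)) mulrC ler_pdivrMr.
Qed.

End dual_bound.

(** * The discrete problem: solvability, energy error, duality *)

Section galerkin_method.
Context {R : realType} {d : nat}.
Variable P : nat.
Notation Rd := 'rV[R]_d.
Notation mu := (@leb R d).
Notation index := {ffun 'I_d -> int}.
Implicit Types (i j : index) (c : index -> @multi d P -> R).

Variables (sigma : R) (Omega : set Rd) (M : set index) (s0 : seq index).
Hypotheses (sigma0 : 0 < sigma) (sigma1 : sigma <= 1) (oO : open Omega) (us0 : uniq s0).
Notation elem := (@elem R d sigma).
Notation fict := (fict_dom sigma Omega).
Hypothesis s0P : forall i, elem i `<=` fict ->
  forall j, (forall l, `|i l - j l| <= 1) -> j \in s0.
Hypothesis bO : exists r : R, forall x, fict x -> forall l, `|x ord0 l| <= r.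
Let k := P.+1.
Variables (eps Cc Ci : R).
Hypothesis eps0 : 0 < eps.
Notation V := (Vfun sigma s0).
Notation stab := (stab sigma Omega M s0 k).
Notation A := (A_bil P sigma Omega M s0 eps).
Notation fictp := (fictp sigma Omega).
Hypothesis Cc0 : 0 <= Cc.
Hypothesis coercive : forall c, \sum_(i <- s0 | fictp i) sqint (elem i) (V c) <=
  Cc * (sqint Omega (V c) + stab (V c)).
Hypothesis Ci0 : 0 <= Ci.
Hypothesis inverse : forall c i (a : @multi d k),
  sigma ^+ (2 * morder a) * sqint (elem i) (partial a (V c)) <=
  Ci * sqint (elem i) (V c).

Let tV c : is_tsum (V c). Proof. exact: Vfun_tsum. Qed.

Let mO : measurable Omega. Proof. exact: open_measurable_rV. Qed.

Let LO v s : is_tsum v -> L2 Omega (iter_partial s v).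
Proof. by move=> tv; apply: (tsum_L2_Omega sigma0 oO bO); exact: is_tsum_iter_partial. Qed.

Let LV c : L2 Omega (V c). Proof. exact: (LO [::] (tV c)). Qed.

Lemma A_diag_ge0 c : 0 <= A (V c) (V c).
Proof.
rewrite A_bil_diag addr_ge0 ?sqint_ge0// mulr_ge0 ?(ltW eps0)//.
exact: stab_ge0.
Qed.

Lemma sqint_le_A c : sqint Omega (V c) <= A (V c) (V c).
Proof. by rewrite A_bil_diag lerDl mulr_ge0 ?(ltW eps0)// stab_ge0. Qed.

Lemma stab_le_A c : eps * stab (V c) <= A (V c) (V c).
Proof. by rewrite A_bil_diag lerDr sqint_ge0. Qed.

Lemma coercive_A c : \sum_(i <- s0 | fictp i) sqint (elem i) (V c) <=
  Cc * (1 + eps^-1) * A (V c) (V c).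
Proof.
apply: (le_trans (coercive c)); rewrite -mulrA ler_wpM2l// mulrDl mul1r lerD//.
  exact: sqint_le_A.
by rewrite ler_pdivlMl// stab_le_A.
Qed.

Lemma A_eq0 c : A (V c) (V c) = 0 -> forall x, fict x -> V c x = 0.
Proof.
move=> A0; apply: (fict_sum_eq0 sigma0 s0P (tV c)).
apply/eqP; rewrite eq_le sumr_ge0 ?andbT => [|i _]; last exact: sqint_ge0.
by have := coercive_A c; rewrite A0 mulr0.
Qed.

(** The inverse estimate is valid on whole elements only. So the integral over [Omega] is enlarged
    to the elements of the fictitious domain, and coercivity leads back to the energy. Lower orders
    are covered by [sigma <= 1]. *)
Lemma inverse_A c : sigma ^+ (2 * k) *
    (\sum_(a : @multi d k | (morder a <= k)%N) sqint Omega (partial a (V c))) <=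
  #|@multi d k|%:R * (Ci * (Cc * (1 + eps^-1))) * A (V c) (V c).
Proof.
set D := Ci * _.
have D0 : 0 <= D * A (V c) (V c).
  apply: mulr_ge0 (A_diag_ge0 c); do 2 (apply: mulr_ge0 => //).
  by rewrite addr_ge0// invr_ge0 ltW.
have -> : #|@multi d k|%:R * D * A (V c) (V c) = \sum_(a : @multi d k) D * A (V c) (V c).
  by rewrite sumr_const -[RHS]mulr_natl [RHS]mulrA.
rewrite [leRHS](bigID (fun a : @multi d k => (morder a <= k)%N))/=.
rewrite mulr_sumr -[leLHS]addr0 lerD ?sumr_ge0//; apply: ler_sum => a ak.
apply: (@le_trans _ _ (sigma ^+ (2 * morder a) * sqint Omega (partial a (V c)))).
  by rewrite ler_wpM2r ?sqint_ge0// ler_wiXn2l// ?(ltW sigma0)// leq_mul2l.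
apply: (@le_trans _ _ (sigma ^+ (2 * morder a) *
    \sum_(i <- s0 | fictp i) sqint (elem i) (partial a (V c)))).
  rewrite ler_wpM2l ?exprn_ge0 ?(ltW sigma0)//.
  by apply: Omega_sum_le => //; exact: is_tsum_iter_partial.
rewrite mulr_sumr; apply: (@le_trans _ _ (\sum_(i <- s0 | fictp i) Ci * sqint (elem i) (V c))).
  by apply: ler_sum => i _; exact: inverse.
by rewrite -mulr_sumr /D -mulrA ler_wpM2l// coercive_A.
Qed.

(** Extension by zero of coefficients indexed by a finite type, the form in which [galerkin_exists]
    is applied. *)
Let coef (x : seq_sub s0 * @multi d P -> R) i (a : @multi d P) : R :=
  if insub i is Some r then x (r, a) else 0.

Let coef_lin t x y :
  coef (fun p => t * x p + y p) = fun i a => t * coef x i a + coef y i a.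
Proof.
apply/funext => i; apply/funext => a; rewrite /coef.
by case: insubP => // _; rewrite mulr0 addr0.
Qed.

Let V_coef c : V c = V (coef (fun p => c (val p.1) p.2)).
Proof.
apply/funext => x; apply: eq_big_seq => i is0; apply: eq_bigr => a _.
by rewrite /coef insubT.
Qed.

Section solution.
Variable uh : (Rd -> R) -> R.
Hypothesis uh_dual : sobolev_dual k Omega uh.

Let uh_lin (t : R) c c' : uh ((V (fun i a => t * c i a + c' i a)) \_ Omega) =
  t * uh (V c \_ Omega) + uh (V c' \_ Omega).
Proof.
have sV c1 : sobolev k Omega (V c1 \_ Omega).
  by apply: sobolev_tsum => // s; exact: LO.
rewrite -(uh_dual.1 t _ _ (sV c) (sV c')); congr uh; apply/funext => x.
by rewrite Vfun_lin !patchE; case: ifP => //; rewrite mulr0 addr0.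
Qed.

Lemma fict_restrict (v : Rd -> R) : (v \_ fict) \_ Omega = v \_ Omega.
Proof.
apply/funext => x; rewrite !patchE; case: ifPn => // /set_mem xO.
by rewrite mem_set//; exact: (subset_fict_dom sigma0 oO).
Qed.

Lemma solutionP c : is_solution sigma Omega M P eps uh (V c \_ fict) <->
  forall c', A (V c) (V c') = uh (V c' \_ Omega).
Proof.
split=> [[_ h] c'|h].
  have := h (V c' \_ fict); rewrite (A_formE P M sigma0 oO us0 s0P bO)// fict_restrict.
  by apply; apply/(V_spaceP P sigma0 us0 s0P); exists c'.
split; first by apply/(V_spaceP P sigma0 us0 s0P); exists c.
move=> v /(V_spaceP P sigma0 us0 s0P)[c' ->].
by rewrite (A_formE P M sigma0 oO us0 s0P bO)// fict_restrict.
Qed.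

Lemma solution_exists : exists c, is_solution sigma Omega M P eps uh (V c \_ fict).
Proof.
pose J : finType := (seq_sub s0 * @multi d P)%type.
have [z|z||z|x hx] := @galerkin_exists R J (fun x y => A (V (coef x)) (V (coef y)))
    (fun x => uh (V (coef x) \_ Omega)).
- by move=> t x y; rewrite coef_lin Vfun_lin (A_bil_lin P M s0 sigma0 oO bO).
- by move=> t x y; rewrite coef_lin Vfun_lin A_bilC (A_bil_lin P M s0 sigma0 oO bO)// ![A _ (V (coef z))]A_bilC.
- by move=> t x y; rewrite coef_lin uh_lin.
(* The compatibility condition: zero energy makes the function vanish on [Omega], and [uh] vanishes
   at 0 by linearity. *)
- move=> /A_eq0 V0.
  have -> : V (coef z) \_ Omega = fun=> 0.
    apply/funext => x; rewrite patchE; case: ifPn => // /set_mem xO.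
    by apply: V0; exact: (subset_fict_dom sigma0 oO).
  have s00 : sobolev k Omega (fun=> 0 : R).
    have h : sobolev k Omega ((fun=> 0 : R) \_ Omega).
      by apply: sobolev_tsum => // [|s]; [|apply: LO]; exact: is_tsum0.
    by rewrite (_ : (fun=> 0) = (fun=> 0) \_ Omega)//; apply/funext => x; rewrite patchE; case: ifP.
  have := uh_dual.1 1 _ _ s00 s00; set v := (X in uh X = _).
  have -> : v = fun=> 0 by apply/funext => x; rewrite /v mul1r addr0.
  by move=> h; lra.
exists (coef x); apply/solutionP => c; rewrite (V_coef c); exact: hx.
Qed.

(** The difference of two solutions has zero energy and therefore vanishes on the fictitious domain,
    while its coefficients may be nonzero. *)
Lemma solution_unique c us : is_solution sigma Omega M P eps uh (V c \_ fict) ->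
  is_solution sigma Omega M P eps uh us -> us = V c \_ fict.
Proof.
move=> sc sus; have [c' e] : exists c', us = V c' \_ fict.
  by apply/(V_spaceP P sigma0 us0 s0P); case: sus.
rewrite e in sus *; move/solutionP : sc => hc; move/solutionP : sus => hc'.
pose b i a := -1 * c i a + c' i a.
have bE : V b = fun x => -1 * V c x + V c' x by exact: Vfun_lin.
have /A_eq0 b0 : A (V b) (V b) = 0.
  rewrite {1}bE (A_bil_lin P M s0 sigma0 oO bO)// hc hc'; ring.
apply/funext => x; rewrite !patchE; case: ifPn => // /set_mem xO.
have := b0 x xO; rewrite bE mulN1r => h; lra.
Qed.

Variables (cs cu : index -> @multi d P -> R) (u : Rd -> R) (X Y : R).
Hypothesis sol : forall c, A (V cs) (V c) = uh (V c \_ Omega).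
Hypothesis Lu : L2 Omega u.
Let N (v : Rd -> R) := \sum_(a : @multi d k | (morder a <= k)%N) sqint Omega (partial a v).
(** The consistency functional u_h - u on discrete functions. Below, [X] stands for the square of a
    bound on its dual norm and [Y] for a bound on the squared interpolation errors of [u]. *)
Let G c := uh (V c \_ Omega) - \int[mu]_(x in Omega) (u x * V c x).
Hypothesis GX : forall c, G c ^+ 2 <= X * N (V c).
Hypothesis X0 : 0 <= X.
Hypothesis uY : sqint Omega (fun x => u x - V cu x) <= Y.
Hypothesis sY : stab (V cu) <= Y.
Let e := V (fun i a => -1 * cu i a + cs i a).

Let Y0 : 0 <= Y. Proof. by apply: le_trans uY; exact: sqint_ge0. Qed.

Let eE : e = fun x => -1 * V cu x + V cs x. Proof. exact: Vfun_lin. Qed.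

Let te : is_tsum e. Proof. exact: tV. Qed.

Let int_subl v1 v2 w : L2 Omega v1 -> L2 Omega v2 -> L2 Omega w ->
  \int[mu]_(x in Omega) ((v1 x - v2 x) * w x) =
  \int[mu]_(x in Omega) (v1 x * w x) - \int[mu]_(x in Omega) (v2 x * w x).
Proof.
move=> L1 L2' Lw; have := Rintegral_mul_lin (-1) mO L2' L1 Lw.
rewrite mulN1r addrC => <-; apply: eq_Rintegral => x _.
by rewrite mulN1r addrC.
Qed.

(* The inverse estimate costs [sigma ^- (2 * P.+1)], which is why the
   consistency error [X] of [uh] has to be of the order of [sigma ^+ (4 * P.+1)]. *)
Lemma energy_error (X3 : R) : 0 <= X3 ->
  X * (#|@multi d k|%:R * (Ci * (Cc * (1 + eps^-1)))) <= X3 * sigma ^+ (2 * k) ->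
  A e e <= 3 * (X3 + Y + eps * Y).
Proof.
move=> X30 XX3; set b := A e e.
have q0 : 0 < sigma ^+ (2 * k) by rewrite exprn_gt0.
have b0 : 0 <= b by exact: A_diag_ge0.
pose p2 := \int[mu]_(x in Omega) ((u x - V cu x) * e x).
pose p3 := eps * stab_bil P sigma Omega M s0 (V cu) e.
apply: (@le_of_sqr_bounds _ b (G (fun i a => -1 * cu i a + cs i a)) p2 p3 X3 Y (eps * Y)) => //.
- by rewrite mulr_ge0// ltW.
- rewrite /b {1}eE (A_bil_lin P M s0 sigma0 oO bO)// sol /G -/e /p2 /p3 int_subl//; last exact: LV.
  rewrite /A_bil; ring.
- rewrite -(ler_pM2l q0); apply: (@le_trans _ _ (X * (sigma ^+ (2 * k) * N e))).
    by rewrite [leRHS]mulrCA ler_wpM2l ?(ltW q0)//; exact: GX.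
  apply: (le_trans (ler_wpM2l X0 (inverse_A _))); rewrite [leLHS]mulrA.
  by apply: (le_trans (ler_wpM2r b0 XX3)); rewrite [leRHS]mulrCA mulrA.
- apply: (le_trans (CS_sqint mO (L2B mO Lu (LV cu)) (LV _))).
  by apply: ler_pM => //; [exact: sqint_ge0|exact: sqint_ge0|exact: sqint_le_A].
- apply: (sqr_scale_le (ltW eps0) (stab_bil_CS P Omega M s0 sigma0 (tV cu) te)) => //.
  + exact: stab_ge0.
  + exact: stab_ge0.
  + exact: stab_le_A.
Qed.

(** The higher order in the dual norm comes from the smoothness of the test function itself, without
    an auxiliary dual problem: its interpolant is the discrete test function. Apart from the
    consistency term, every summand pairs an error of u_sigma or of its interpolant with one of
    [f]. *)
Lemma duality_error (B Z Z' : R) (f : Rd -> R) (cf : index -> @multi d P -> R) : A e e <= B -> L2 Omega f ->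
  sqint Omega (fun x => f x - V cf x) <= Z -> stab (V cf) <= Z -> N (V cf) <= Z' ->
  (\int[mu]_(x in Omega) ((V cs x - u x) * f x)) ^+ 2 <=
  4 * ((2 * B + 2 * Y) * Z + X * Z' + eps * B * Z + eps ^+ 2 * (Y * Z)).
Proof.
move=> eB Lf fZ sZ NZ.
have Lcu : L2 Omega (fun x => u x - V cu x) by exact: L2B.
have Lcs : L2 Omega (fun x => V cs x - u x) by exact: L2B.
have Lcf : L2 Omega (fun x => f x - V cf x) by exact: L2B.
pose t1 := \int[mu]_(x in Omega) ((V cs x - u x) * (f x - V cf x)).
pose t3 := eps * stab_bil P sigma Omega M s0 e (V cf).
pose t4 := eps * stab_bil P sigma Omega M s0 (V cu) (V cf).
(* On [V cf] the discrete equation replaces the integral of [V cs * V cf] by [uh] minus the penalty,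
   which is split according to [V cs = V cu + e]. *)
rewrite (_ : \int[mu]_(x in Omega) _ = t1 + G cf - t3 - t4); last first.
  have e1 : t1 = \int[mu]_(x in Omega) ((V cs x - u x) * f x) -
      \int[mu]_(x in Omega) ((V cs x - u x) * V cf x).
    transitivity (\int[mu]_(x in Omega) ((f x - V cf x) * (V cs x - u x))).
      by apply: eq_Rintegral => x _; rewrite mulrC.
    by rewrite [LHS]int_subl//; congr (_ - _); apply: eq_Rintegral => x _; rewrite mulrC.
  have e2 : eps * stab_bil P sigma Omega M s0 (V cs) (V cf) = t3 + t4.
    rewrite /t3 /t4 eE (stab_bil_lin P Omega M s0 sigma0)//; ring.
  have := sol cf; rewrite /A_bil e2 e1 !int_subl// /G => <-; ring.
apply: (le_trans (sqr_sum4_le _ _ _ _)); rewrite ler_pM2l//.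
have b0 : 0 <= A e e by exact: A_diag_ge0.
have st0 v : 0 <= stab v by exact: stab_ge0.
have sq0 v : 0 <= sqint Omega v by exact: sqint_ge0.
apply: lerD; [apply: lerD; [apply: lerD|]|].
- apply: (le_trans (CS_sqint mO Lcs Lcf)); apply: ler_pM => //.
  rewrite (@sqint_eq _ _ _ _ (fun x => e x - (u x - V cu x))); last first.
    by move=> x _; rewrite eE; ring.
  apply: (le_trans (sqintB_le mO (LV _) Lcu)); rewrite lerD// ler_pM2l//.
  by apply: le_trans eB; exact: sqint_le_A.
- by apply: (le_trans (GX cf)); rewrite ler_wpM2l.
- rewrite (_ : eps * B * Z = eps * Z * B); last by ring.
  apply: (sqr_scale_le (ltW eps0) _ (st0 (V cf)) (st0 e)) => //.
    rewrite [leRHS]mulrC; exact: (stab_bil_CS P Omega M s0 sigma0 te (tV cf)).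
  by apply: le_trans eB; exact: stab_le_A.
- rewrite /t4 exprMn.
  apply: (le_trans (ler_wpM2l (sqr_ge0 eps) (stab_bil_CS P Omega M s0 sigma0 (tV cu) (tV cf)))).
  by rewrite ler_wpM2l ?sqr_ge0// ler_pM.
Qed.

End solution.
End galerkin_method.

(** * Assembly of the error bound *)

Lemma fict_bounded (R : realType) (d : nat) (sigma : R) (Omega : set 'rV[R]_d)
    (s : seq {ffun 'I_d -> int}) : 0 < sigma ->
  (forall i, elem sigma i `<=` fict_dom sigma Omega -> i \in s) ->
  exists r : R, forall x, fict_dom sigma Omega x -> forall l, `|x ord0 l| <= r.
Proof.
move=> sigma0 sP; pose B (i : {ffun 'I_d -> int}) l := (`|(i l)%:~R| + 1) * sigma.
have B0 i l : 0 <= B i l by rewrite mulr_ge0 ?(ltW sigma0)// addr_ge0.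
exists (\sum_(i <- s) \sum_l B i l) => x /interior_subset[i /=].
rewrite -elem_fict_dom// closure_elem// => /sP is0 xi l.
apply: (@le_trans _ _ (B i l)).
  have /andP[h1 h2] := xi l; have a := ler_norm ((i l)%:~R : R).
  have b := ler_norm (- (i l)%:~R : R); rewrite normrN in b.
  have := sigma0; rewrite /B ler_norml; move: h1 h2; nra.
rewrite (perm_big _ (perm_to_rem is0)) big_cons (bigD1 l)//= -addrA lerDl.
by rewrite addr_ge0// sumr_ge0// => j _; rewrite sumr_ge0.
Qed.

(** Linearity with coefficient [t - 1] and both functions equal to [f] gives homogeneity at once. *)
Lemma sobolev_dualZ (R : realType) (d k : nat) (U : set 'rV[R]_d) F (t : R) f :
  sobolev_dual k U F -> sobolev k U f -> F (fun x => t * f x) = t * F f.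
Proof.
move=> [lF _] sf; have := lF (t - 1) f f sf sf.
rewrite (_ : (fun x => _) = fun x => t * f x); last by apply/funext => x; ring.
by move=> ->; ring.
Qed.

Lemma sqr_le_mul (R : realDomainType) (a b c : R) : 0 <= a -> a <= b * c ->
  a ^+ 2 <= b ^+ 2 * c ^+ 2.
Proof. by move=> a0 abc; rewrite -exprMn lerXn2r ?nnegrE// (le_trans a0). Qed.

Lemma norm_le_of_sqr (R : realDomainType) (a b : R) : 0 <= b -> a ^+ 2 <= b ^+ 2 -> `|a| <= b.
Proof.
by move=> b0; rewrite -[X in X <= _](@real_normK R) ?num_real// ler_pXn2r ?nnegrE.
Qed.

Lemma sqr_sqrtr_mul (R : rcfType) (D q n : R) : 0 <= D ->
  (Num.sqrt D * q * n) ^+ 2 = D * q ^+ 2 * n ^+ 2.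
Proof. by move=> D0; rewrite !exprMn sqr_sqrtr. Qed.

Unset Implicit Arguments.
Set Strict Implicit.

Theorem theorem3p6 (R : realType) (d m P : nat) (Omega : set 'rV[R]_d)
    (M : R -> set {ffun 'I_d -> int}) (sigma1 : R) :
  (0 < d)%N -> P = m -> d%:R / 2 < m.+1%:R :> R ->
  open Omega -> connected Omega -> Omega !=set0 -> bounded_set Omega ->
  (forall k : nat, has_extension k Omega) ->
  0 < sigma1 ->
  (exists K : nat, forall sigma : R, 0 < sigma < sigma1 ->
     chain_condition sigma Omega (M sigma) K) ->
  (exists C : R, forall sigma : R, 0 < sigma < sigma1 ->
     local_approximation sigma Omega P C) ->
  forall eps : R, 0 < eps ->
  forall C : R,
  exists Ceps sigma0 : R, 0 < sigma0 /\
  forall sigma h : R, 0 < sigma < sigma0 -> h = sigma ^+ 2 ->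
  forall u : 'rV[R]_d -> R, sobolev P.+1 Omega u ->
  forall uh : ('rV[R]_d -> R) -> R, sobolev_dual P.+1 Omega uh ->
  (dual_norm P.+1 Omega (fun f => (uh f - L2_functional Omega u f)%R)
     <= (C * h ^+ P.+1 * sobolev_norm P.+1 Omega u)%:E)%E ->
  exists us : 'rV[R]_d -> R,
    [/\ is_solution sigma Omega (M sigma) P eps uh us,
        forall us', is_solution sigma Omega (M sigma) P eps uh us' ->
          us' = us &
        (dual_norm P.+1 Omega
           (fun f =>
              (L2_functional Omega us f - L2_functional Omega u f)%R)
         <= (Ceps * h ^+ P.+1 * sobolev_norm P.+1 Omega u)%:E)%E].
Proof.
move=> _ _ _ oO _ _ bO ext s10 [K chain] [CL approx] eps eps0 C.
have [CI CI0 interp] := @interpolation R d P CL.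
have [Ci Ci0 inv] := @elem_inverse R d P P.+1.
have [Cg Cg0 ghost] := @elem_ghost R d P P.+1.
have [E [CE [_ hE]]] := ext P.+1.
(* The added 1 ensures [1 <= cg], so that powers of [2 * cg] grow along a chain. *)
pose cg := 1 + Cg.
pose Cc := (2 * cg) ^+ K.+1 * #|{: {ffun 'I_d -> 'I_(K.*2.+1)}}|%:R.
pose nm : R := #|@multi d P.+1|%:R.
(* Constants for squared quantities: [D1] for the inverse estimate in terms of the energy, [Y1] for
   interpolation after extension, [D2] for the energy error and [D3] for the duality bound. They
   involve [eps], but neither [sigma] nor [u]. *)
pose D1 := nm * (Ci * (Cc * (1 + eps^-1))).
pose Y1 := CI * CE ^+ 2.
pose D2 := 3 * (C ^+ 2 * D1 + Y1 + eps * Y1).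
pose D3 := 4 * ((2 * D2 + 2 * Y1) * Y1 + C ^+ 2 * (nm * Y1) + eps * D2 * Y1 + eps ^+ 2 * (Y1 * Y1)).
have cg1 : 1 <= cg by rewrite lerDl.
have Cc0 : 0 <= Cc by rewrite /Cc mulr_ge0// exprn_ge0//; lra.
have nm0 : 0 <= nm by exact: ler0n.
have D10 : 0 <= D1.
  by do 3 (apply: mulr_ge0 => //); rewrite addr_ge0// invr_ge0 ltW.
have Y10 : 0 <= Y1 by apply: mulr_ge0 => //; exact: sqr_ge0.
have C20 : 0 <= C ^+ 2 by exact: sqr_ge0.
have mO := open_measurable_rV oO.
(* The root returns from squares to norms. The threshold 1 is there for dropping surplus powers of
   [sigma]. *)
exists (Num.sqrt D3), (Num.min sigma1 1); split; first by rewrite lt_min s10/=.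
move=> sigma h /andP[sigma0]; rewrite lt_min => /andP[lt_s1 /ltW s1] ->.
have s01 : 0 < sigma < sigma1 by rewrite sigma0.
move=> u su uh duh hdual.
have [s0 us0 s0P] := fict_index_list sigma0 bO.
have bF : exists r : R, forall x, fict_dom sigma Omega x -> forall l, `|x ord0 l| <= r.
  by apply: (fict_bounded sigma0) => i; exact: (elem_mem_list s0P).
pose q := sigma ^+ (2 * P.+1); have q0 : 0 <= q by rewrite exprn_ge0// ltW.
have hq : (sigma ^+ 2) ^+ P.+1 = q by rewrite -exprM.
rewrite hq in hdual *.
pose U2 := sobolev_norm P.+1 Omega u ^+ 2; have U20 : 0 <= U2 by exact: sqr_ge0.
have coer c : \sum_(i <- s0 | fictp sigma Omega i) sqint (elem sigma i) (Vfun sigma s0 c) <=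
    Cc * (sqint Omega (Vfun sigma s0 c) + stab sigma Omega (M sigma) s0 P.+1 (Vfun (P := P) sigma s0 c)).
  apply: (chain_sum_le sigma0 oO us0 s0P bF (chain sigma s01) cg1) => i j ij.
  apply: (le_trans (ghost sigma sigma0 s0 c i j ij)); rewrite ler_wpM2r//.
    rewrite addr_ge0 ?sqint_ge0// mulr_ge0 ?exprn_ge0 ?(ltW sigma0)//.
    by rewrite sumr_ge0// => a _; exact: sqint_ge0.
  by rewrite lerDr.
have LO v s : is_tsum v -> L2 Omega (iter_partial s v).
  by move=> tv; apply: (tsum_L2_Omega sigma0 oO bF); exact: is_tsum_iter_partial.
have tV c : is_tsum (Vfun (P := P) sigma s0 c) by exact: Vfun_tsum.
have invV c i a := inv sigma sigma0 s0 c i a.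
(* Interpolation takes place on the fictitious domain, which sticks out of [Omega], so [f] is first
   extended to the whole space. On [Omega] the extension may be replaced by [f] again. *)
have ext_interp f : sobolev P.+1 Omega f -> exists c, 
    [/\ sqint Omega (fun x => f x - Vfun sigma s0 c x) <=
          Y1 * q * sobolev_norm P.+1 Omega f ^+ 2,
        \sum_(a : @multi d P.+1 | (morder a <= P.+1)%N)
          sqint Omega (partial a (Vfun sigma s0 c)) <=
          nm * Y1 * sobolev_norm P.+1 Omega f ^+ 2 &
        stab sigma Omega (M sigma) s0 P.+1 (Vfun (P := P) sigma s0 c) <=
          Y1 * q * sobolev_norm P.+1 Omega f ^+ 2].
  move=> sf; have [sEf aef nEf] := hE f sf.
  have [c [h1 h2 h3]] := interp sigma Omega (M sigma) s0 sigma0 s1 oO us0 s0P bF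
    (approx sigma s01) (E f) sEf.
  have S2 : sobolev_norm P.+1 setT (E f) ^+ 2 <= CE ^+ 2 * sobolev_norm P.+1 Omega f ^+ 2.
    exact: (sqr_le_mul (sobolev_norm_ge0 _ _ _) nEf).
  move: (sobolev_norm P.+1 setT (E f) ^+ 2) (sqr_ge0 (sobolev_norm P.+1 setT (E f))) h1 h2 h3 S2.
  move: (sobolev_norm P.+1 Omega f ^+ 2) => Sf SE SE0 h1 h2 h3 S2.
  have S2' : CI * q * SE <= Y1 * q * Sf.
    rewrite (_ : Y1 * q * Sf = CI * q * (CE ^+ 2 * Sf)); last by rewrite /Y1; ring.
    by apply: ler_wpM2l => //; exact: mulr_ge0.
  exists c; split; last exact: le_trans S2'.
    apply: le_trans S2'; apply: le_trans h1; rewrite le_eqVlt; apply/orP; left; apply/eqP.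
    have LEf : L2 Omega (E f).
      exact: (L2_subset measurableT mO (@subsetT _ _) sEf.1).
    apply: (sqint_ae mO mO (@subset_refl _ _)).
    - by apply: L2B => //; [exact: sf.1|exact: (LO _ [::])].
    - by apply: L2B => //; exact: (LO _ [::]).
    - by apply: filterS aef => x hx /hx ->.
  have CS0 : 0 <= CI * SE by exact: mulr_ge0.
  apply: (@le_trans _ _ (\sum_(a : @multi d P.+1) CI * SE)).
    rewrite [leRHS](bigID (fun a : @multi d P.+1 => (morder a <= P.+1)%N))/=.
    rewrite -[leLHS]addr0; apply: lerD; first exact: ler_sum.
    exact: sumr_ge0.
  rewrite sumr_const -[leLHS]mulr_natl -/nm -[leRHS]mulrA; apply: ler_wpM2l => //.
  by rewrite /Y1 -[leRHS]mulrA; exact: ler_wpM2l.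
have [cu [hu1 _ hu3]] := ext_interp u su.
have [cs scs] := solution_exists sigma0 oO us0 s0P bF eps0 Cc0 coer duh.
have sol := (solutionP (M sigma) sigma0 oO us0 s0P bF eps uh cs).1 scs.
exists (Vfun sigma s0 cs \_ (fict_dom sigma Omega)); split=> //.
  by move=> us' sus; exact: (solution_unique sigma0 oO us0 s0P bF eps0 Cc0 coer scs sus).
pose X := C * q * sobolev_norm P.+1 Omega u.
have GX c : (uh (Vfun (P := P) sigma s0 c \_ Omega) -
     \int[leb d]_(x in Omega) (u x * Vfun sigma s0 c x)) ^+ 2 <=
    X ^+ 2 * \sum_(a : @multi d P.+1 | (morder a <= P.+1)%N)
      sqint Omega (partial a (Vfun sigma s0 c)).
  have := dual_norm_tsum oO LO _ hdual (tV c).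
  rewrite (_ : L2_functional Omega u _ = \int[leb d]_(x in Omega) (u x * Vfun sigma s0 c x)).
    apply=> t f sf; rewrite (sobolev_dualZ _ duh sf) mulrBr; congr (_ - _).
    rewrite /L2_functional -RintegralZl//; last exact: L2_mul_integrable su.1 sf.1.
    by apply: eq_Rintegral => x _; rewrite mulrCA.
  by apply: eq_Rintegral => x xO; rewrite patchE xO.
have X2 : X ^+ 2 = C ^+ 2 * q ^+ 2 * U2 by rewrite /X !exprMn.
have X20 : 0 <= X ^+ 2 by exact: sqr_ge0.
(* [X ^ 2] carries [q ^ 2], one factor of which pays for the inverse estimate; this determines
   [C ^ 2 * D1 * q * U2] as the value of [X3]. *)
have eB := @energy_error _ _ _ _ _ _ _ sigma0 s1 oO s0P bF _ _ _ eps0 Cc0 coer Ci0 invV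
  uh cs cu u (X ^+ 2) (Y1 * q * U2) sol su.1 GX X20 hu1 hu3 (C ^+ 2 * D1 * q * U2).
apply: ge_ereal_sup => _ [f [sf nf] <-]; rewrite lee_fin.
have [cf [hf1 hf2 hf3]] := ext_interp f sf.
have nf2 : sobolev_norm P.+1 Omega f ^+ 2 <= 1.
  by rewrite expr_le1 ?sobolev_norm_ge0.
have le1 a : 0 <= a -> a * sobolev_norm P.+1 Omega f ^+ 2 <= a by move=> a0; exact: ler_piMr.
(* For [f] in the unit ball its norm drops out of the interpolation bounds, which leaves
   [Z = Y1 * q] and [Z' = nm * Y1]. *)
have err := @duality_error _ _ _ _ _ _ _ sigma0 oO bF _ eps0
  uh cs cu u (X ^+ 2) (Y1 * q * U2) sol su.1 GX X20 hu1 hu3 (D2 * q * U2) (Y1 * q) (nm * Y1) f cf.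
rewrite (_ : _ - _ = \int[leb d]_(x in Omega) ((Vfun sigma s0 cs x - u x) * f x)); last first.
  have LVs : L2 Omega (Vfun (P := P) sigma s0 cs) by exact: (LO _ [::]).
  have := Rintegral_mul_lin (-1) mO su.1 LVs sf.1; rewrite mulN1r addrC => e.
  rewrite /L2_functional (@eq_Rintegral _ _ _ (leb d) Omega (fun x => Vfun sigma s0 cs x * f x)).
    by rewrite -e; apply: eq_Rintegral => x _; rewrite mulN1r addrC.
  move=> x /set_mem xO; rewrite patchE mem_set//.
  exact: (subset_fict_dom sigma0 oO).
set I := Rintegral _ _ _ in err *.
have D20 : 0 <= D2.
  by apply: mulr_ge0 => //; exact: addr_ge0 (addr_ge0 (mulr_ge0 C20 D10) Y10) (mulr_ge0 (ltW eps0) Y10).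
have D30 : 0 <= D3.
  have z1 : 0 <= (2 * D2 + 2 * Y1) * Y1.
    by apply: mulr_ge0 => //; apply: addr_ge0; exact: mulr_ge0.
  have z2 : 0 <= C ^+ 2 * (nm * Y1) by do 2 (apply: mulr_ge0 => //).
  have z3 : 0 <= eps * D2 * Y1 by do 2 (apply: mulr_ge0 => //); exact: ltW.
  have z4 : 0 <= eps ^+ 2 * (Y1 * Y1) by rewrite mulr_ge0 ?sqr_ge0//; exact: mulr_ge0.
  by apply: mulr_ge0 => //; exact: addr_ge0 (addr_ge0 (addr_ge0 z1 z2) z3) z4.
have rhs0 : 0 <= Num.sqrt D3 * q * sobolev_norm P.+1 Omega u.
  by rewrite !mulr_ge0 ?sqrtr_ge0.
apply: (norm_le_of_sqr rhs0); rewrite (sqr_sqrtr_mul _ _ D30) -/U2.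
(* Every summand carries [q ^ 2], either as one [q] from u and one from [f] or through [X ^ 2]; and
   [q] is [h ^ P.+1]. *)
have -> : D3 * q ^+ 2 * U2 =
    4 * ((2 * (D2 * q * U2) + 2 * (Y1 * q * U2)) * (Y1 * q) + X ^+ 2 * (nm * Y1) +
      eps * (D2 * q * U2) * (Y1 * q) + eps ^+ 2 * (Y1 * q * U2 * (Y1 * q))).
  by rewrite X2 /D3; ring.
apply: err.
- rewrite (_ : D2 * q * U2 = 3 * (C ^+ 2 * D1 * q * U2 + Y1 * q * U2 + eps * (Y1 * q * U2))); last first.
    by rewrite /D2; ring.
  apply: eB; first by do 3 (apply: mulr_ge0 => //).
  by rewrite -/nm -/D1 -/q X2 le_eqVlt; apply/orP; left; apply/eqP; ring.
- exact: sf.1.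
- by apply: (le_trans hf1); apply: le1; exact: mulr_ge0.
- by apply: (le_trans hf3); apply: le1; exact: mulr_ge0.
- by apply: (le_trans hf2); apply: le1; exact: mulr_ge0.
Qed.
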